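(* Let $\ell$ be a field, $E$ a graph, $R$ a purely infinite simple unital $\ell$-algebra, and $\xi:K_0(L(E))\to K_0(R)$ a group homomorphism. Let $\iota:R\to M_\infty(R)$, $\iota(a)=\epsilon_{1,1}\otimes a$, be the upper left corner inclusion. (i) If $E$ is countable, then there exists a nonzero algebra homomorphism $\psi:L(E)\to M_\infty R$ such that $K_0(\psi)=K_0(\iota)\xi$. (ii) If $E$ is finite, then there exists a nonzero algebra homomorphism $\psi:L(E)\to R$ such that $K_0(\psi)=\xi$. (iii) If $E^0$ is finite, $E^1$ is countable and $\xi$ is unital (that is, $\xi([1_{L(E)}])=[1_R]$), then there is a unital homomorphism $\phi:L(E)\to R$ such that $K_0(\phi)=\xi$.
   Context: Algebras are associative, not necessarily unital $\ell$-algebras; homomorphisms need not be unital. A graph $E$ is a directed graph consisting of a set $E^0$ of vertices and a set $E^1$ of edges together with source and range maps $s,r:E^1\to E^0$; it is finite (countable) if both $E^0$ and $E^1$ are. The Leavitt path algebra $L(E)$ is the $\ell$-algebra generated by $E^0\cup E^1\cup\{e^*:e\in E^1\}$ subject to: $vw=\delta_{v,w}v$ for $v,w\in E^0$; $s(e)e=e=er(e)$ and $r(e)e^*=e^*=e^*s(e)$; $e^*f=\delta_{e,f}r(e)$; and $v=\sum_{s(e)=v}ee^*$ for every $v$ with $0<\#s^{-1}(v)<\infty$. It is unital when $E^0$ is finite. $M_\infty R=\bigcup_nM_nR$, and $\epsilon_{1,1}$ is the matrix unit with $1$ in position $(1,1)$. A unital ring is purely infinite simple iff it is not a division ring and for every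 nonzero $x$ there are $a,b$ with $axb=1$. For unital algebras, and more generally algebras with local units such as $L(E)$ and $M_\infty R$, $K_0(A)$ is the group completion of the monoid of Murray-von Neumann equivalence classes of idempotents in $M_\infty A$ ($p\sim q$ iff $p=xy$, $q=yx$ with $x\in pM_\infty(A)q$, $y\in qM_\infty(A)p$) under direct sum; a homomorphism $\phi$ induces $K_0(\phi)$ by $[p]\mapsto[\phi(p)]$.
   Formalization: The graph E is assumed to have at least one vertex; for the empty graph L(E)=0, so no nonzero homomorphism exists in (i) and (ii), and (iii) fails when [1_R]=0. *)

(* Defs.v *)
From HB Require Import structures.
From mathcomp Require Import all_boot all_algebra generic_quotient finmap.
From mathcomp Require Import boolp classical_sets functions cardinality fsbigop.

Set Implicit Arguments.
Unset Strict Implicit.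
Unset Printing Implicit Defensive.

Import GRing.Theory.

Local Open Scope classical_set_scope.
Local Open Scope ring_scope.
Local Open Scope quotient_scope.

(* Quotient of an arbitrary type by a Prop-valued equivalence relation. *)
Section PropQuotient.
Context (T : Type) (R : T -> T -> Prop) (eqvR : RelationClasses.Equivalence R).

Definition prop_rel : rel {classic T} := fun x y => `[< R x y >].

Lemma prop_rel_refl : reflexive prop_rel.
Proof. by move=> x; apply/asboolP; case: eqvR. Qed.

Lemma prop_rel_sym : symmetric prop_rel.
Proof.
by move=> x y; apply/idP/idP => /asboolP xy; apply/asboolP; case: eqvR => _ S _; apply: S.
Qed.

Lemma prop_rel_trans : transitive prop_rel.
Proof.
move=> y x z /asboolP xy /asboolP yz; apply/asboolP.
by case: eqvR => _ _ Tr; apply: Tr xy yz.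
Qed.

Canonical prop_rel_equiv :=
  EquivRel prop_rel prop_rel_refl prop_rel_sym prop_rel_trans.

Definition pquot : Type := {eq_quot prop_rel}.
HB.instance Definition _ := Choice.on pquot.

Definition pclass (x : T) : pquot := \pi_({eq_quot prop_rel}) (x : {classic T}).
Definition prepr (c : pquot) : T := repr (c : {eq_quot prop_rel}).

Lemma preprK (c : pquot) : pclass (prepr c) = c.
Proof. exact: reprK. Qed.

Lemma pclassP (x y : T) : pclass x = pclass y <-> R x y.
Proof. by split=> [/eqmodP/asboolP|xy]; last by apply/eqmodP/asboolP. Qed.

Lemma prepr_class (x : T) : R (prepr (pclass x)) x.
Proof. by apply/pclassP; rewrite preprK. Qed.

End PropQuotient.

(* Associative, not necessarily unital, K-algebras. *)
HB.mixin Record Lmodule_isNUAlgebra (K : fieldType) V of GRing.Lmodule K V := {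
  nmul : V -> V -> V;
  nmulA : associative nmul;
  nmulDl : left_distributive nmul +%R;
  nmulDr : right_distributive nmul +%R;
  nscalerAl : forall (a : K) (x y : V), nmul (a *: x) y = a *: nmul x y;
  nscalerAr : forall (a : K) (x y : V), nmul x (a *: y) = a *: nmul x y
}.

#[short(type="nuAlgType")]
HB.structure Definition NUAlgebra (K : fieldType) :=
  { V of Lmodule_isNUAlgebra K V & GRing.Lmodule K V }.

Notation "x ** y" := (nmul x y) (at level 40, left associativity) : ring_scope.

HB.mixin Record isNUMultiplicative (K : fieldType) (A B : nuAlgType K)
    (f : A -> B) := {
  nmorphM : {morph f : x y / x ** y}
}.

#[short(type="nuMorphism")]
HB.structure Definition NUMorphism (K : fieldType) (A B : nuAlgType K) :=
  { f of isNUMultiplicative K A B f & @GRing.Linear K A B *:%R f }.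

Notation "{ 'nuhom' A -> B }" := (nuMorphism A B)
  (at level 0, A at level 98, B at level 99) : type_scope.

HB.instance Definition _ (K : fieldType) (R : algType K) :=
  Lmodule_isNUAlgebra.Build K R (@mulrA R) (@mulrDl R) (@mulrDr R)
    (fun a x y => esym (scalerAl a x y)) (fun a x y => esym (scalerAr a x y)).

Section NUTheory.
Context (K : fieldType) (A : nuAlgType K).
Implicit Types x y : A.

Lemma nmul0r x : 0 ** x = 0.
Proof. by apply: (addIr (0 ** x)); rewrite -nmulDl !add0r. Qed.

Lemma nmulr0 x : x ** 0 = 0.
Proof. by apply: (addIr (x ** 0)); rewrite -nmulDr !add0r. Qed.

Lemma nmul_suml (I : Type) (r : seq I) (F : I -> A) x :
  (\sum_(i <- r) F i) ** x = \sum_(i <- r) F i ** x.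
Proof. by elim/big_rec2: _ => [|i a b _ <-]; rewrite ?nmul0r ?nmulDl. Qed.

Lemma nmul_sumr (I : Type) (r : seq I) (F : I -> A) x :
  x ** (\sum_(i <- r) F i) = \sum_(i <- r) x ** F i.
Proof. by elim/big_rec2: _ => [|i a b _ <-]; rewrite ?nmulr0 ?nmulDr. Qed.

Definition is_identity (u : A) : Prop := forall x, u ** x = x /\ x ** u = x.

End NUTheory.

Lemma one_identity (K : fieldType) (R : algType K) : is_identity (1 : R).
Proof. by move=> x; split; [exact: mul1r | exact: mulr1]. Qed.

Arguments one_identity {K} R.

(* The K-algebra presented by generators X and relations rel: terms modulo the
   least congruence that contains rel and makes the quotient an algebra. *)
Section Presentation.
Context (K : fieldType) (X : Type).

Inductive alg_term :=
| tgen of X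
| tzero
| topp of alg_term
| tadd of alg_term & alg_term
| tscale of K & alg_term
| tmul of alg_term & alg_term.

Inductive pres_eq (rel : alg_term -> alg_term -> Prop) :
    alg_term -> alg_term -> Prop :=
| pres_rel t u : rel t u -> pres_eq rel t u
| pres_refl t : pres_eq rel t t
| pres_sym t u : pres_eq rel t u -> pres_eq rel u t
| pres_trans t u w : pres_eq rel t u -> pres_eq rel u w -> pres_eq rel t w
| pres_opp t t' : pres_eq rel t t' -> pres_eq rel (topp t) (topp t')
| pres_add t t' u u' : pres_eq rel t t' -> pres_eq rel u u' ->
    pres_eq rel (tadd t u) (tadd t' u')
| pres_scale a t t' : pres_eq rel t t' ->
    pres_eq rel (tscale a t) (tscale a t')
| pres_mul t t' u u' : pres_eq rel t t' -> pres_eq rel u u' ->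
    pres_eq rel (tmul t u) (tmul t' u')
| pres_addA t u w : pres_eq rel (tadd t (tadd u w)) (tadd (tadd t u) w)
| pres_addC t u : pres_eq rel (tadd t u) (tadd u t)
| pres_add0 t : pres_eq rel (tadd tzero t) t
| pres_addN t : pres_eq rel (tadd (topp t) t) tzero
| pres_scaleA a b t :
    pres_eq rel (tscale a (tscale b t)) (tscale (a * b) t)
| pres_scale1 t : pres_eq rel (tscale 1 t) t
| pres_scaleDr a t u :
    pres_eq rel (tscale a (tadd t u)) (tadd (tscale a t) (tscale a u))
| pres_scaleDl a b t :
    pres_eq rel (tscale (a + b) t) (tadd (tscale a t) (tscale b t))
| pres_mulA t u w : pres_eq rel (tmul t (tmul u w)) (tmul (tmul t u) w)
| pres_mulDl t u w :
    pres_eq rel (tmul (tadd t u) w) (tadd (tmul t w) (tmul u w))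
| pres_mulDr t u w :
    pres_eq rel (tmul t (tadd u w)) (tadd (tmul t u) (tmul t w))
| pres_scaleAl a t u :
    pres_eq rel (tmul (tscale a t) u) (tscale a (tmul t u))
| pres_scaleAr a t u :
    pres_eq rel (tmul t (tscale a u)) (tscale a (tmul t u)).

Variable rel : alg_term -> alg_term -> Prop.

Lemma pres_equivalence : RelationClasses.Equivalence (pres_eq rel).
Proof.
by split=> [t|t u|t u w]; [exact: pres_refl|exact: pres_sym|exact: pres_trans].
Qed.

Definition presented : Type := pquot pres_equivalence.
HB.instance Definition _ := Choice.on presented.

Definition pres_class (t : alg_term) : presented := pclass pres_equivalence t.
Let pr (c : presented) : alg_term := prepr c.

Let addp (c d : presented) := pres_class (tadd (pr c) (pr d)).
Let oppp (c : presented) := pres_class (topp (pr c)).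
Let scalep a (c : presented) := pres_class (tscale a (pr c)).
Let mulp (c d : presented) := pres_class (tmul (pr c) (pr d)).

Let prK t : pres_eq rel (pr (pres_class t)) t.
Proof. exact: prepr_class. Qed.

Let prW (P : presented -> Prop) : (forall t, P (pres_class t)) -> forall c, P c.
Proof. by move=> Pt c; rewrite -(preprK c); apply: Pt. Qed.

Let eqP t u : pres_eq rel t u -> pres_class t = pres_class u.
Proof. by move/pclassP; apply. Qed.

Let addE t u : addp (pres_class t) (pres_class u) = pres_class (tadd t u).
Proof. by apply: eqP; apply: pres_add. Qed.
Let oppE t : oppp (pres_class t) = pres_class (topp t).
Proof. by apply: eqP; apply: pres_opp. Qed.
Let scaleE a t : scalep a (pres_class t) = pres_class (tscale a t).
Proof. by apply: eqP; apply: pres_scale. Qed.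
Let mulE t u : mulp (pres_class t) (pres_class u) = pres_class (tmul t u).
Proof. by apply: eqP; apply: pres_mul. Qed.

Let addpA : associative addp.
Proof.
by elim/prW=> t; elim/prW=> u; elim/prW=> w; rewrite !addE; apply/eqP/pres_addA.
Qed.
Let addpC : commutative addp.
Proof. by elim/prW=> t; elim/prW=> u; rewrite !addE; apply/eqP/pres_addC. Qed.
Let add0p : left_id (pres_class tzero) addp.
Proof. by elim/prW=> t; rewrite addE; apply/eqP/pres_add0. Qed.
Let addNp : left_inverse (pres_class tzero) oppp addp.
Proof. by elim/prW=> t; rewrite oppE addE; apply/eqP/pres_addN. Qed.

HB.instance Definition _ :=
  GRing.isZmodule.Build presented addpA addpC add0p addNp.

Let scalepA a b c : scalep a (scalep b c) = scalep (a * b) c.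
Proof. by elim/prW: c => t; rewrite !scaleE; apply/eqP/pres_scaleA. Qed.
Let scale1p : left_id 1 scalep.
Proof. by elim/prW=> t; rewrite !scaleE; apply/eqP/pres_scale1. Qed.
Let scalepDr : right_distributive scalep +%R.
Proof.
move=> a; elim/prW=> t; elim/prW=> u.
rewrite -[_ + _]/(addp _ _) -[RHS]/(addp _ _) !(addE, scaleE).
exact/eqP/pres_scaleDr.
Qed.
Let scalepDl c : {morph scalep^~ c : a b / a + b}.
Proof.
elim/prW: c => t a b; rewrite -[RHS]/(addp _ _) !(addE, scaleE).
exact/eqP/pres_scaleDl.
Qed.

HB.instance Definition _ :=
  GRing.Zmodule_isLmodule.Build K presented scalepA scale1p scalepDr scalepDl.

Let mulpA : associative mulp.
Proof.
by elim/prW=> t; elim/prW=> u; elim/prW=> w; rewrite !mulE; apply/eqP/pres_mulA.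
Qed.
Let mulpDl : left_distributive mulp +%R.
Proof.
elim/prW=> t; elim/prW=> u; elim/prW=> w.
rewrite -[_ + _]/(addp _ _) -[RHS]/(addp _ _) !(addE, mulE).
exact/eqP/pres_mulDl.
Qed.
Let mulpDr : right_distributive mulp +%R.
Proof.
elim/prW=> t; elim/prW=> u; elim/prW=> w.
rewrite -[_ + _]/(addp _ _) -[RHS]/(addp _ _) !(addE, mulE).
exact/eqP/pres_mulDr.
Qed.
Let scalepAl (a : K) (x y : presented) : mulp (a *: x) y = a *: mulp x y.
Proof.
elim/prW: x => t; elim/prW: y => u.
rewrite -[a *: _]/(scalep _ _) -[RHS]/(scalep _ _) !(scaleE, mulE).
exact/eqP/pres_scaleAl.
Qed.
Let scalepAr (a : K) (x y : presented) : mulp x (a *: y) = a *: mulp x y.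
Proof.
elim/prW: x => t; elim/prW: y => u.
rewrite -[a *: _]/(scalep _ _) -[RHS]/(scalep _ _) !(scaleE, mulE).
exact/eqP/pres_scaleAr.
Qed.

HB.instance Definition _ :=
  Lmodule_isNUAlgebra.Build K presented mulpA mulpDl mulpDr scalepAl scalepAr.

Lemma pres_classE t u : pres_class t = pres_class u <-> pres_eq rel t u.
Proof. exact: pclassP. Qed.
Lemma pres_class0 : pres_class tzero = 0. Proof. by []. Qed.
Lemma pres_classD t u : pres_class (tadd t u) = pres_class t + pres_class u.
Proof. by rewrite -addE. Qed.
Lemma pres_classN t : pres_class (topp t) = - pres_class t.
Proof. by rewrite -oppE. Qed.
Lemma pres_classZ a t : pres_class (tscale a t) = a *: pres_class t.
Proof. by rewrite -scaleE. Qed.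
Lemma pres_classM t u : pres_class (tmul t u) = pres_class t ** pres_class u.
Proof. by rewrite -mulE. Qed.
Lemma pres_classW (P : presented -> Prop) :
  (forall t, P (pres_class t)) -> forall c, P c.
Proof. exact: prW. Qed.

End Presentation.

Arguments tzero {K X}.
Arguments tgen {K X} _.

Record graph := Graph {
  vertex : Type;
  edge : Type;
  gsource : edge -> vertex;
  grange : edge -> vertex
}.
Arguments gsource {g}.
Arguments grange {g}.

HB.instance Definition _ (E : graph) := gen_eqMixin (vertex E).
HB.instance Definition _ (E : graph) := gen_choiceMixin (vertex E).
HB.instance Definition _ (E : graph) := gen_eqMixin (edge E).
HB.instance Definition _ (E : graph) := gen_choiceMixin (edge E).

Definition countable_graph (E : graph) : Prop :=
  countable [set: vertex E] /\ countable [set: edge E].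

Definition finite_graph (E : graph) : Prop :=
  finite_set [set: vertex E] /\ finite_set [set: edge E].

Section Leavitt.
Context (K : fieldType) (E : graph).

Inductive lpa_gen := gvertex of vertex E | gedge of edge E | gghost of edge E.

Let V v : alg_term K lpa_gen := tgen (gvertex v).
Let Ed e : alg_term K lpa_gen := tgen (gedge e).
Let Gh e : alg_term K lpa_gen := tgen (gghost e).

Definition emitted (v : vertex E) : set (edge E) := [set e | gsource e = v].

Inductive lpa_rel : alg_term K lpa_gen -> alg_term K lpa_gen -> Prop :=
| lpa_vertex_idem v : lpa_rel (tmul (V v) (V v)) (V v)
| lpa_vertex_orth v w : v <> w -> lpa_rel (tmul (V v) (V w)) tzero
| lpa_source_edge e : lpa_rel (tmul (V (gsource e)) (Ed e)) (Ed e)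
| lpa_edge_range e : lpa_rel (tmul (Ed e) (V (grange e))) (Ed e)
| lpa_range_ghost e : lpa_rel (tmul (V (grange e)) (Gh e)) (Gh e)
| lpa_ghost_source e : lpa_rel (tmul (Gh e) (V (gsource e))) (Gh e)
| lpa_ghost_edge e : lpa_rel (tmul (Gh e) (Ed e)) (V (grange e))
| lpa_ghost_orth e f : e <> f -> lpa_rel (tmul (Gh e) (Ed f)) tzero
| lpa_regular v : emitted v !=set0 -> finite_set (emitted v) ->
    lpa_rel (V v)
      (\big[@tadd _ _ / tzero]_(e <- fset_set (emitted v)) tmul (Ed e) (Gh e)).

Definition leavitt : Type := presented lpa_rel.
HB.instance Definition _ := NUAlgebra.on leavitt.

Definition lpa_vertex (v : vertex E) : leavitt := pres_class lpa_rel (V v).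
Definition lpa_edge (e : edge E) : leavitt := pres_class lpa_rel (Ed e).
Definition lpa_ghost (e : edge E) : leavitt := pres_class lpa_rel (Gh e).

(* The sum is the identity of L(E) when E has finitely many vertices, and is 0
   by convention when infinitely many of its terms are nonzero. *)
Definition lpa_one : leavitt := \sum_(v \in [set: vertex E]) lpa_vertex v.

Lemma lpa_relE t u : lpa_rel t u -> pres_class lpa_rel t = pres_class lpa_rel u.
Proof. by move=> tu; apply/pres_classE/pres_rel. Qed.

Lemma lpa_vertexM v w :
  lpa_vertex v ** lpa_vertex w = if v == w then lpa_vertex v else 0.
Proof.
rewrite /lpa_vertex -pres_classM; case: eqVneq => [->|/eqP vw].
  exact/lpa_relE/lpa_vertex_idem.
exact/lpa_relE/lpa_vertex_orth.
Qed.

Lemma lpa_one_identity : finite_set [set: vertex E] -> is_identity lpa_one.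
Proof.
move=> finE.
have oneE : lpa_one = \sum_(v <- fset_set [set: vertex E]) lpa_vertex v.
  exact: fsbig_finite.
have inV v : v \in fset_set [set: vertex E] by rewrite in_fset_set// mem_setT.
have onel v : lpa_one ** lpa_vertex v = lpa_vertex v.
  rewrite oneE nmul_suml (bigD1_seq v (inV v) (fset_uniq _)) /= lpa_vertexM eqxx big1 ?addr0// => w wv.
  by rewrite lpa_vertexM (negbTE wv).
have oner v : lpa_vertex v ** lpa_one = lpa_vertex v.
  rewrite oneE nmul_sumr (bigD1_seq v (inV v) (fset_uniq _)) /= lpa_vertexM eqxx big1 ?addr0// => w wv.
  by rewrite lpa_vertexM eq_sym (negbTE wv).
have se e : lpa_vertex (gsource e) ** lpa_edge e = lpa_edge e.
  by rewrite -pres_classM; apply/lpa_relE/lpa_source_edge.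
have er e : lpa_edge e ** lpa_vertex (grange e) = lpa_edge e.
  by rewrite -pres_classM; apply/lpa_relE/lpa_edge_range.
have rg e : lpa_vertex (grange e) ** lpa_ghost e = lpa_ghost e.
  by rewrite -pres_classM; apply/lpa_relE/lpa_range_ghost.
have gs e : lpa_ghost e ** lpa_vertex (gsource e) = lpa_ghost e.
  by rewrite -pres_classM; apply/lpa_relE/lpa_ghost_source.
elim/pres_classW; elim=> [[v|e|e]||t [IH1 IH2]|t [IH1 IH2] u [IH3 IH4]
    |a t [IH1 IH2]|t [IH1 IH2] u [IH3 IH4]].
- by split; [exact: onel|exact: oner].
- rewrite -/(lpa_edge e).
  by split; [rewrite -(se e) nmulA onel|rewrite -(er e) -nmulA oner].
- rewrite -/(lpa_ghost e).
  by split; [rewrite -(rg e) nmulA onel|rewrite -(gs e) -nmulA oner].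
- by rewrite pres_class0 nmul0r nmulr0.
- rewrite pres_classN -scaleN1r nscalerAl nscalerAr.
  by rewrite IH1 IH2.
- by rewrite pres_classD nmulDl nmulDr IH1 IH2 IH3 IH4.
- by rewrite pres_classZ nscalerAl nscalerAr IH1 IH2.
- by rewrite pres_classM nmulA IH1 -nmulA IH4.
Qed.

End Leavitt.

Arguments lpa_one_identity K {E} finE : rename.

(* M_infty A: infinite matrices supported in a finite square block [0, n)^2,
   the elements supported in [0, n)^2 forming M_n A. *)
Definition supported (A : nmodType) (n : nat) (a : nat -> nat -> A) : Prop :=
  forall i j, (n <= i)%N || (n <= j)%N -> a i j = 0.

Record minf (A : nmodType) := MInf {
  mentry :> nat -> nat -> A;
  mfinite : exists n, supported n mentry
}.

Definition minf_of (A : nmodType) n (a : nat -> nat -> A) (an : supported n a) :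
  minf A := MInf (ex_intro (fun n => supported n a) n an).

HB.instance Definition _ A := gen_eqMixin (minf A).
HB.instance Definition _ A := gen_choiceMixin (minf A).

Section MInfSize.
Context (A : nmodType).
Implicit Types a b : minf A.

Lemma minfP a b : (forall i j, a i j = b i j) -> a = b.
Proof.
case: a b => [a fa] [b fb] /= ab.
have {}ab : a = b by apply/funext => i; apply/funext => j.
by case: _ / ab fb => fb; rewrite (Prop_irrelevance fa fb).
Qed.

Lemma msize_ex a : exists n, `[< supported n a >].
Proof. by have [n an] := mfinite a; exists n; apply/asboolP. Qed.

(* The least n with a in M_n A. *)
Definition msize a : nat := ex_minn (msize_ex a).

Lemma msizeP a : supported (msize a) a.
Proof. by rewrite /msize; case: ex_minnP => n /asboolP. Qed.

End MInfSize.

Section MInfAlgebra.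
Context (K : fieldType) (A : nuAlgType K).
Implicit Types a b c : minf A.

Lemma supported_leq n m (a : nat -> nat -> A) :
  (n <= m)%N -> supported n a -> supported m a.
Proof.
move=> nm an i j /orP[mi|mj]; apply: an; first by rewrite (leq_trans nm mi).
by rewrite (leq_trans nm mj) orbT.
Qed.

Lemma supported0 : supported 0 (fun _ _ => 0 : A). Proof. by []. Qed.
Definition minf0 := minf_of supported0.

Lemma supportedN a : supported (msize a) (fun i j => - a i j).
Proof. by move=> i j ij; rewrite msizeP ?oppr0. Qed.
Definition minfN a := minf_of (@supportedN a).

Lemma supportedZ (k : K) a : supported (msize a) (fun i j => k *: a i j).
Proof. by move=> i j ij; rewrite msizeP ?scaler0. Qed.
Definition minfZ k a := minf_of (@supportedZ k a).

Lemma supportedD a b :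
  supported (maxn (msize a) (msize b)) (fun i j => a i j + b i j).
Proof.
move=> i j ij.
rewrite (supported_leq (leq_maxl _ _) (@msizeP _ a) ij).
by rewrite (supported_leq (leq_maxr _ _) (@msizeP _ b) ij) addr0.
Qed.
Definition minfD a b := minf_of (@supportedD a b).

Lemma supportedM a b : supported (maxn (msize a) (msize b))
  (fun i j => \sum_(0 <= k < msize a) a i k ** b k j).
Proof.
move=> i j; rewrite !geq_max => /orP[/andP[ai _]|/andP[_ bj]].
  by apply: big1 => k _; rewrite msizeP ?ai// nmul0r.
by apply: big1 => k _; rewrite (msizeP (a := b)) ?bj ?orbT// nmulr0.
Qed.
(* The matrix product; the omitted terms k >= msize a vanish. *)
Definition minfM a b := minf_of (@supportedM a b).

Lemma minfD_A : associative minfD.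
Proof. by move=> a b c; apply: minfP => i j /=; rewrite addrA. Qed.
Lemma minfD_C : commutative minfD.
Proof. by move=> a b; apply: minfP => i j /=; rewrite addrC. Qed.
Lemma minfD_0 : left_id minf0 minfD.
Proof. by move=> a; apply: minfP => i j /=; rewrite add0r. Qed.
Lemma minfD_N : left_inverse minf0 minfN minfD.
Proof. by move=> a; apply: minfP => i j /=; rewrite addNr. Qed.
HB.instance Definition _ :=
  GRing.isZmodule.Build (minf A) minfD_A minfD_C minfD_0 minfD_N.

Lemma minfZ_A k l a : minfZ k (minfZ l a) = minfZ (k * l) a.
Proof. by apply: minfP => i j /=; rewrite scalerA. Qed.
Lemma minfZ_1 : left_id 1 minfZ.
Proof. by move=> a; apply: minfP => i j /=; rewrite scale1r. Qed.
Lemma minfZ_Dr : right_distributive minfZ +%R.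
Proof. by move=> k a b; apply: minfP => i j /=; rewrite scalerDr. Qed.
Lemma minfZ_Dl a : {morph minfZ^~ a : k l / k + l}.
Proof. by move=> k l; apply: minfP => i j /=; rewrite scalerDl. Qed.
HB.instance Definition _ := GRing.Zmodule_isLmodule.Build K (minf A)
  minfZ_A minfZ_1 minfZ_Dr minfZ_Dl.

Lemma minfM_bound n a b i j : (forall k, (n <= k)%N -> a i k ** b k j = 0) ->
  minfM a b i j = \sum_(0 <= k < n) a i k ** b k j.
Proof.
move=> abn /=.
have wid m N : (m <= N)%N -> (forall k, (m <= k)%N -> a i k ** b k j = 0) ->
    \sum_(0 <= k < N) a i k ** b k j = \sum_(0 <= k < m) a i k ** b k j.
  move=> mN am; rewrite (big_cat_nat _ mN)//=.
  by rewrite [X in _ + X]big_nat_cond [X in _ + X]big1 ?addr0// => k /andP[/andP[+ _] _] => /am.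
have [mn|/ltnW nm] := leqP (msize a) n; last exact: wid.
by apply/esym/wid => // k ak; rewrite msizeP ?ak ?orbT// nmul0r.
Qed.

Lemma minfM_A : associative minfM.
Proof.
move=> a b c; apply: minfP => i j.
rewrite (minfM_bound (n := msize a)); last first.
  by move=> k ak; rewrite msizeP ?ak ?orbT// nmul0r.
rewrite (minfM_bound (n := msize b)); last first.
  move=> k bk; rewrite [minfM a b i k]/= big1 ?nmul0r// => l _.
  by rewrite (msizeP (a := b)) ?bk ?orbT// nmulr0.
under eq_bigr do rewrite /= nmul_sumr.
rewrite exchange_big /=; apply: eq_bigr => k _.
by rewrite nmul_suml; apply: eq_bigr => l _; rewrite nmulA.
Qed.
Lemma mentryD a b i j : (a + b) i j = a i j + b i j. Proof. by []. Qed.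
Lemma mentryZ k a i j : (k *: a) i j = k *: a i j. Proof. by []. Qed.
Lemma minfM_Dl : left_distributive minfM +%R.
Proof.
move=> a b c; apply: minfP => i j; rewrite mentryD.
pose n := maxn (msize a) (msize b).
have an k : (n <= k)%N -> a i k = 0.
  by rewrite geq_max => /andP[ak _]; apply: msizeP; rewrite ak orbT.
have bn k : (n <= k)%N -> b i k = 0.
  by rewrite geq_max => /andP[_ bk]; apply: msizeP; rewrite bk orbT.
rewrite !(minfM_bound (n := n)) => [|k /bn ->|k /an ->|k nk]; rewrite ?nmul0r//.
  by rewrite -big_split; apply: eq_bigr => k _; rewrite mentryD nmulDl.
by rewrite mentryD an// bn// addr0 nmul0r.
Qed.
Lemma minfM_Dr : right_distributive minfM +%R.
Proof.
move=> a b c; apply: minfP => i j /=.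
by rewrite -big_split; apply: eq_bigr => k _; rewrite nmulDr.
Qed.
Lemma minfM_Zl k a b : minfM (k *: a) b = k *: minfM a b.
Proof.
apply: minfP => i j; rewrite (minfM_bound (n := msize a)) => [|l al].
  by rewrite /= scaler_sumr; apply: eq_bigr => l _; rewrite nscalerAl.
by rewrite mentryZ msizeP ?al ?orbT// scaler0 nmul0r.
Qed.
Lemma minfM_Zr k a b : minfM a (k *: b) = k *: minfM a b.
Proof.
apply: minfP => i j; rewrite /= scaler_sumr.
by apply: eq_bigr => l _; rewrite nscalerAr.
Qed.
HB.instance Definition _ := Lmodule_isNUAlgebra.Build K (minf A)
  minfM_A minfM_Dl minfM_Dr minfM_Zl minfM_Zr.

Lemma minfME a b i j n : (forall k, (n <= k)%N -> a i k ** b k j = 0) ->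
  (a ** b) i j = \sum_(0 <= k < n) a i k ** b k j.
Proof. exact: minfM_bound. Qed.

Lemma supported_corner (x : A) :
  supported 1 (fun i j => if (i == 0%N) && (j == 0%N) then x else 0).
Proof. by case=> [|i] [|j]. Qed.
Definition corner (x : A) : minf A := minf_of (supported_corner x).

Lemma corner_is_linear : linear corner.
Proof.
move=> k x y; apply: minfP => i j /=.
by case: ifP => // _; rewrite scaler0 addr0.
Qed.
HB.instance Definition _ :=
  GRing.isLinear.Build K A (minf A) *:%R corner corner_is_linear.

Lemma cornerM : {morph corner : x y / x ** y}.
Proof.
move=> x y; apply: minfP => i j; rewrite (minfME (n := 1)) => [|[//|k] _]; last first.
  by rewrite /= andbF nmul0r.
rewrite big_nat1 /= andbT.
by case: i => [|i]; case: j => [|j] /=; rewrite ?nmul0r ?nmulr0.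
Qed.
HB.instance Definition _ := isNUMultiplicative.Build K A (minf A) corner cornerM.

(* x placed m rows down and n columns to the right *)
Lemma supported_shift m n a : supported (maxn m n + msize a) (fun i j =>
  if (m <= i)%N && (n <= j)%N then a (i - m)%N (j - n)%N else 0).
Proof.
move=> i j ij; case: ifP => // /andP[mi nj]; apply: msizeP.
move: ij; rewrite addn_maxl !geq_max.
by case/orP => /andP[h1 h2]; rewrite leq_subRL// ?h1// orbC leq_subRL// h2.
Qed.
Definition mshift m n a := minf_of (@supported_shift m n a).

Lemma mshift00 a : mshift 0 0 a = a.
Proof. by apply: minfP => i j /=; rewrite !subn0. Qed.

Lemma mshift0 m n : mshift m n 0 = 0.
Proof. by apply: minfP => i j /=; rewrite if_same. Qed.

Lemma mshiftD m n a b : mshift m n (a + b) = mshift m n a + mshift m n b.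
Proof. by apply: minfP => i j /=; case: ifP => // _; rewrite addr0. Qed.

Lemma mshift_comp m n m' n' a :
  mshift m n (mshift m' n' a) = mshift (m + m') (n + n') a.
Proof.
apply: minfP => i j /=; rewrite !subnDA.
have [mi|im] := leqP m i; have [nj|jn] := leqP n j => /=.
- by rewrite !leq_subRL.
- by rewrite [(n + _ <= _)%N]leqNgt (leq_trans jn) ?leq_addr// andbF.
- by rewrite [(m + _ <= _)%N]leqNgt (leq_trans im) ?leq_addr.
- by rewrite [(m + _ <= _)%N]leqNgt (leq_trans im) ?leq_addr.
Qed.

Lemma mshiftM m n k a b : mshift m n a ** mshift n k b = mshift m k (a ** b).
Proof.
apply: minfP => i j; rewrite (minfME (n := n + msize a)) => [|l al]; last first.
  rewrite /=; case: ifP => // [/andP[_ nl]|]; last by rewrite nmul0r.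
  by rewrite msizeP ?nmul0r// (leq_subRL _ nl) al orbT.
rewrite (big_cat_nat _ (leq_addr _ _))//= big_nat_cond big1 ?add0r; last first.
  by move=> l /andP[/andP[_ ln] _]; rewrite [(n <= l)%N]leqNgt ln andbF nmul0r.
rewrite -{1}[n]add0n big_addn addKn.
have [mi|im] := leqP m i; last by apply: big1 => l _; rewrite nmul0r.
have [kj|jk] := leqP k j; last first.
  by apply: big1 => l _; rewrite !andbF nmulr0.
by apply: eq_bigr => l _; rewrite leq_addl addnK.
Qed.

Lemma mshiftM_lo m n n' k a b :
  (forall i j, (n' <= j)%N -> a i j = 0) -> (n + n' <= k)%N ->
  forall l, mshift m n a ** mshift k l b = 0.
Proof.
move=> an nk l; apply: minfP => i j; rewrite /GRing.zero /=.
rewrite -[LHS]/((mshift m n a ** mshift k l b) i j).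
rewrite (minfME (n := 0)) ?big_geq// => h _ /=.
have [kh|hk] := leqP k h; last by rewrite nmulr0.
rewrite (an _ (h - n)%N) ?if_same ?nmul0r//.
by rewrite leq_subRL ?(leq_trans nk)// (leq_trans _ (leq_trans nk kh))// leq_addr.
Qed.

Lemma mshiftM_hi m n n' k a b :
  (forall i j, (n' <= i)%N -> b i j = 0) -> (k + n' <= n)%N ->
  forall l, mshift m n a ** mshift k l b = 0.
Proof.
move=> bn nk l; apply: minfP => i j; rewrite /GRing.zero /=.
rewrite -[LHS]/((mshift m n a ** mshift k l b) i j).
rewrite (minfME (n := 0)) ?big_geq// => h _ /=.
have [nh|hn] := leqP n h; last by rewrite andbF nmul0r.
rewrite (bn (h - k)%N) ?if_same ?nmulr0//.
by rewrite leq_subRL ?(leq_trans nk)// (leq_trans _ (leq_trans nk nh))// leq_addr.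
Qed.

End MInfAlgebra.

(* The map M_infty A -> M_infty B induced by f : A -> B. *)
Section MInfMap.
Context (K : fieldType) (A B : nuAlgType K) (f : {nuhom A -> B}).

Lemma supported_map (a : minf A) : supported (msize a) (fun i j => f (a i j)).
Proof. by move=> i j ij; rewrite msizeP ?linear0. Qed.
Definition minf_map (a : minf A) : minf B :=
  minf_of (@supported_map a).

Lemma minf_map_is_linear : linear minf_map.
Proof. by move=> k a b; apply: minfP => i j /=; rewrite linearP. Qed.
HB.instance Definition _ :=
  GRing.isLinear.Build K (minf A) (minf B) *:%R minf_map minf_map_is_linear.

Lemma minf_mapM : {morph minf_map : a b / a ** b}.
Proof.
move=> a b; apply: minfP => i j; rewrite (minfME (n := msize a)) => [|k ak].
  by rewrite /= linear_sum /=; apply: eq_bigr => k _; rewrite nmorphM.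
by rewrite /= msizeP ?ak ?orbT// linear0 nmul0r.
Qed.
HB.instance Definition _ :=
  isNUMultiplicative.Build K (minf A) (minf B) minf_map minf_mapM.

Lemma minf_map_shift m n a : minf_map (mshift m n a) = mshift m n (minf_map a).
Proof. by apply: minfP => i j /=; case: ifP => // _; rewrite linear0. Qed.

End MInfMap.

Section MurrayVonNeumann.
Context (K : fieldType) (A : nuAlgType K).

Local Notation "x ** y" := (nmul (x : minf A) (y : minf A)) (only parsing).

Record idem := Idem { ival :> minf A; idemP : ival ** ival = ival }.

Definition mvn (p q : idem) : Prop := exists x y : minf A,
  [/\ (exists a, x = p ** a ** q), (exists b, y = q ** b ** p),
      ival p = x ** y & ival q = y ** x].

Lemma mvnP (p q : idem) x y : p ** x = x -> x ** q = x -> q ** y = y ->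
  y ** p = y -> x ** y = p -> y ** x = q -> mvn p q.
Proof.
move=> px xq qy yp xy yx; exists x, y; split=> //.
  by exists x; rewrite px xq.
by exists y; rewrite qy yp.
Qed.

Lemma mvnE (p q : idem) : mvn p q -> exists x y : minf A,
  [/\ p ** x = x, x ** q = x, q ** y = y & y ** p = y]
  /\ x ** y = p /\ y ** x = q.
Proof.
case=> x [y [[a xE] [b yE] pE qE]]; exists x, y; split; last by [].
split; [rewrite xE|rewrite xE|rewrite yE|rewrite yE].
- by rewrite !nmulA idemP.
- by rewrite -!nmulA idemP.
- by rewrite !nmulA idemP.
- by rewrite -!nmulA idemP.
Qed.

Lemma mvn_equivalence : RelationClasses.Equivalence mvn.
Proof.
split=> [p|p q|p q r].
- by apply: (@mvnP _ _ p p); rewrite ?idemP.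
- case/mvnE=> x [y [[px xq qy yp] [xy yx]]].
  exact: (@mvnP _ _ y x).
- case/mvnE=> x [y [[px xq qy yp] [xy yx]]].
  case/mvnE=> z [w [[qz zr rw wq] [zw wz]]].
  apply: (@mvnP _ _ (x ** z) (w ** y)).
  + by rewrite nmulA px.
  + by rewrite -nmulA zr.
  + by rewrite nmulA rw.
  + by rewrite -nmulA yp.
  + by rewrite -nmulA (nmulA z) zw qy xy.
  + by rewrite -nmulA (nmulA y) yx qz wz.
Qed.

Lemma idem0P : (0 : minf A) ** 0 = 0. Proof. exact: nmul0r. Qed.
Definition idem0 := Idem idem0P.

Lemma ival_hi (n : nat) (a : minf A) : supported n a ->
  forall i j, (n <= j)%N -> a i j = 0.
Proof. by move=> an i j nj; apply: an; rewrite nj orbT. Qed.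
Lemma ival_lo (n : nat) (a : minf A) : supported n a ->
  forall i j, (n <= i)%N -> a i j = 0.
Proof. by move=> an i j nj; apply: an; rewrite nj. Qed.

Lemma dsum_at_idem n (p q : idem) : supported n p ->
  ((p : minf A) + mshift n n q) ** ((p : minf A) + mshift n n q)
  = (p : minf A) + mshift n n q.
Proof.
move=> pn; rewrite nmulDl !nmulDr idemP mshiftM idemP.
rewrite -{1}[X in X ** _]mshift00 (mshiftM_lo _ _ (ival_hi pn))// addr0.
by rewrite -{1}[X in _ ** X]mshift00 (mshiftM_hi _ _ (ival_lo pn))// add0r.
Qed.

Definition dsum_at n (p q : idem) (pn : supported n p) : idem :=
  Idem (dsum_at_idem q pn).

(* Block diagonal sum diag(p, q), with p seen in M_(msize p) A. *)
Definition dsum (p q : idem) : idem := dsum_at q (@msizeP _ p).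

Lemma mul_left_support n (p : idem) (x : minf A) : supported n p ->
  p ** x = x -> forall i j, (n <= i)%N -> x i j = 0.
Proof.
move=> pn <- i j ni; rewrite (minfME (n := 0)) ?big_geq// => k _.
by rewrite pn ?ni// nmul0r.
Qed.
Lemma mul_right_support n (p : idem) (x : minf A) : supported n p ->
  x ** p = x -> forall i j, (n <= j)%N -> x i j = 0.
Proof.
move=> pn <- i j nj; rewrite (minfME (n := 0)) ?big_geq// => k _.
by rewrite pn ?nj ?orbT// nmulr0.
Qed.

Lemma mvn_dsum n n' (p p' q q' : idem) (pn : supported n p)
    (pn' : supported n' p') :
  mvn p p' -> mvn q q' -> mvn (dsum_at q pn) (dsum_at q' pn').
Proof.
case/mvnE=> x [y [[px xq qy yp] [xy yx]]].
case/mvnE=> z [w [[qz zr rw wq] [zw wz]]].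
have lp := ival_lo pn; have hp := ival_hi pn.
have lp' := ival_lo pn'; have hp' := ival_hi pn'.
have lx := mul_left_support pn px; have hx := mul_right_support pn' xq.
have ly := mul_left_support pn' qy; have hy := mul_right_support pn yp.
have L k a b c (ha : forall i j, (k <= j)%N -> (a : minf A) i j = 0) :
    a ** mshift k c b = 0.
  by rewrite -(mshift00 a) (mshiftM_lo _ _ ha).
have H k a b c (ha : forall i j, (k <= i)%N -> (a : minf A) i j = 0) :
    mshift c k b ** a = 0.
  by rewrite -(mshift00 a) (mshiftM_hi _ _ ha).
apply: (@mvnP _ _ (x + mshift n n' z) (y + mshift n' n w));
  rewrite /= nmulDl !nmulDr mshiftM ?L ?H// addr0 add0r.
- by rewrite px qz.
- by rewrite xq zr.
- by rewrite qy rw.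
- by rewrite yp wq.
- by rewrite xy zw.
- by rewrite yx wz.
Qed.

Definition vmon : Type := pquot mvn_equivalence.
HB.instance Definition _ := Choice.on vmon.

Definition vclass (p : idem) : vmon := pclass mvn_equivalence p.

Lemma vclassP p q : vclass p = vclass q <-> mvn p q.
Proof. exact: pclassP. Qed.

Lemma vclass_eq (p q : idem) : ival p = ival q -> vclass p = vclass q.
Proof.
move=> pq; apply/vclassP; apply: (@mvnP _ _ p p); rewrite -?pq ?idemP//.
Qed.

Lemma vclassW (P : vmon -> Prop) : (forall p, P (vclass p)) -> forall c, P c.
Proof. by move=> Pp c; rewrite -(preprK c); apply: Pp. Qed.

Definition vadd (c d : vmon) : vmon := vclass (dsum (prepr c) (prepr d)).

Lemma vadd_at n p q (pn : supported n (ival p)) :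
  vadd (vclass p) (vclass q) = vclass (dsum_at q pn).
Proof. by apply/vclassP/mvn_dsum; apply: prepr_class. Qed.

Lemma vaddE p q : vadd (vclass p) (vclass q) = vclass (dsum p q).
Proof. exact: vadd_at. Qed.

Lemma vaddA : associative vadd.
Proof.
elim/vclassW=> p; elim/vclassW=> q; elim/vclassW=> r.
have pn := @msizeP _ p; have qm := @msizeP _ q.
have pqn : supported (msize p + msize q) (dsum p q).
  move=> i j ij /=; rewrite pn ?add0r; last first.
    by case/orP: ij => /(leq_trans (leq_addr _ _)) ->; rewrite ?orbT.
  case: ifP => // /andP[pi pj]; apply: qm.
  by rewrite !leq_subRL.
rewrite (vaddE q) (vaddE p (dsum q r)) (vaddE p q) (vadd_at _ pqn); apply: vclass_eq => /=.
by rewrite mshiftD mshift_comp addrA.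
Qed.

Lemma vaddC : commutative vadd.
Proof.
elim/vclassW=> p; elim/vclassW=> q; rewrite !vaddE.
have pn := @msizeP _ p; have qm := @msizeP _ q.
set n := msize p in pn *; set m := msize q in qm *.
have L k l b a r : supported r (a : minf A) ->
    mshift k 0 a ** mshift r l b = 0.
  by move=> ar; rewrite (mshiftM_lo _ _ (ival_hi ar)).
have H k l b a r : supported r (a : minf A) ->
    mshift k r b ** mshift 0 l a = 0.
  by move=> ar; rewrite (mshiftM_hi _ _ (ival_lo ar)).
have E1 : ival (dsum p q) = mshift 0 0 p + mshift n n q by rewrite mshift00.
have E2 : ival (dsum q p) = mshift 0 0 q + mshift m m p by rewrite mshift00.
apply/vclassP; apply: (@mvnP _ _ (mshift 0 m p + mshift n 0 q)
  (mshift m 0 p + mshift 0 n q)); rewrite ?E1 ?E2 nmulDl !nmulDr;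
  rewrite !mshiftM !idemP.
- by rewrite (L _ _ _ _ _ pn) (H _ _ _ _ _ pn) addr0 add0r.
- by rewrite (H _ _ _ _ _ qm) (L _ _ _ _ _ qm) addr0 add0r.
- by rewrite (L _ _ _ _ _ qm) (H _ _ _ _ _ qm) addr0 add0r addrC.
- by rewrite (H _ _ _ _ _ pn) (L _ _ _ _ _ pn) addr0 add0r.
- by rewrite (H _ _ _ _ _ qm) (L _ _ _ _ _ qm) addr0 add0r.
- by rewrite (L _ _ _ _ _ pn) (H _ _ _ _ _ pn) addr0 add0r addrC.
Qed.

Lemma vadd0 : left_id (vclass idem0) vadd.
Proof.
elim/vclassW=> p; have z0 : supported 0 (ival idem0) by [].
by rewrite (vadd_at _ z0); apply: vclass_eq; rewrite /= mshift00 add0r.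
Qed.

HB.instance Definition _ := GRing.isNmodule.Build vmon vaddA vaddC vadd0.

Lemma vclassD p q : vclass (dsum p q) = vclass p + vclass q.
Proof. by rewrite -vaddE. Qed.

End MurrayVonNeumann.

(* Group completion of a commutative monoid: formal differences x.1 - x.2. *)
Section GroupCompletion.
Context (M : nmodType).
Implicit Types x y z : M * M.

Definition gcrel x y : Prop := exists e, x.1 + y.2 + e = y.1 + x.2 + e.

Lemma gcrel_equivalence : RelationClasses.Equivalence gcrel.
Proof.
split=> [x|x y [e xy]|x y z [e xy] [f yz]]; first by exists 0.
  by exists e.
exists (y.1 + y.2 + e + f).
have -> : x.1 + z.2 + (y.1 + y.2 + e + f) =
    (x.1 + y.2 + e) + (y.1 + z.2 + f).
  by rewrite (AC (2*4) ((1*4*5)*(3*2*6))).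
by rewrite xy yz (AC (3*3) ((4*2)*(1*5*3*6))).
Qed.

Definition gcompl : Type := pquot gcrel_equivalence.
HB.instance Definition _ := Choice.on gcompl.

Definition gcclass x : gcompl := pclass gcrel_equivalence x.
Let gr (c : gcompl) : M * M := prepr c.

Lemma gcclassP x y : gcclass x = gcclass y <-> gcrel x y.
Proof. exact: pclassP. Qed.
Lemma gcclassW (P : gcompl -> Prop) : (forall x, P (gcclass x)) -> forall c, P c.
Proof. by move=> Px c; rewrite -(preprK c); apply: Px. Qed.
Let grK x : gcrel (gr (gcclass x)) x.
Proof. exact: prepr_class. Qed.

Let gadd c d := gcclass ((gr c).1 + (gr d).1, (gr c).2 + (gr d).2).
Let gopp c := gcclass ((gr c).2, (gr c).1).

Let gaddE x y : gadd (gcclass x) (gcclass y) = gcclass (x.1 + y.1, x.2 + y.2).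
Proof.
apply/gcclassP; have [e xe] := grK x; have [f yf] := grK y; exists (e + f) => /=.
rewrite (AC (2*2*2) ((1*3*5)*(2*4*6))) /= xe yf.
by rewrite (AC (3*3) ((1*4)*(2*5)*(3*6))).
Qed.
Let goppE x : gopp (gcclass x) = gcclass (x.2, x.1).
Proof.
apply/gcclassP; have [e xe] := grK x; exists e => /=.
by rewrite [_ + x.1]addrC -xe [x.2 + _]addrC.
Qed.

Let gaddA : associative gadd.
Proof.
by elim/gcclassW=> x; elim/gcclassW=> y; elim/gcclassW=> z; rewrite !gaddE /= !addrA.
Qed.
Let gaddC : commutative gadd.
Proof.
by elim/gcclassW=> x; elim/gcclassW=> y; rewrite !gaddE addrC [x.2 + _]addrC.
Qed.
Let gadd0 : left_id (gcclass (0, 0)) gadd.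
Proof. by elim/gcclassW=> -[x1 x2]; rewrite gaddE /= !add0r. Qed.
Let gaddN : left_inverse (gcclass (0, 0)) gopp gadd.
Proof.
elim/gcclassW=> x; rewrite goppE gaddE; apply/gcclassP; exists 0 => /=.
by rewrite !addr0 add0r addrC.
Qed.

HB.instance Definition _ := GRing.isZmodule.Build gcompl gaddA gaddC gadd0 gaddN.

Lemma gcclassD x y : gcclass (x.1 + y.1, x.2 + y.2) = gcclass x + gcclass y.
Proof. by rewrite -gaddE. Qed.
Lemma gcclassN x : gcclass (x.2, x.1) = - gcclass x.
Proof. by rewrite -goppE. Qed.

End GroupCompletion.

Definition K0 (K : fieldType) (A : nuAlgType K) : zmodType := gcompl (vmon A).

Section K0Class.
Context (K : fieldType) (A : nuAlgType K).

Definition k0_class (p : idem A) : K0 A := gcclass (vclass p, 0).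

Lemma k0_classB (p q : idem A) : gcclass (vclass p, vclass q) = k0_class p - k0_class q.
Proof. by rewrite /k0_class -gcclassN -gcclassD /= addr0 add0r. Qed.

Lemma k0_classD (p q : idem A) : k0_class (dsum p q) = k0_class p + k0_class q.
Proof. by rewrite /k0_class -gcclassD /= addr0 vclassD. Qed.

Lemma identity_idem (u : A) : is_identity u -> corner u ** corner u = corner u.
Proof. by move=> uP; rewrite -cornerM (uP u).1. Qed.

(* The class [1_A], for A unital with identity element u. *)
Definition k0_one (u : A) (uP : is_identity u) : K0 A :=
  k0_class (Idem (identity_idem uP)).

End K0Class.

Section K0Map.
Context (K : fieldType) (A B : nuAlgType K) (f : {nuhom A -> B}).

Lemma idem_map_idem (p : idem A) :
  minf_map f p ** minf_map f p = minf_map f p.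
Proof. by rewrite -nmorphM idemP. Qed.
Definition idem_map (p : idem A) : idem B := Idem (idem_map_idem p).

Lemma mvn_map p q : mvn p q -> mvn (idem_map p) (idem_map q).
Proof.
case/mvnE=> x [y [[px xq qy yp] [xy yx]]].
by apply: (@mvnP _ _ _ _ (minf_map f x) (minf_map f y));
  rewrite -nmorphM /= (px, xq, qy, yp, xy, yx).
Qed.

Definition vmap (c : vmon A) : vmon B := vclass (idem_map (prepr c)).

Lemma vmapE p : vmap (vclass p) = vclass (idem_map p).
Proof. by apply/vclassP; apply: mvn_map; apply: (prepr_class (mvn_equivalence A)). Qed.

Lemma vmap0 : vmap 0 = 0.
Proof. by rewrite [0 in LHS]/GRing.zero/= vmapE; apply: vclass_eq; rewrite /= linear0. Qed.

Lemma vmapD : {morph vmap : c d / c + d}.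
Proof.
elim/vclassW=> p; elim/vclassW=> q; rewrite -vclassD !vmapE.
have pn : supported (msize p) (ival (idem_map p)).
  by move=> i j ij /=; rewrite msizeP ?linear0.
rewrite [RHS](vadd_at _ pn); apply: vclass_eq => /=.
by rewrite linearD /= minf_map_shift.
Qed.

Definition k0_map (c : K0 A) : K0 B :=
  gcclass (vmap (prepr c).1, vmap (prepr c).2).

Lemma k0_mapE x : k0_map (gcclass x) = gcclass (vmap x.1, vmap x.2).
Proof.
apply/gcclassP; have [e xe] := prepr_class (gcrel_equivalence (vmon A)) x.
by exists (vmap e); rewrite /= -!vmapD xe.
Qed.

Lemma k0_map_class p : k0_map (k0_class p) = k0_class (idem_map p).
Proof. by rewrite k0_mapE /= vmapE vmap0. Qed.

Lemma k0_map_is_zmod_morphism : zmod_morphism k0_map.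
Proof.
elim/gcclassW=> x; elim/gcclassW=> y.
rewrite -gcclassN -gcclassD !k0_mapE /= !vmapD.
by rewrite (gcclassD (_, _) (_, _)) -(gcclassN (_, _)).
Qed.
HB.instance Definition _ :=
  GRing.isZmodMorphism.Build (K0 A) (K0 B) k0_map k0_map_is_zmod_morphism.

End K0Map.

Definition purely_infinite_simple (R : nzRingType) : Prop :=
  ~ (forall x : R, x != 0 -> exists y, x * y = 1 /\ y * x = 1) /\
  forall x : R, x != 0 -> exists a b, a * x * b = 1.

(* Main.v *)
Require Import Defs.
From HB Require Import structures.
From mathcomp Require Import all_boot all_algebra finmap.
From mathcomp Require Import boolp classical_sets functions cardinality fsbigop.

(** For a purely infinite simple ring R, the nonzero classes in V(R) form a group,
namely K_0(R): every class is realized by a nonzero idempotent below any given one,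
and nonzero idempotents of R with the same class are equivalent. So one can choose
orthogonal nonzero idempotents p_v of R with [p_v] = xi[v], then, inside p_v,
orthogonal idempotents equivalent to the p_(r(e)) for the edges e leaving v. When v
is regular, [v] is the sum of the [r(e)] and one of these idempotents can be enlarged
so that they add up to p_v; the same trick makes the p_v add up to 1 in (iii). The
equivalences are the images of the edges and ghost edges.

The resulting map has the right effect on K_0 because K_0(L(E)) is generated by the
classes of the vertices. Given an idempotent matrix p over L(E), replace E by the
finite graph F of the edges occurring in p, with an added sink w' for the part of each
vertex w that these edges do not exhaust. For all t in a complete set T of long paths
of F, the columns of p t have entries in the path algebra of F, and p is the sum of the
(p t) t^*. Groebner reduction of these columns leads to p = sum_i b_i c_i, where the
leading words of the b_i are not prefixes of each other; then the b_i are independent,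
so c_i b_j = delta_ij v_i for vertices v_i of F, and [p] = sum_i [v_i]. *)

Set Implicit Arguments.
Unset Strict Implicit.
Unset Printing Implicit Defensive.

Import GRing.Theory.
Local Open Scope classical_set_scope.
Local Open Scope ring_scope.

(** * K-theory classes of matrices *)

(** Every relation that holds in K_0(L(E)) is respected by [xi] because [xi] is defined there. The
    only fact needed about K_0(L(E)) is therefore that vertices generate it, and K_0(psi) is
    compared with [xi] on vertices alone. Ghost edges obstruct a division algorithm for columns over
    L(E); long paths on the right move the columns into the path algebra, where leading words behave
    as in a free algebra. A second obstacle is that a complement w' may be zero, namely when the
    chosen edges are all the edges leaving a regular vertex. Hence the conditions [P u != 0], and
    hence a representation of L(E) in which each nonzero vertex projection of F fixes a basis point:
    it shows that paths with a common nonzero end are linearly independent. Countability of the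
    edges enters through injective codes into the natural numbers: orthogonal isometries of R form a
    sequence, and disjoint copies of N, one for each edge leaving a vertex, must fit into a single
    N. *)

Section TotalClass.
Context (K : fieldType) (A : nuAlgType K).
Implicit Types p q x y : minf A.

(* The class of an idempotent, with junk value 0 on other matrices. *)
Definition vc x : vmon A :=
  if pselect (x ** x = x) is left h then vclass (Idem h) else 0.

Definition kc x : K0 A := gcclass (vc x, 0).

Lemma vcE (p : idem A) : vc (ival p) = vclass p.
Proof.
rewrite /vc; case: pselect => [h|]; first exact: vclass_eq.
by case; apply: idemP.
Qed.

Lemma kcE (p : idem A) : kc (ival p) = k0_class p.
Proof. by rewrite /kc vcE. Qed.

(** Mutual generalized inverses carry their own equivalence: both products are automatically
    idempotent, and [x], [y] are the two partial isomorphisms. *)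
Lemma vc_swap x y : x ** y ** x = x -> y ** x ** y = y ->
  vc (x ** y) = vc (y ** x).
Proof.
move=> xyx yxy.
have ip : (x ** y) ** (x ** y) = x ** y by rewrite nmulA xyx.
have iq : (y ** x) ** (y ** x) = y ** x by rewrite nmulA yxy.
rewrite -[x ** y]/(ival (Idem ip)) -[y ** x]/(ival (Idem iq)) !vcE.
apply/vclassP; apply: (@mvnP _ _ (Idem ip) (Idem iq) x y) => //=.
- by rewrite nmulA xyx.
- by rewrite nmulA yxy.
Qed.

Lemma vcD p q : p ** p = p -> q ** q = q -> p ** q = 0 -> q ** p = 0 ->
  vc (p + q) = vc p + vc q.
Proof.
move=> ip iq pq qp.
have is_ : (p + q) ** (p + q) = p + q.
  by rewrite nmulDl !nmulDr ip iq pq qp addr0 add0r.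
rewrite -[p + q]/(ival (Idem is_)) -[p in RHS]/(ival (Idem ip)).
rewrite -[q in RHS]/(ival (Idem iq)) !vcE -vclassD.
set n := msize p; have pn : supported n p := @msizeP _ p.
have pM b l : p ** mshift n l b = 0.
  by rewrite -[p]mshift00 (mshiftM_lo _ _ (ival_hi pn)).
have Mp b l : mshift l n b ** p = 0.
  by rewrite -[p]mshift00 (mshiftM_hi _ _ (ival_lo pn)).
have pMr b l : p ** mshift 0 l b = mshift 0 l (p ** b).
  by rewrite -{1}[p]mshift00 mshiftM.
have Mpr b l : mshift l 0 b ** p = mshift l 0 (b ** p).
  by rewrite -{1}[p]mshift00 mshiftM.
have qM b l : q ** mshift 0 l b = mshift 0 l (q ** b).
  by rewrite -{1}[q]mshift00 mshiftM.
have Mq b l : mshift l 0 b ** q = mshift l 0 (b ** q).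
  by rewrite -{1}[q]mshift00 mshiftM.
(* The witnesses are the block row and the block column with entries [p] and [q]. One product is
   [p + q]; orthogonality makes the other one block diagonal. *)
apply/vclassP; apply: (@mvnP _ _ (Idem is_) (dsum (Idem ip) (Idem iq))
  (p + mshift 0 n q) (p + mshift n 0 q)); rewrite /= -?/n !(nmulDl, nmulDr);
  by rewrite !(pM, Mp, pMr, Mpr, qM, Mq, mshiftM, pq, qp, ip, iq, mshift0,
    mshift00, addr0, add0r).
Qed.

Lemma vc_eq0 p : p ** p = p -> vc p = 0 -> p = 0.
Proof.
move=> ip; rewrite -[p]/(ival (Idem ip)) vcE => /(vclassP _ _)/mvnE.
by case=> x [y [[_ + _ _] [+ _]]]; rewrite nmulr0 => <- <-; rewrite nmul0r.
Qed.

Lemma kc_swap x y : x ** y ** x = x -> y ** x ** y = y ->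
  kc (x ** y) = kc (y ** x).
Proof. by move=> xyx yxy; rewrite /kc (vc_swap xyx yxy). Qed.

Lemma kcD p q : p ** p = p -> q ** q = q -> p ** q = 0 -> q ** p = 0 ->
  kc (p + q) = kc p + kc q.
Proof.
by move=> ip iq pq qp; rewrite /kc vcD// -gcclassD /= addr0.
Qed.

Lemma kc0 : kc 0 = 0.
Proof.
rewrite -[0 : minf A]/(ival (idem0 A)) /kc vcE; apply/gcclassP.
by exists 0; rewrite /=.
Qed.

Lemma orth_sum_idem (I : eqType) (r : seq I) (F : I -> minf A) : uniq r ->
  (forall i j, i \in r -> j \in r -> F i ** F j = if i == j then F i else 0) ->
  (\sum_(i <- r) F i) ** (\sum_(i <- r) F i) = \sum_(i <- r) F i.
Proof.
move=> ur FF; rewrite nmul_suml big_seq [RHS]big_seq; apply: eq_bigr => i ir.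
rewrite nmul_sumr (bigD1_seq i)//= FF// eqxx big_seq_cond big1 ?addr0// => j.
by case/andP=> jr ji; rewrite FF// eq_sym (negbTE ji).
Qed.

Lemma kc_sum (I : eqType) (r : seq I) (F : I -> minf A) : uniq r ->
  (forall i j, i \in r -> j \in r -> F i ** F j = if i == j then F i else 0) ->
  kc (\sum_(i <- r) F i) = \sum_(i <- r) kc (F i).
Proof.
elim: r => [|i r IH] /=; first by rewrite !big_nil kc0.
move=> /andP[ir ur] FF; rewrite !big_cons.
have FFr j k : j \in r -> k \in r -> F j ** F k = if j == k then F j else 0.
  by move=> jr kr; rewrite FF// inE ?jr ?kr orbT.
have ni j : j \in r -> (i == j) = false.
  by move=> jr; apply: contraNF ir => /eqP ->.
rewrite kcD ?IH//.
- by rewrite FF ?mem_head// eqxx.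
- exact: orth_sum_idem.
- rewrite nmul_sumr big_seq big1// => j jr.
  by rewrite FF ?ni// inE ?eqxx// jr orbT.
- rewrite nmul_suml big_seq big1// => j jr.
  by rewrite FF ?[j == i]eq_sym ?ni// inE ?eqxx// jr orbT.
Qed.

Lemma corner_inj : injective (@corner K A).
Proof. by move=> x y /(congr1 (fun a : minf A => a 0%N 0%N)). Qed.

Lemma supported1_corner (a : minf A) : supported 1 a -> a = corner (a 0%N 0%N).
Proof.
by move=> a1; apply: minfP => -[|i] [|j] //=; rewrite a1.
Qed.

(** Corners on both sides leave only the entry at (0, 0), so an equivalence between corners in
    [minf A] comes from elements of [A]. *)
Lemma corner_sandwich (p q : A) (a : minf A) :
  corner p ** a = a -> a ** corner q = a -> a = corner (a 0%N 0%N).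
Proof.
move=> pa aq; apply: supported1_corner => i j /orP[i0|j0].
  rewrite -pa (minfME (n := 0)) ?big_geq// => k _.
  have -> : corner p i k = 0 by apply: supported_corner; rewrite i0.
  by rewrite nmul0r.
rewrite -aq (minfME (n := 0)) ?big_geq// => k _.
have -> : corner q k j = 0 by apply: supported_corner; rewrite j0 orbT.
by rewrite nmulr0.
Qed.

End TotalClass.

(** * Homomorphisms out of presented algebras *)

Section PresentationLift.
Context (K : fieldType) (X : Type) (A : nuAlgType K) (f : X -> A).

Fixpoint alg_eval (t : alg_term K X) : A :=
  match t with
  | tgen x => f x
  | tzero => 0
  | topp t => - alg_eval t
  | tadd t u => alg_eval t + alg_eval u
  | tscale a t => a *: alg_eval t
  | tmul t u => alg_eval t ** alg_eval u
  end.

Context (rel : alg_term K X -> alg_term K X -> Prop).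
Hypothesis rel_eval : forall t u, rel t u -> alg_eval t = alg_eval u.

Lemma alg_eval_pres t u : pres_eq rel t u -> alg_eval t = alg_eval u.
Proof.
elim=> //=.
- by move=> t1 u1 w1 _ -> _ ->.
- by move=> t1 t2 _ ->.
- by move=> t1 t2 u1 u2 _ -> _ ->.
- by move=> a t1 t2 _ ->.
- by move=> t1 t2 u1 u2 _ -> _ ->.
- by move=> *; rewrite addrA.
- by move=> *; rewrite addrC.
- by move=> *; rewrite add0r.
- by move=> *; rewrite addNr.
- by move=> *; rewrite scalerA.
- by move=> *; rewrite scale1r.
- by move=> *; rewrite scalerDr.
- by move=> *; rewrite scalerDl.
- by move=> *; rewrite nmulA.
- by move=> *; rewrite nmulDl.
- by move=> *; rewrite nmulDr.
- by move=> *; rewrite nscalerAl.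
- by move=> *; rewrite nscalerAr.
Qed.

(* The hypothesis is an argument so that the morphism structures below can be
   inferred from the function. *)
Definition pres_lift
    (_ : forall t u, rel t u -> alg_eval t = alg_eval u)
    (c : presented rel) : A := alg_eval (prepr c).

Notation lift := (pres_lift rel_eval).

Lemma pres_liftE t : lift (pres_class rel t) = alg_eval t.
Proof. exact/alg_eval_pres/(prepr_class (pres_equivalence rel)). Qed.

Lemma pres_lift_is_linear : linear lift.
Proof.
move=> a; elim/pres_classW=> t; elim/pres_classW=> u.
by rewrite -pres_classZ -pres_classD !pres_liftE.
Qed.
HB.instance Definition _ :=
  GRing.isLinear.Build K (presented rel) A *:%R lift pres_lift_is_linear.

Lemma pres_liftM : {morph lift : x y / x ** y}.
Proof.
elim/pres_classW=> t; elim/pres_classW=> u.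
by rewrite -pres_classM !pres_liftE.
Qed.
HB.instance Definition _ :=
  isNUMultiplicative.Build K (presented rel) A lift pres_liftM.

End PresentationLift.

Section NUComposition.
Context (K : fieldType) (A B C : nuAlgType K).
Variables (g : {nuhom B -> C}) (f : {nuhom A -> B}).

Lemma comp_nmorphM : {morph (g \o f) : x y / x ** y}.
Proof. by move=> x y; rewrite /= !nmorphM. Qed.
HB.instance Definition _ := isNUMultiplicative.Build K A C (g \o f) comp_nmorphM.

End NUComposition.

Section K0Functor.
Context (K : fieldType) (A B : nuAlgType K) (f : {nuhom A -> B}).

Lemma k0_map_kc (p : minf A) : p ** p = p -> k0_map f (kc p) = kc (minf_map f p).
Proof.
move=> ip; rewrite -[p]/(ival (Idem ip)) kcE k0_map_class.
by rewrite -[minf_map f _]/(ival (idem_map f (Idem ip))) kcE.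
Qed.

Lemma minf_map_corner (x : A) : minf_map f (corner x) = corner (f x).
Proof. by apply: minfP => i j /=; case: ifP => // _; rewrite linear0. Qed.

Lemma k0_map_corner (p : A) : p ** p = p ->
  k0_map f (kc (corner p)) = kc (corner (f p)).
Proof. by move=> ip; rewrite k0_map_kc ?minf_map_corner// -cornerM ip. Qed.

End K0Functor.

(** * Relations and universal property of L(E) *)

Section LeavittRelations.
Context (K : fieldType) (E : graph).
Local Notation L := (leavitt K E).
Local Notation V := (@lpa_vertex K E).
Local Notation S := (@lpa_edge K E).
Local Notation T := (@lpa_ghost K E).

Lemma lpa_VS e : V (gsource e) ** S e = S e.
Proof. by rewrite -pres_classM; apply/lpa_relE/lpa_source_edge. Qed.
Lemma lpa_SV e : S e ** V (grange e) = S e.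
Proof. by rewrite -pres_classM; apply/lpa_relE/lpa_edge_range. Qed.
Lemma lpa_VT e : V (grange e) ** T e = T e.
Proof. by rewrite -pres_classM; apply/lpa_relE/lpa_range_ghost. Qed.
Lemma lpa_TV e : T e ** V (gsource e) = T e.
Proof. by rewrite -pres_classM; apply/lpa_relE/lpa_ghost_source. Qed.
Lemma lpa_TS e f : T e ** S f = if e == f then V (grange e) else 0.
Proof.
rewrite -pres_classM; case: eqVneq => [->|/eqP ef].
  exact/lpa_relE/lpa_ghost_edge.
exact/lpa_relE/lpa_ghost_orth.
Qed.
Lemma lpa_CK v : emitted v !=set0 -> finite_set (emitted v) ->
  V v = \sum_(e <- fset_set (emitted v)) S e ** T e.
Proof.
move=> v0 vf; rewrite /lpa_vertex (lpa_relE (lpa_regular K v0 vf)).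
elim/big_rec2: _ => [|e x y _ <-]; first exact: pres_class0.
by rewrite pres_classD pres_classM.
Qed.

Lemma kc_edge_ghost e : kc (corner (S e ** T e)) = kc (corner (V (grange e))).
Proof.
rewrite cornerM kc_swap -!cornerM; last first.
- by rewrite lpa_TS eqxx lpa_VT.
- by rewrite -nmulA lpa_TS eqxx lpa_SV.
by rewrite lpa_TS eqxx.
Qed.

Lemma edge_ghostM e f :
  (S e ** T e) ** (S f ** T f) = if e == f then S e ** T e else 0.
Proof.
rewrite nmulA -(nmulA (S e)) lpa_TS; case: eqP => [->|_]; first by rewrite lpa_SV.
by rewrite nmulr0 nmul0r.
Qed.

End LeavittRelations.

Section LeavittLift.
Context (K : fieldType) (E : graph) (A : nuAlgType K).
Variables (p : vertex E -> A) (s t : edge E -> A).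
Hypothesis pp : forall v w, p v ** p w = if v == w then p v else 0.
Hypothesis ps : forall e, p (gsource e) ** s e = s e.
Hypothesis sp : forall e, s e ** p (grange e) = s e.
Hypothesis pt : forall e, p (grange e) ** t e = t e.
Hypothesis tp : forall e, t e ** p (gsource e) = t e.
Hypothesis ts : forall e f, t e ** s f = if e == f then p (grange e) else 0.
Hypothesis ck : forall v, emitted v !=set0 -> finite_set (emitted v) ->
  p v = \sum_(e <- fset_set (emitted v)) s e ** t e.

Definition lpa_gens (x : lpa_gen E) : A :=
  match x with gvertex v => p v | gedge e => s e | gghost e => t e end.

Lemma lpa_gens_rel x y : lpa_rel x y ->
  alg_eval lpa_gens x = alg_eval lpa_gens y :> A.
Proof.
case=> /=.
- by move=> v; rewrite pp eqxx.
- by move=> v w /eqP vw; rewrite pp (negbTE vw).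
- exact: ps.
- exact: sp.
- exact: pt.
- exact: tp.
- by move=> e; rewrite ts eqxx.
- by move=> e f /eqP ef; rewrite ts (negbTE ef).
- move=> v v0 vf; rewrite (ck v0 vf).
  by elim/big_rec2: _ => // e a b _ ->.
Qed.

Definition lpa_lift : {nuhom leavitt K E -> A} := pres_lift lpa_gens_rel.

Lemma lpa_liftV v : lpa_lift (lpa_vertex K v) = p v.
Proof. exact: pres_liftE. Qed.

End LeavittLift.

(** * Purely infinite simple rings *)

Section UnitalClass.
Context (K : fieldType) (R : algType K).
Implicit Types p q x y : R.

Definition vr x : vmon R := vc (corner x).
Definition kr x : K0 R := kc (corner x).

Lemma cornerMr x y : corner x ** corner y = corner (x * y).
Proof. by rewrite -cornerM. Qed.

Lemma vr_swap x y : x * y * x = x -> y * x * y = y -> vr (x * y) = vr (y * x).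
Proof.
by move=> xyx yxy; rewrite /vr -!cornerMr vc_swap// !cornerMr ?xyx ?yxy.
Qed.

Lemma kr_swap x y : x * y * x = x -> y * x * y = y -> kr (x * y) = kr (y * x).
Proof. by move=> xyx yxy; rewrite /kr /kc -!/(vr _) vr_swap. Qed.

Lemma vrD p q : p * p = p -> q * q = q -> p * q = 0 -> q * p = 0 ->
  vr (p + q) = vr p + vr q.
Proof.
by move=> ip iq pq qp; rewrite /vr linearD vcD// cornerMr ?ip ?iq ?pq ?qp ?linear0.
Qed.

Lemma vr_eq0 p : p * p = p -> vr p = 0 -> p = 0.
Proof.
move=> ip /vc_eq0 p0; apply: (@corner_inj K R); rewrite p0 ?linear0//.
by rewrite cornerMr ip.
Qed.

Lemma kr_sum (I : eqType) (r : seq I) (F : I -> R) : uniq r ->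
  (forall i j, i \in r -> j \in r -> F i * F j = if i == j then F i else 0) ->
  kr (\sum_(i <- r) F i) = \sum_(i <- r) kr (F i).
Proof.
move=> ur FF; rewrite /kr linear_sum kc_sum// => i j ir jr.
by rewrite cornerMr FF//; case: ifP => // _; rewrite linear0.
Qed.

Lemma vaddr_eq0 (x y : vmon R) : x + y = 0 -> y = 0.
Proof.
elim/vclassW: x => p; elim/vclassW: y => q; rewrite -vclassD -!vcE.
move/(vc_eq0 (idemP (dsum p q))) => /= pq0.
suff -> : ival q = 0 by rewrite -[0]/(ival (idem0 R)) vcE.
apply: minfP => i j.
have : (ival p + mshift (msize p) (msize p) q) (msize p + i)%N (msize p + j)%N
    = 0 by rewrite pq0.
by rewrite /= !leq_addr !addKn msizeP ?leq_addr// add0r.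
Qed.

End UnitalClass.

Section PurelyInfiniteSimple.
Context (K : fieldType) (R : algType K).
Hypothesis pisR : purely_infinite_simple R.

(* A ring with a one-sided inverse y z = 1 that is not two-sided has the nonzero
   idempotent e = 1 - z y, and a e b = 1 yields a second isometry e b whose range
   is orthogonal to that of z. *)
Lemma orthogonal_isometries : exists s t : nat -> R,
  forall m n, t m * s n = (m == n)%:R.
Proof.
have [nd simp] := pisR.
have [y [z [yz zy]]] : exists y z : R, y * z = 1 /\ z * y != 1.
  (* If every one-sided inverse were two-sided, [a * x * b = 1] would make [b * a] an inverse of
     [x], and [R] would be a division ring. *)
  apply: contrapT => nyz; apply: nd => x x0.
  have swap (y z : R) : y * z = 1 -> z * y = 1.
    by move=> yz; apply/eqP/negPn/negP => zy; apply: nyz; exists y, z.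
  have [a [b axb]] := simp x x0.
  have xba : x * (b * a) = 1 by rewrite mulrA swap// mulrA.
  by exists (b * a); split; last exact: swap.
pose e := 1 - z * y.
have e0 : e != 0 by rewrite subr_eq0 eq_sym.
have ye : y * e = 0 by rewrite mulrBr mulr1 mulrA yz mul1r subrr.
have ez : e * z = 0 by rewrite mulrBl mul1r -mulrA yz mulr1 subrr.
have [a [b aeb]] := simp e e0.
pose u := e * b; pose v := a * e.
have ee : e * e = e by rewrite {1}/e mulrBl mul1r -mulrA ye mulr0 subr0.
have vu : v * u = 1 by rewrite /v /u mulrA -(mulrA a) ee.
have yu : y * u = 0 by rewrite mulrA ye mul0r.
have vz : v * z = 0 by rewrite -mulrA ez mulr0.
(* Since [y ^+ k * z ^+ k = 1], the common powers cancel; what remains for [m != n] contains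
   [v * z = 0] or [y * u = 0]. *)
exists (fun n => z ^+ n * u), (fun n => v * y ^+ n) => m n.
have yzn k : y ^+ k * z ^+ k = 1.
  elim: k => [|k IH]; first by rewrite mulr1.
  by rewrite exprSr exprS mulrA -(mulrA _ y z) yz mulr1.
rewrite -mulrA (mulrA (y ^+ m)).
case: (ltngtP m n) => [mn|nm|->]; last by rewrite yzn mul1r.
  rewrite -(subnKC mn) exprD exprSr !mulrA -(mulrA v) yzn mulr1.
  by rewrite vz !mul0r.
rewrite -(subnK nm) exprD exprS mulrA.
have -> : y ^+ (m - n.+1) * (y * y ^+ n) * z ^+ n = y ^+ (m - n.+1) * y.
  by rewrite mulrA -mulrA yzn mulr1.
by rewrite -!mulrA yu !mulr0.
Qed.

(** The row [x] of the [s j] and the column [y] of the [t i] satisfy [y ** x = 1] in M_n R, so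
    [x ** p ** y] is an idempotent of the corner with the class of [p]. *)
Lemma vmon_unital (c : vmon R) : exists p : R, p * p = p /\ c = vr p.
Proof.
have [s [t ts]] := orthogonal_isometries.
elim/vclassW: c => p; rewrite -vcE; set n := msize p.
pose xf i j := if (i == 0%N) && (j < n)%N then s j else 0 : R.
pose yf i j := if (j == 0%N) && (i < n)%N then t i else 0 : R.
have xfin : supported n.+1 xf.
  by move=> [|i] j //= nj; rewrite /xf ltnNge (ltnW nj).
have yfin : supported n.+1 yf.
  by move=> i [|j] //=; rewrite orbF => ni; rewrite /yf ltnNge (ltnW ni).
pose x := minf_of xfin; pose y := minf_of yfin.
have pyx : ival p ** y ** x = p.
  rewrite -nmulA; apply: minfP => i j.
  rewrite (minfME (n := n)) => [|k nk]; last first.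
    by rewrite msizeP ?nk ?orbT// nmul0r.
  have yx k : (k < n)%N -> (y ** x) k j = if k == j then 1 else 0.
    move=> kn; rewrite (minfME (n := 1)) => [|l l1]; last first.
      by rewrite /= /yf; case: l l1 => //= l _; rewrite nmul0r.
    rewrite big_nat1 /= /yf /xf /= kn; case: ltnP => jn.
      by rewrite -[_ ** _]/(_ * _) ts; case: eqP.
    rewrite nmulr0; case: eqP => // kj; move: jn.
    by rewrite -kj leqNgt kn.
  have [jn|nj] := ltnP j n.
    rewrite big_mkord (bigD1 (Ordinal jn)) // yx// eqxx big1 => [|k kj].
      by rewrite [LHS]addr0 -[LHS]/(_ * _) mulr1.
    rewrite yx//; case: eqP => [kE|_]; last by rewrite nmulr0.
    by case/eqP: kj; apply: val_inj.
  rewrite [RHS]msizeP ?nj ?orbT// big_nat big1// => k /andP[_ kn].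
  rewrite yx//; case: eqP => [kj|]; last by rewrite nmulr0.
  by rewrite kj ltnNge nj in kn.
pose z := x ** ival p ** y.
have AB : (ival p ** y) ** (x ** ival p) = p by rewrite nmulA pyx idemP.
have BA : (x ** ival p) ** (ival p ** y) = z.
  by rewrite nmulA -(nmulA x) idemP.
have ABA : (ival p ** y) ** (x ** ival p) ** (ival p ** y) = ival p ** y.
  by rewrite AB nmulA idemP.
have BAB : (x ** ival p) ** (ival p ** y) ** (x ** ival p) = x ** ival p.
  by rewrite -nmulA AB -nmulA idemP.
have pz : vc (ival p) = vc z by rewrite -{1}AB -BA vc_swap.
have zz : z ** z = z by rewrite -BA -[in RHS]ABA !nmulA.
have zE : z = corner (z 0%N 0%N).
  apply: (@corner_sandwich K R 1 1).
    rewrite /z !nmulA; congr (_ ** _ ** _).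
    apply: minfP => i j; rewrite (minfME (n := 1)) => [|l l1].
      rewrite big_nat1 /= /xf; case: i => [|i] /=; last by rewrite nmul0r.
      by rewrite -[_ ** _]/(_ * _) mul1r.
    by rewrite /= andbC; case: l l1 => // l _; rewrite nmul0r.
  rewrite /z -!nmulA; congr (_ ** (_ ** _)).
  apply: minfP => i j; rewrite (minfME (n := 1)) => [|l l1].
    rewrite big_nat1 /= /yf; case: j => [|j] /=; last by rewrite nmulr0.
    by rewrite -[_ ** _]/(_ * _) mulr1.
  by rewrite /= /yf; case: l l1 => // l _; rewrite nmul0r.
exists (z 0%N 0%N); rewrite /vr -zE; split=> //.
by apply: (@corner_inj K R); rewrite -cornerMr -zE.
Qed.

(** From [a * q * b = 1], the element [q * b * s 0 * p] embeds [p] below [q]. Inserting [s 0] leaves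
    the orthogonal isometry [s 1] free, which keeps the complement from vanishing. *)
Lemma idem_divisible (p q : R) : p * p = p -> q * q = q -> q != 0 ->
  exists p' q', [/\ p' * p' = p', q' * q' = q', p' * q' = 0 /\ q' * p' = 0,
    p' + q' = q /\ q' != 0 & vr p' = vr p].
Proof.
move=> ip iq q0; have [s [t ts]] := orthogonal_isometries.
have [a [b aqb]] := pisR.2 q q0.
pose x := q * b * s 0%N * p; pose y := p * t 0%N * a * q.
have yx : y * x = p.
  rewrite /x /y -!mulrA (mulrA q q) iq (mulrA q) (mulrA a) (mulrA a) aqb mul1r.
  by rewrite (mulrA (t 0%N)) ts mul1r.
have qx : q * x = x by rewrite /x !mulrA iq.
have yq : y * q = y by rewrite /y -!mulrA iq.
have px : x * p = x by rewrite /x -mulrA ip.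
have py : p * y = y by rewrite /y !mulrA ip.
have ixy : x * y * (x * y) = x * y by rewrite mulrA -(mulrA x) yx px.
exists (x * y), (q - x * y).
have h1 : x * y * (q - x * y) = 0 by rewrite mulrBr ixy -mulrA yq subrr.
have h2 : (q - x * y) * (x * y) = 0 by rewrite mulrBl ixy mulrA qx subrr.
split=> //.
- by rewrite mulrBl {1}mulrBr iq mulrA qx h1 subr0.
- split; first by rewrite addrC subrK.
  apply/eqP => h.
  (* This compression sends [q] to 1 and [x * y] to 0. *)
  have := congr1 (fun u => t 1%N * a * u * (q * b * s 1%N)) h.
  rewrite /= mulr0 mul0r mulrBr mulrBl.
  have -> : t 1%N * a * q * (q * b * s 1%N) = 1.
    rewrite -!mulrA (mulrA q q) iq (mulrA q) (mulrA a) (mulrA a) aqb mul1r.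
    by rewrite ts.
  have -> : t 1%N * a * (x * y) * (q * b * s 1%N) = 0.
    rewrite /x -!mulrA (mulrA q) (mulrA a) (mulrA a) aqb mul1r.
    by rewrite (mulrA (t 1%N)) ts mul0r.
  by move/eqP; rewrite subr0 oner_eq0.
- by rewrite vr_swap ?yx ?py// -mulrA yx px.
Qed.

Lemma vmon_divisible (x y : vmon R) : y != 0 -> exists2 z, z != 0 & y = x + z.
Proof.
have [p [ip ->]] := vmon_unital x; have [q [iq ->]] := vmon_unital y => y0.
have q0 : q != 0.
  apply: contraNneq y0 => ->; apply/eqP; rewrite /vr linear0.
  by rewrite -[0 : minf R]/(ival (idem0 R)) vcE.
have [p' [q' [ip' iq' [pq qp] [<- q'0] <-]]] := idem_divisible ip iq q0.
exists (vr q'); last by rewrite vrD.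
by apply: contraNneq q'0 => /(vr_eq0 iq') ->.
Qed.

(* By divisibility, the nonzero elements of the monoid form a group. *)
Lemma vmon_cancel (x y e : vmon R) : x != 0 -> y != 0 -> x + e = y + e -> x = y.
Proof.
(* From [x = x + u] and [y = x + w], [u] is neutral for both [x] and [y]; adding [f], where
   [u = e + f], to the hypothesis replaces [e] by [u]. *)
move=> x0 y0 xy; have [u u0 xu] := vmon_divisible x x0.
have [w _ yw] := vmon_divisible x y0.
have [f _ uf] := vmon_divisible e u0.
by rewrite xu uf addrA xy -addrA -uf yw addrAC -xu.
Qed.

(** If [vr 1 = vr 1 + u] then [u] is zero in K_0; writing [u = b + z] makes [z] a representative of
    minus the class of [b], so [a + z] represents the given difference. As [z] is nonzero, so is the
    idempotent. *)
Lemma kr_surjective (c : K0 R) : exists p : R, [/\ p * p = p, p != 0 & kr p = c].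
Proof.
have v1 : vr (1 : R) != 0.
  by apply/eqP => /vr_eq0 h; have := oner_neq0 R; rewrite h ?eqxx ?mulr1.
elim/gcclassW: c => -[a b]; have [u u0 wu] := vmon_divisible (vr 1) v1.
have [z z0 uz] := vmon_divisible b u0.
have [p [ip pE]] := vmon_unital (a + z).
exists p; split=> //.
  apply: contraNneq z0 => p0; apply/eqP/(@vaddr_eq0 _ _ a).
  rewrite pE p0 /vr linear0.
  by rewrite -[0 : minf R]/(ival (idem0 R)) vcE.
apply/gcclassP; exists (vr 1); rewrite /= -/(vr p) -pE addr0.
by rewrite -(addrA a) (addrC z) -uz -addrA (addrC u) -wu.
Qed.

(** Cancellation turns equality in K_0 into equality in the monoid, and [corner_sandwich] brings the
    equivalence from matrices down to [R]. *)
Lemma kr_mvn (p q : R) : p * p = p -> q * q = q -> p != 0 -> q != 0 ->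
  kr p = kr q -> exists x y, [/\ x * y = p, y * x = q, p * x = x, x * q = x
    & q * y = y /\ y * p = y].
Proof.
move=> ip iq p0 q0 /gcclassP[e /=]; rewrite !addr0 => /vmon_cancel pq.
have {}pq : vr p = vr q.
  by apply: pq; [apply: contraNneq p0|apply: contraNneq q0] => /vr_eq0 ->.
have icp : corner p ** corner p = corner p by rewrite cornerMr ip.
have icq : corner q ** corner q = corner q by rewrite cornerMr iq.
move: pq; rewrite /vr -[corner p]/(ival (Idem icp)) -[corner q]/(ival (Idem icq)).
rewrite !vcE => /(vclassP _ _)/mvnE[X [Y [[/= pX Xq qY Yp] [XY YX]]]].
have XE := corner_sandwich pX Xq; have YE := corner_sandwich qY Yp.
move: pX Xq qY Yp XY YX; rewrite XE YE !cornerMr.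
do 6!move/(@corner_inj K R) => ?.
by exists (X 0%N 0%N), (Y 0%N 0%N); split.
Qed.

End PurelyInfiniteSimple.

(** * Orthogonal idempotents with prescribed classes *)

Section Partition.
Context (K : fieldType) (R : algType K).
Hypothesis pisR : purely_infinite_simple R.

(** Idempotence of [x] is recorded separately, by the orthogonality relations of the family to which
    [x] belongs. *)
Definition realizes (q : R) (c : K0 R) (x : R) : Prop :=
  [/\ q * x = x, x * q = x, x != 0 & kr x = c].

(** The embedding of [idem_divisible] with one isometry per index, selected by [code]: orthogonality
    of the isometries makes the images of the [p i] orthogonal, even for infinitely many indices. *)
Lemma orthogonal_realization (I : eqType) (code : I -> nat) (q : R)
    (kappa : I -> K0 R) : injective code -> q * q = q -> q != 0 ->
  exists Q : I -> R, (forall i j, Q i * Q j = if i == j then Q i else 0) /\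
    forall i, realizes q (kappa i) (Q i).
Proof.
move=> code_inj iq q0; have [s [t ts]] := orthogonal_isometries pisR.
have [a [b aqb]] := pisR.2 q q0.
have [p pP] := choice (fun i => kr_surjective pisR (kappa i)).
pose x i := q * b * s (code i) * p i; pose y i := p i * t (code i) * a * q.
have ip i : p i * p i = p i by case: (pP i).
have xp i : x i * p i = x i by rewrite /x -mulrA ip.
have py i : p i * y i = y i by rewrite /y !mulrA ip.
have yx i j : y i * x j = if i == j then p i else 0.
  rewrite /x /y -!mulrA (mulrA q q) iq (mulrA q) (mulrA a) (mulrA a) aqb mul1r.
  rewrite (mulrA (t _)) ts inj_eq//; case: eqP => [->|_].
    by rewrite mul1r ip.
  by rewrite mul0r mulr0.
exists (fun i => x i * y i); split=> [i j|i].
  rewrite mulrA -(mulrA (x i)) yx; case: eqP => [->|_]; first by rewrite xp.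
  by rewrite mulr0 mul0r.
have [_ p0 pk] := pP i; split.
- by rewrite /x !mulrA iq.
- by rewrite /y -!mulrA iq.
- apply: contraNneq p0 => xy0; apply/eqP.
  have := congr1 (fun u => y i * u * x i) xy0.
  by rewrite /= mulr0 mul0r mulrA yx eqxx -mulrA yx eqxx ip.
- by rewrite kr_swap ?yx ?eqxx ?py// -mulrA yx eqxx xp.
Qed.

(** One member [Q i0] is replaced by [q] minus the sum of the others. The replacement is nonzero
    because [Q i0] lies below it, and its class is found by subtraction in the group K_0. *)
Lemma partition_realization (I : eqType) (r : seq I) (q : R)
    (kappa : I -> K0 R) (Q : I -> R) : uniq r -> r != [::] -> q * q = q ->
  (forall i j, Q i * Q j = if i == j then Q i else 0) ->
  (forall i, realizes q (kappa i) (Q i)) -> kr q = \sum_(i <- r) kappa i ->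
  exists Q' : I -> R,
    [/\ forall i j, i \in r -> j \in r -> Q' i * Q' j = if i == j then Q' i else 0,
        forall i, i \in r -> realizes q (kappa i) (Q' i)
      & \sum_(i <- r) Q' i = q].
Proof.
case: r => [//|i0 r] /= /andP[i0r ur] _ iq QQ Qk qE.
pose P := \sum_(i <- r) Q i.
have qQ i : q * Q i = Q i by case: (Qk i).
have Qq i : Q i * q = Q i by case: (Qk i).
have qP : q * P = P.
  by rewrite mulr_sumr; apply: eq_bigr => i _; case: (Qk i).
have Pq : P * q = P.
  by rewrite mulr_suml; apply: eq_bigr => i _; case: (Qk i).
have PQ i : P * Q i = if i \in r then Q i else 0.
  rewrite mulr_suml; case: ifP => ir.
    rewrite (bigD1_seq i)//= QQ eqxx big1 ?addr0// => j ji.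
    by rewrite QQ (negbTE ji).
  rewrite big_seq big1// => j jr; rewrite QQ; case: eqP => // ji.
  by rewrite -ji jr in ir.
have QP i : Q i * P = if i \in r then Q i else 0.
  rewrite mulr_sumr; case: ifP => ir.
    rewrite (bigD1_seq i)//= QQ eqxx big1 ?addr0// => j ji.
    by rewrite QQ eq_sym (negbTE ji).
  rewrite big_seq big1// => j jr; rewrite QQ; case: eqP => // ji.
  by rewrite ji jr in ir.
have PP : P * P = P.
  by rewrite {1}/P mulr_suml [RHS]big_seq big_seq; apply: eq_bigr => i ir; rewrite QP ir.
pose Q' i := if i == i0 then q - P else Q i.
have Q'r i : i \in r -> Q' i = Q i.
  by move=> ir; rewrite /Q'; case: eqP => // ii0; rewrite -ii0 ir in i0r.
have Q'0 : Q' i0 = q - P by rewrite /Q' eqxx.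
have Q'Q' i j : i \in i0 :: r -> j \in i0 :: r ->
    Q' i * Q' j = if i == j then Q' i else 0.
  rewrite !inE; case: (eqVneq i i0) => [->|ii0] /=; case: (eqVneq j i0) => [->|ji0] /=.
  - by rewrite ?eqxx => _ _; rewrite Q'0 mulrBl !mulrBr iq qP Pq PP subrr subr0.
  - move=> _ jr; rewrite Q'0 Q'r// mulrBl PQ jr qQ subrr.
    by rewrite ?[i0 == j]eq_sym ?(negbTE ji0).
  - by move=> ir _; rewrite Q'0 Q'r// mulrBr QP ir Qq subrr ?(negbTE ii0).
  - by move=> ir jr; rewrite !Q'r.
have sumQ' : \sum_(i <- i0 :: r) Q' i = q.
  rewrite big_cons Q'0 big_seq (eq_bigr Q) => [|i ir]; last exact: Q'r.
  by rewrite -big_seq subrK.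
exists Q'; split=> // i; rewrite inE => /orP[/eqP->|ir]; last by rewrite Q'r.
rewrite Q'0; split.
- by rewrite mulrBr iq qP.
- by rewrite mulrBl iq Pq.
- have [_ _ Q0 _] := Qk i0; apply: contraNneq Q0 => qP0; apply/eqP.
  by have := congr1 (fun u => u * Q i0) qP0; rewrite mul0r mulrBl qQ PQ (negbTE i0r) subr0.
- have := qE; rewrite -{1}sumQ' kr_sum//=; last by rewrite i0r.
  rewrite !big_cons Q'0; suff -> : \sum_(j <- r) kr (Q' j) = \sum_(j <- r) kappa j.
    exact: addIr.
  rewrite big_seq [RHS]big_seq; apply: eq_bigr => j jr.
  by rewrite Q'r//; case: (Qk j).
Qed.

End Partition.

(** * A homomorphism with prescribed values on the vertices *)

Section Realization.
Context (K : fieldType) (E : graph) (R : algType K).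
Hypothesis pisR : purely_infinite_simple R.
Context (xi : {additive K0 (leavitt K E) -> K0 R}).
Hypothesis countableE : countable [set: edge E].

Local Notation vk v := (kc (corner (lpa_vertex K v))).

Lemma vertex_class (v : vertex E) : emitted v !=set0 -> finite_set (emitted v) ->
  vk v = \sum_(e <- fset_set (emitted v)) vk (grange e).
Proof.
move=> v0 vf; rewrite (lpa_CK K v0 vf) linear_sum kc_sum ?fset_uniq// => [|e f].
  by apply: eq_bigr => e _; rewrite /= kc_edge_ghost.
by move=> _ _; rewrite -cornerM edge_ghostM; case: eqP => //; rewrite linear0.
Qed.

Lemma realize_on_vertices (p : vertex E -> R) :
  (forall v w, p v * p w = if v == w then p v else 0) ->
  (forall v, p v != 0) -> (forall v, kr (p v) = xi (vk v)) ->
  exists psi : {nuhom leavitt K E -> R}, forall v, psi (lpa_vertex K v) = p v.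
Proof.
move=> pp p0 pk; have ip v : p v * p v = p v by rewrite pp eqxx.
have [code code_inj] : exists code : edge E -> nat, injective code.
  by case/countable_injP: countableE => f fi; exists f => x y; apply: fi; rewrite in_setT.
have exQ v : exists Q : edge E -> R,
    [/\ forall e f, gsource e = v -> gsource f = v ->
          Q e * Q f = if e == f then Q e else 0,
        forall e, gsource e = v -> realizes (p v) (xi (vk (grange e))) (Q e)
      & emitted v !=set0 -> finite_set (emitted v) ->
          p v = \sum_(e <- fset_set (emitted v)) Q e].
  have [Q [QQ Qk]] := orthogonal_realization pisR (fun e => xi (vk (grange e)))
    code_inj (ip v) (p0 v).
  (* Only at a regular vertex must the idempotents of the edges exhaust [p v]; at any other vertex
     the family [Q] can stay as it is. *)
  have [[v0 vf]|nreg] := pselect (emitted v !=set0 /\ finite_set (emitted v)).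
    have memv e : gsource e = v -> e \in (fset_set (emitted v) : seq _).
      by move=> ev; rewrite in_fset_set//; apply/mem_set.
    have [||||Q' [Q'Q' Q'k sumQ']] := @partition_realization K R _
        (fset_set (emitted v)) (p v) (fun e => xi (vk (grange e))) Q _ _ _ QQ Qk.
    - exact: fset_uniq.
    - by case: v0 => e /memv; case: (fset_set _ : seq _).
    - exact: ip.
    - by rewrite pk vertex_class// raddf_sum.
    exists Q'; split=> // [e f ev fv|e ev].
    - by apply: Q'Q'; apply: memv.
    - by apply: Q'k; apply: memv.
  by exists Q; split=> // v0 vf; case: nreg.
(* Each [Q v] is indexed by all edges; [q] keeps the values at edges leaving [v]. *)
have [Q QP] := choice exQ; pose q e := Q (gsource e) e.
have qk e : realizes (p (gsource e)) (xi (vk (grange e))) (q e).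
  by case: (QP (gsource e)) => _ + _; apply.
have qq e f : q e * q f = if e == f then q e else 0.
  case: (eqVneq (gsource f) (gsource e)) => [fe|fe].
    by rewrite /q fe; case: (QP (gsource e)) => + _ _; apply.
  have [_ <- _ _] := qk e; have [<- _ _ _] := qk f.
  rewrite mulrA -(mulrA (q e)) pp eq_sym (negbTE fe) mulr0 mul0r.
  by case: (eqVneq e f) fe => [->|//]; rewrite eqxx.
have iq e : q e * q e = q e by rewrite qq eqxx.
have exst e : exists st : R * R,
    [/\ st.1 * st.2 = q e, st.2 * st.1 = p (grange e), q e * st.1 = st.1,
      st.1 * p (grange e) = st.1
    & p (grange e) * st.2 = st.2 /\ st.2 * q e = st.2].
  have [_ _ q0 kq] := qk e.
  have [|x [y xyP]] := kr_mvn pisR (iq e) (ip (grange e)) q0 (p0 _).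
    by rewrite kq pk.
  by exists (x, y).
have [st stP] := choice exst.
have h1 v w : p v ** p w = if v == w then p v else 0 by exact: pp.
have h2 e : p (gsource e) ** (st e).1 = (st e).1.
  have [_ _ + _ _] := stP e; have [+ _ _ _] := qk e => pq <-.
  by rewrite nmulA; congr (_ * _).
have h3 e : (st e).1 ** p (grange e) = (st e).1 by case: (stP e).
have h4 e : p (grange e) ** (st e).2 = (st e).2 by case: (stP e) => _ _ _ _ [].
have h5 e : (st e).2 ** p (gsource e) = (st e).2.
  have [_ _ _ _ [_ +]] := stP e; have [_ + _ _] := qk e => qp <-.
  by rewrite -nmulA; congr (_ * _).
have h6 e f : (st e).2 ** (st f).1 = if e == f then p (grange e) else 0.
  case: eqVneq => [<-|ef]; first by case: (stP e).
  have [_ _ _ _ [_ <-]] := stP e; have [_ _ <- _ _] := stP f.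
  rewrite -[LHS]/(_ * _ * (_ * _)) mulrA -(mulrA (st e).2) qq (negbTE ef).
  by rewrite mulr0 mul0r.
have h7 v : emitted v !=set0 -> finite_set (emitted v) ->
    p v = \sum_(e <- fset_set (emitted v)) (st e).1 ** (st e).2.
  move=> v0 vf; have [_ _ ->//] := QP v.
  rewrite big_seq [RHS]big_seq; apply: eq_bigr => e.
  rewrite in_fset_set// => /set_mem <-.
  by case: (stP e) => ST _ _ _ _; exact: esym ST.
exists (lpa_lift h1 h2 h3 h4 h5 h6 h7) => v; exact: lpa_liftV.
Qed.

End Realization.

(** * Idempotents over the algebra of a finite graph *)

Section LinearSpan.
Context (K : fieldType).

Inductive lspan (A : lmodType K) (Q : A -> Prop) : A -> Prop :=
| lspan0 : lspan Q 0
| lspan_cons c x y : Q x -> lspan Q y -> lspan Q (c *: x + y).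

(** Linearity is asked of a bare function, so that maps such as [nmul^~ a] can be used without a
    bundled structure. *)
Lemma lspan_map (A B : lmodType K) (f : A -> B) (Q : A -> Prop) (Q' : B -> Prop) :
  linear f -> (forall x, Q x -> lspan Q' (f x)) ->
  forall x, lspan Q x -> lspan Q' (f x).
Proof.
move=> lf fQ.
have f0 : f 0 = 0 by apply: (addIr (f 0)); rewrite -{1}[f 0]scale1r -lf scale1r !add0r.
have spanP c x y : lspan Q' x -> lspan Q' y -> lspan Q' (c *: x + y).
  elim=> [|d x' y' Qx _ IH] ys; first by rewrite scaler0 add0r.
  by rewrite scalerDr scalerA -addrA; apply: lspan_cons => //; apply: IH.
move=> x; elim=> [|c x' y Qx _ IH]; first by rewrite f0; apply: lspan0.
by rewrite lf; apply: spanP => //; apply: fQ.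
Qed.

Context (A : lmodType K).
Implicit Types (Q : A -> Prop) (x y : A).

Lemma lspan_gen Q x : Q x -> lspan Q x.
Proof. by rewrite -{2}[x]addr0 -{2}[x]scale1r => /lspan_cons; apply; apply: lspan0. Qed.

Lemma lspanP Q c x y : lspan Q x -> lspan Q y -> lspan Q (c *: x + y).
Proof.
elim=> [|d x' y' Qx _ IH] ys; first by rewrite scaler0 add0r.
by rewrite scalerDr scalerA -addrA; apply: lspan_cons => //; apply: IH.
Qed.

Lemma lspanD Q x y : lspan Q x -> lspan Q y -> lspan Q (x + y).
Proof. by move=> xs ys; rewrite -[x]scale1r; apply: lspanP. Qed.

Lemma lspanZ Q c x : lspan Q x -> lspan Q (c *: x).
Proof. by move=> xs; rewrite -[_ *: _]addr0; apply: lspanP => //; apply: lspan0. Qed.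

Lemma lspanB Q x y : lspan Q x -> lspan Q y -> lspan Q (x - y).
Proof. by move=> xs ys; rewrite -scaleN1r addrC; apply: lspanP. Qed.

Lemma lspan_sum Q (I : Type) (r : seq I) (D : pred I) (F : I -> A) :
  (forall i, D i -> lspan Q (F i)) -> lspan Q (\sum_(i <- r | D i) F i).
Proof. by move=> FQ; elim/big_rec: _ => [|i x /FQ]; [exact: lspan0|exact: lspanD]. Qed.

Lemma lspanW Q Q' x : (forall y, Q y -> lspan Q' y) -> lspan Q x -> lspan Q' x.
Proof. by move=> QQ'; apply: (@lspan_map A A id Q Q') => // c u v. Qed.

Lemma lspan_seq Q x : (forall c y, Q y -> Q (c *: y)) -> lspan Q x ->
  exists2 r : seq A, forall y, y \in r -> Q y & x = \sum_(y <- r) y.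
Proof.
move=> QZ; elim=> [|c y z Qy _ [r rQ ->]]; first by exists [::]; rewrite ?big_nil.
exists (c *: y :: r); last by rewrite big_cons.
by move=> u; rewrite inE => /orP[/eqP->|/rQ//]; apply: QZ.
Qed.

End LinearSpan.

Section NULinear.
Context (K : fieldType) (A : nuAlgType K).

Lemma nmul_linear_l (a : A) : linear (nmul a).
Proof. by move=> c x y; rewrite nmulDr nscalerAr. Qed.

Lemma nmul_linear_r (a : A) : linear (nmul^~ a).
Proof. by move=> c x y; rewrite nmulDl nscalerAl. Qed.

Lemma nmulBl (x y z : A) : (x - y) ** z = x ** z - y ** z.
Proof. by rewrite nmulDl -scaleN1r nscalerAl scaleN1r. Qed.

Lemma nmulBr (x y z : A) : z ** (x - y) = z ** x - z ** y.
Proof. by rewrite nmulDr -scaleN1r nscalerAr scaleN1r. Qed.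

Definition munit (i j : nat) (x : A) : minf A := mshift i j (corner x).

Lemma munitE i j x k l : munit i j x k l = if (k == i) && (l == j) then x else 0.
Proof.
rewrite /= !subn_eq0 [k == i]eqn_leq [l == j]eqn_leq.
by case: (leqP i k) => _; case: (leqP j l) => _; rewrite ?andbT ?andbF.
Qed.

Lemma munit_linear i j : linear (munit i j).
Proof.
move=> c x y; apply: minfP => k l; rewrite mentryD mentryZ !munitE.
by case: ifP => // _; rewrite scaler0 addr0.
Qed.

Lemma munitM i j k l x y :
  munit i j x ** munit k l y = if j == k then munit i l (x ** y) else 0.
Proof.
have lo a b (z : A) : (1 <= a)%N || (1 <= b)%N -> corner z a b = 0.
  by move=> ab; apply: supported_corner.
rewrite /munit; case: (ltngtP j k) => [jk|kj|->].
- by apply: (@mshiftM_lo _ _ _ _ 1); rewrite ?addn1// => a b b1; rewrite lo ?b1 ?orbT.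
- by apply: (@mshiftM_hi _ _ _ _ 1); rewrite ?addn1// => a b a1; rewrite lo ?a1.
- by rewrite mshiftM cornerM.
Qed.

Lemma munit00 x : munit 0 0 x = corner x.
Proof. exact: mshift00. Qed.

Lemma mentry_sum (I : Type) (r : seq I) (F : I -> minf A) k l :
  (\sum_(i <- r) F i) k l = \sum_(i <- r) F i k l.
Proof. by elim/big_rec2: _ => // i x y _ <-. Qed.

Lemma minf_sum_units n (X : minf A) : supported n X ->
  X = \sum_(i < n) \sum_(j < n) munit i j (X i j).
Proof.
move=> Xn; apply: minfP => k l; rewrite mentry_sum.
have [kn|nk] := ltnP k n; last first.
  rewrite Xn ?nk// big1// => i _; rewrite mentry_sum big1// => j _.
  by rewrite munitE gtn_eqF// (leq_trans _ nk).
rewrite (bigD1 (Ordinal kn))//= [X in _ + X]big1 => [|i ik]; last first.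
  rewrite mentry_sum big1// => j _; rewrite munitE; case: eqP => //= ki.
  by case/eqP: ik; apply: val_inj.
rewrite addr0 mentry_sum; have [ln|nl] := ltnP l n; last first.
  rewrite Xn ?nl ?orbT// big1// => j _.
  by rewrite munitE [l == _]gtn_eqF ?andbF// (leq_trans _ nl).
rewrite (bigD1 (Ordinal ln))//= big1 ?addr0 => [|j jl].
  by rewrite -[RHS]/(munit k l (X k l) k l) munitE !eqxx.
rewrite -[LHS]/(munit k j (X k j) k l) munitE; case: (l =P _) => [lj|].
  by case/eqP: jl; apply: val_inj.
by rewrite andbF.
Qed.

Definition mcol (i : nat) (x : A) : minf A := munit i 0 x.
Definition mrow (j : nat) (x : A) : minf A := munit 0 j x.

Lemma mcolE i x k l : mcol i x k l = if (k == i) && (l == 0%N) then x else 0.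
Proof. exact: munitE. Qed.

Lemma mcol_linear i : linear (mcol i).
Proof. exact: munit_linear. Qed.

Lemma mcol_corner i x y : mcol i x ** corner y = mcol i (x ** y).
Proof. by rewrite -munit00 munitM. Qed.

Lemma corner_mrow j x y : corner x ** mrow j y = mrow j (x ** y).
Proof. by rewrite -munit00 munitM. Qed.

End NULinear.

Section DyadicPairing.

Lemma dyadic_inj a b c d :
  (2 ^ c * a.*2.+1)%N = (2 ^ d * b.*2.+1)%N -> c = d /\ a = b.
Proof.
have lg x y : logn 2 (2 ^ x * y.*2.+1) = x.
  rewrite lognM ?expn_gt0// pfactorK// logn_coprime ?addn0//.
  by rewrite prime_coprime// dvdn2 /= odd_double.
move=> h; have cd : c = d by rewrite -[c](lg c a) h lg.
split=> //; move: h; rewrite cd => /eqP; rewrite eqn_pmul2l ?expn_gt0//.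
by rewrite eqSS => /eqP /double_inj.
Qed.

End DyadicPairing.

(** * Families of elements satisfying the relations of a finite graph *)

Section FiniteFamily.
Context (K : fieldType) (A : nuAlgType K) (V Ed : finType).
Variables (src rng : Ed -> V) (sink : pred V) (P : V -> A) (S T : Ed -> A).
Hypothesis PP : forall v w, P v ** P w = if v == w then P v else 0.
Hypothesis PS : forall e, P (src e) ** S e = S e.
Hypothesis SP : forall e, S e ** P (rng e) = S e.
Hypothesis PT : forall e, P (rng e) ** T e = T e.
Hypothesis TP : forall e, T e ** P (src e) = T e.
Hypothesis TS : forall e f, T e ** S f = if e == f then P (rng e) else 0.
Hypothesis ST : forall v, ~~ sink v -> P v = \sum_(e | src e == v) S e ** T e.
Hypothesis src_sink : forall e, ~~ sink (src e).

(* A path is a starting vertex v and the list g of its edges, last edge first. *)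
Definition path_elt (v : V) (g : seq Ed) : A := foldr (fun e x => x ** S e) (P v) g.
Definition path_end (v : V) (g : seq Ed) : V := if g is e :: _ then rng e else v.
Fixpoint is_path (v : V) (g : seq Ed) : bool :=
  if g is e :: g' then is_path v g' && (src e == path_end v g') else true.

Lemma path_elt_end v g : path_elt v g ** P (path_end v g) = path_elt v g.
Proof. by case: g => [|e g] /=; rewrite ?PP ?eqxx// -nmulA SP. Qed.

Lemma path_elt_start v g : P v ** path_elt v g = path_elt v g.
Proof. by elim: g => [|e g IH] /=; rewrite ?PP ?eqxx// nmulA IH. Qed.

(** Edges are listed last first, so [d ++ g] is the path [g] followed by [d]. *)
Lemma path_end_cat v d g : path_end v (d ++ g) = path_end (path_end v g) d.
Proof. by case: d. Qed.

Lemma is_path_cat v d g :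
  is_path v (d ++ g) = is_path v g && is_path (path_end v g) d.
Proof.
by elim: d => [|e d IH] /=; rewrite ?andbT// IH path_end_cat andbA.
Qed.

Lemma path_elt_cat v d g :
  path_elt v g ** path_elt (path_end v g) d = path_elt v (d ++ g).
Proof. by elim: d => [|e d IH] /=; rewrite ?path_elt_end// nmulA IH. Qed.

Lemma mul_path_elt v g w d : path_elt v g ** path_elt w d =
  if path_end v g == w then path_elt v (d ++ g) else 0.
Proof.
case: eqP => [<-|/eqP vw]; first exact: path_elt_cat.
by rewrite -(path_elt_end v g) -(path_elt_start w d) nmulA
  -(nmulA _ (P (path_end v g))) PP (negbTE vw)
  nmulr0 nmul0r.
Qed.

Lemma mul_path_P v g w :
  path_elt v g ** P w = if path_end v g == w then path_elt v g else 0.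
Proof. exact: (mul_path_elt v g w [::]). Qed.

Definition path_span : A -> Prop :=
  lspan (fun x => exists v g, is_path v g /\ x = path_elt v g).

Definition path_span_to (w : V) : A -> Prop := lspan (fun x =>
  exists v g, [/\ is_path v g, path_end v g = w & x = path_elt v g]).

Definition path_span_from_to (u w : V) : A -> Prop := lspan (fun x =>
  exists g, [/\ is_path u g, path_end u g = w & x = path_elt u g]).

Lemma path_spanP w x : path_span x -> path_span_to w (x ** P w).
Proof.
apply: (@lspan_map _ _ _ (nmul^~ (P w))); first exact: nmul_linear_r.
move=> _ [v [g [vg ->]]]; rewrite mul_path_P; case: eqP => [<-|_].
  by apply: lspan_gen; exists v, g.
exact: lspan0.
Qed.

Lemma path_span_from u w x : path_span_to w x -> path_span_from_to u w (P u ** x).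
Proof.
apply: (@lspan_map _ _ _ (nmul (P u))); first exact: nmul_linear_l.
move=> _ [v [g [vg gw ->]]]; rewrite -path_elt_start nmulA PP.
case: eqVneq => [uv|_]; last by rewrite nmul0r; apply: lspan0.
by rewrite -uv in vg gw *; rewrite path_elt_start; apply: lspan_gen; exists g.
Qed.

Lemma path_span_elt v g : is_path v g -> path_span (path_elt v g).
Proof. by move=> vg; apply: lspan_gen; exists v, g. Qed.

Lemma path_spanM x v g : is_path v g -> path_span x -> path_span (x ** path_elt v g).
Proof.
move=> vg; apply: (@lspan_map _ _ _ (nmul^~ (path_elt v g))).
  exact: nmul_linear_r.
move=> _ [w [d [wd ->]]]; rewrite mul_path_elt; case: eqP => [wv|_].
  by apply: path_span_elt; rewrite is_path_cat wd wv.
exact: lspan0.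
Qed.

(** * Elements that long paths carry into the path algebra *)

Definition deep (n : nat) (v : V) (g : seq Ed) : bool :=
  is_path v g && ((n <= size g)%N || sink (path_end v g)).

(* Multiplying on the right by long enough paths removes all ghost edges; paths
   ending at a sink cannot be extended, and always count as long enough. *)
Definition tame_at (n : nat) (x : A) : Prop :=
  forall v g, deep n v g -> path_span (x ** path_elt v g).

Definition tame (x : A) : Prop := exists n, tame_at n x.

Lemma tame_atW n m x : (n <= m)%N -> tame_at n x -> tame_at m x.
Proof.
move=> nm xn v g /andP[vg mg]; apply: xn; rewrite /deep vg /=.
by case/orP: mg => [/(leq_trans nm)->//|->]; rewrite orbT.
Qed.

Lemma tame0 : tame 0.
Proof. by exists 0%N => v g _; rewrite nmul0r; apply: lspan0. Qed.

Lemma tameP c x y : tame x -> tame y -> tame (c *: x + y).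
Proof.
move=> [n xn] [m ym]; exists (maxn n m) => v g vg.
rewrite nmulDl nscalerAl; apply: lspanP.
  exact: (tame_atW (leq_maxl n m) xn).
exact: (tame_atW (leq_maxr n m) ym).
Qed.

Lemma tameD x y : tame x -> tame y -> tame (x + y).
Proof. by move=> xt yt; rewrite -[x]scale1r; apply: tameP. Qed.

Lemma tameZ c x : tame x -> tame (c *: x).
Proof. by move=> xt; rewrite -[_ *: _]addr0; apply: tameP => //; apply: tame0. Qed.

Lemma tameB x y : tame x -> tame y -> tame (x - y).
Proof. by move=> xt yt; rewrite -scaleN1r addrC; apply: tameP. Qed.

Lemma tame_sum (I : Type) (r : seq I) (D : pred I) (F : I -> A) :
  (forall i, D i -> tame (F i)) -> tame (\sum_(i <- r | D i) F i).
Proof. by move=> FQ; elim/big_rec: _ => [|i x /FQ]; [exact: tame0|exact: tameD]. Qed.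

Lemma path_span_tame x : path_span x -> tame x.
Proof. by move=> xs; exists 0%N => v g /andP[vg _]; apply: path_spanM. Qed.

Lemma tame_vertex v : tame (P v).
Proof. exact/path_span_tame/(path_span_elt (v := v) (g := [::])). Qed.

Lemma tame_edge e : tame (S e).
Proof.
apply: path_span_tame; rewrite -PS.
by apply: (path_span_elt (v := src e) (g := [:: e])) => /=.
Qed.

Lemma ghost_mul_path e v g : is_path v g -> g != [::] ->
  path_span (T e ** path_elt v g).
Proof.
elim/last_ind: g => // g f _ + _; rewrite -cats1 is_path_cat.
rewrite -path_elt_cat /= => /andP[/eqP <- fg].
rewrite PS nmulA TS; case: eqP => [->|_]; last by rewrite nmul0r; apply: lspan0.
by rewrite path_elt_start; apply: path_span_elt.
Qed.

(** Depth 1 suffices: a ghost edge cancels at most the first edge of a path, and it kills sinks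
    because no edge starts there. *)
Lemma tame_ghost e : tame (T e).
Proof.
exists 1%N => v [|f g] /andP[vg]; last by move=> _; apply: ghost_mul_path.
rewrite /= => vs; rewrite -TP -nmulA PP; case: eqP => [ev|_].
  by move: vs; rewrite -ev (negbTE (src_sink e)).
by rewrite nmulr0; apply: lspan0.
Qed.

(** In a path of length at least [n + m], the initial part [drop n g] absorbs the ghosts of [y]; the
    last [n] edges [take n g] then make every resulting path long enough for [x]. For a path ending
    at a sink, the product with [y] is spanned by paths ending at the same sink, which are deep at
    every level. *)
Lemma tameM x y : tame x -> tame y -> tame (x ** y).
Proof.
move=> [n xn] [m ym]; exists (n + m)%N => v g /andP[vg /orP[nm|vs]]; last first.
  have yg : path_span (y ** path_elt v g) by apply: ym; rewrite /deep vg vs orbT.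
  rewrite -nmulA -path_elt_end (nmulA y).
  apply: (@lspan_map _ _ _ (nmul x) _ _ (nmul_linear_l x) _ _ (path_spanP _ yg)).
  by move=> _ [w [d [wd dv ->]]]; apply: xn; rewrite /deep wd dv vs orbT.
move: vg; rewrite -(cat_take_drop n g) is_path_cat => /andP[vg1 vg2].
rewrite -path_elt_cat nmulA -(nmulA x).
set d := take n g in vg2 *; set h := drop n g in vg1 vg2 *.
have yh : path_span (y ** path_elt v h).
  apply: ym; rewrite /deep vg1 size_drop leq_subRL ?nm//.
  exact: leq_trans (leq_addr _ _) nm.
rewrite -nmulA.
have lin : linear (fun z => x ** (z ** path_elt (path_end v h) d)).
  by move=> c u w; rewrite nmulDl nscalerAl nmulDr nscalerAr.
apply: (@lspan_map _ _ _ _ _ _ lin _ _ yh) => _ [w [a [wa ->]]].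
rewrite mul_path_elt; case: eqP => [wv|_]; last by rewrite nmulr0; apply: lspan0.
apply: xn; rewrite /deep is_path_cat wa wv vg2 size_cat size_take.
case: ltnP => [_|gn]; first by rewrite leq_addr.
by rewrite (leq_trans (leq_trans (leq_addr _ _) nm))// leq_addr.
Qed.

Definition family_one : A := \sum_v P v.

Lemma P_one v : P v ** family_one = P v.
Proof.
rewrite nmul_sumr (bigD1 v)//= PP eqxx big1 ?addr0// => w wv.
by rewrite PP eq_sym (negbTE wv).
Qed.

(** Each round expands the ends that are not sinks by [ST]. The factor [t] stands for the ghost of
    the path; only its tameness and its left end are remembered. *)
Lemma one_decomposition n : lspan (fun x => exists v g t,
  [/\ deep n v g, P (path_end v g) ** t = t, tame t & x = path_elt v g ** t])
  family_one.
Proof.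
elim: n => [|n IH].
  apply: lspan_sum => v _; apply: lspan_gen; exists v, [::], (P v).
  by rewrite /= PP eqxx; split=> //; apply: tame_vertex.
apply: lspanW IH => _ [v [g [t [/andP[vg ng] Pt tt ->]]]].
have [vs|vns] := boolP (sink (path_end v g)).
  by apply: lspan_gen; exists v, g, t; rewrite /deep vg vs orbT.
move: ng; rewrite (negbTE vns) orbF => ng.
rewrite -Pt (ST vns) -big_filter nmul_suml nmul_sumr big_filter; apply: lspan_sum => e /eqP ev.
apply: lspan_gen; exists v, (e :: g), (T e ** t) => /=; split.
- by rewrite /deep /= vg ev eqxx /= ltnS ng.
- by rewrite nmulA PT.
- by apply: tameM => //; apply: tame_ghost.
- by rewrite !nmulA.
Qed.

(** * Leading words of columns *)

Definition letter_code (x : (nat * V + Ed)%type) : nat := choice.pickle x.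

(* The code of a word determines it, and appending an edge is monotone in the
   code; this replaces the length-lexicographic order of Groebner theory. *)
Definition word_code (i : nat) (v : V) (g : seq Ed) : nat :=
  foldr (fun e a => 2 ^ letter_code (inr e) * a.*2.+1)%N
    (2 ^ letter_code (inl (i, v)))%N g.

Lemma word_code_gt0 i v g : (0 < word_code i v g)%N.
Proof. by case: g => [|e g] /=; rewrite ?muln_gt0 expn_gt0. Qed.

(** The row index and the starting vertex together form the first letter of a word, and each further
    edge is recovered from the dyadic pairing. *)
Lemma word_code_inj i v g j w h :
  word_code i v g = word_code j w h -> [/\ i = j, v = w & g = h].
Proof.
have start k u : word_code k u [::] =
    (2 ^ letter_code (inl (k, u)) * (0%N).*2.+1)%N by rewrite muln1.
have pinj : injective letter_code by apply: pcan_inj choice.pickleK.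
elim: g h => [|e g IH] [|f h].
- by rewrite !start => /dyadic_inj[/pinj[-> ->]].
- by rewrite start => /dyadic_inj[/pinj].
- by rewrite start => /dyadic_inj[/pinj].
- by move=> /dyadic_inj[/pinj[->] /IH[-> -> ->]].
Qed.

Lemma word_code_cat i v g j w h d : (word_code i v g < word_code j w h)%N ->
  (word_code i v (d ++ g) < word_code j w (d ++ h))%N.
Proof.
by move=> gh; elim: d => //= e d IH; rewrite ltn_pmul2l ?expn_gt0// ltnS ltn_double.
Qed.

Definition below (k : nat) (u : V) : minf A -> Prop := lspan (fun X =>
  exists i v g, [/\ is_path v g, path_end v g = u, (word_code i v g < k)%N
    & X = mcol i (path_elt v g)]).

Lemma below_col k u X : below k u X -> X ** corner (P u) = X.
Proof.
elim=> [|c _ Y [i [v [g [_ <- _ ->]]]] _ IH]; first by rewrite nmul0r.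
by rewrite nmulDl nscalerAl mcol_corner path_elt_end IH.
Qed.

Lemma belowS k u X : below k.+1 u X -> below k u X \/
  exists c i v g, [/\ c != 0, is_path v g, path_end v g = u, word_code i v g = k
    & below k u (X - c *: mcol i (path_elt v g))].
Proof.
elim=> [|c _ Y [i [v [g [vg gu gk ->]]]] _ IH]; first by left; apply: lspan0.
move: gk; rewrite ltnS leq_eqVlt => /orP[/eqP gk|gk]; last first.
  have cb (Z : minf A) : below k u Z -> below k u (c *: mcol i (path_elt v g) + Z).
    by apply: lspan_cons; exists i, v, g.
  case: IH => [/cb|[d [j [w [h [d0 wh hu hk /cb Yb]]]]]]; first by left.
  by right; exists d, j, w, h; split=> //; rewrite -addrA.
case: IH => [Yb|[d [j [w [h [d0 wh hu hk Yb]]]]]].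
  have [c0|c0] := eqVneq c 0; first by left; rewrite c0 scale0r add0r.
  by right; exists c, i, v, g; split=> //; rewrite addrAC subrr add0r.
have [? ? ?] := word_code_inj (etrans gk (esym hk)); subst j w h.
have [cd0|cd0] := eqVneq (c + d) 0.
  left; suff -> : c *: mcol i (path_elt v g) + Y = Y - d *: mcol i (path_elt v g) by [].
  by rewrite addrC -scaleNr; congr (_ + _ *: _); apply/eqP; rewrite -addr_eq0 cd0.
right; exists (c + d), i, v, g; split=> //.
suff -> : c *: mcol i (path_elt v g) + Y - (c + d) *: mcol i (path_elt v g)
   = Y - d *: mcol i (path_elt v g) by [].
by rewrite scalerDl opprD addrA (addrC (c *: _)) addrK.
Qed.

(** If [P u = 0], every column ending at [u] vanishes and a leading word would mean nothing; hence
    the first clause. *)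
Definition monic (u : V) (w : nat * V * seq Ed) (X : minf A) : Prop :=
  [/\ P u != 0, is_path w.1.2 w.2, path_end w.1.2 w.2 = u
    & below (word_code w.1.1 w.1.2 w.2) u (X - mcol w.1.1 (path_elt w.1.2 w.2))].

(** Codes of words are positive, so the value 0 places the zero column strictly below all others. *)
Definition lead_code (l : option (nat * V * seq Ed)) : nat :=
  if l is Some w then word_code w.1.1 w.1.2 w.2 else 0.

Definition has_lead (u : V) (l : option (nat * V * seq Ed)) (X : minf A) : Prop :=
  if l is Some w then monic u w X else X = 0.

(** The second bound is the one that makes reduction terminate. It fails at [k = 0], where the
    column is zero with code 0; the first bound carries the induction through that case. *)
Lemma below_normalize k u X : below k u X ->
  exists c l, [/\ c != 0, has_lead u l (c *: X) & (lead_code l < k.+1)%N /\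
    (0 < k -> lead_code l < k)%N].
Proof.
have zero (Y : minf A) n : Y = 0 -> exists c l, [/\ c != 0 :> K,
    has_lead u l (c *: Y) & (lead_code l < n.+1)%N /\ (0 < n -> lead_code l < n)%N].
  by move=> ->; exists 1, None; rewrite oner_neq0 /= scaler0.
have [Pu|Pu] := eqVneq (P u) 0.
  by move=> /below_col; rewrite Pu linear0 nmulr0 => /esym/zero.
elim: k => [|k IH]; first by case=> [|c _ Y [i [v [g []]]] //]; apply: zero.
case/belowS=> [/IH[c [l [c0 cl [lk _]]]]|].
  by exists c, l; split=> //; rewrite ltnW.
move=> [c [i [v [g [c0 vg gu gk Xb]]]]].
exists c^-1, (Some (i, v, g)); rewrite invr_eq0; split=> //=.
  split=> //=; rewrite gk.
  have -> : c^-1 *: X - mcol i (path_elt v g) =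
      c^-1 *: (X - c *: mcol i (path_elt v g)).
    by rewrite scalerBr scalerA mulVf// scale1r.
  exact: lspanZ.
by rewrite gk ltnS leqnSn ltnSn.
Qed.

Lemma below_cat i v g d X : is_path v (d ++ g) ->
  below (word_code i v g) (path_end v g) X ->
  below (word_code i v (d ++ g)) (path_end v (d ++ g))
    (X ** corner (path_elt (path_end v g) d)).
Proof.
rewrite is_path_cat => /andP[vg gd].
apply: (@lspan_map _ _ _ (nmul^~ _)); first exact: nmul_linear_r.
move=> _ [j [w [h [wh hg hk ->]]]]; rewrite mcol_corner -{1}hg path_elt_cat.
apply: lspan_gen; exists j, w, (d ++ h); split=> //.
- by rewrite is_path_cat wh hg.
- by rewrite !path_end_cat hg.
- exact: word_code_cat.
Qed.

Lemma path_span_to_below u i x : path_span_to u x ->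
  exists k, below k u (mcol i x).
Proof.
elim=> [|c _ y [v [g [vg gu ->]]] _ [k kb]].
  exists 0%N; suff -> : mcol i 0 = 0 :> minf A by apply: lspan0.
  by apply: minfP => a b; rewrite mcolE if_same.
exists (maxn (word_code i v g).+1 k); rewrite mcol_linear; apply: lspan_cons.
  by exists i, v, g; rewrite leq_maxl.
apply: lspanW kb => _ [j [w [h [wh hu hk ->]]]]; apply: lspan_gen.
by exists j, w, h; rewrite (leq_trans hk) ?leq_maxr.
Qed.

Lemma belowW k l u X : (k <= l)%N -> below k u X -> below l u X.
Proof.
move=> kl; apply: lspanW => _ [j [w [h [wh hu hk ->]]]]; apply: lspan_gen.
by exists j, w, h; rewrite (leq_trans hk).
Qed.

(** * Factorizations of an idempotent matrix and their reduction *)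

Definition mtame (X : minf A) : Prop := forall i j, tame (X i j).

Lemma mtameP c X Y : mtame X -> mtame Y -> mtame (c *: X + Y).
Proof. by move=> Xt Yt i j; apply: tameP. Qed.

Lemma mtameM X Y : mtame X -> mtame Y -> mtame (X ** Y).
Proof.
move=> Xt Yt i j; rewrite (minfME (n := msize X)) => [|k Xk].
  by apply: tame_sum => k _; apply: tameM.
by rewrite msizeP ?Xk ?orbT// nmul0r.
Qed.

Lemma mtame_munit i j x : tame x -> mtame (munit i j x).
Proof. by move=> xt k l; rewrite munitE; case: ifP => // _; apply: tame0. Qed.

Lemma mtame_corner x : tame x -> mtame (corner x).
Proof. by rewrite -munit00; apply: mtame_munit. Qed.

(** The [b i] are columns and the [c i] rows: [p] factors through the vertices [u i], and the [b i]
    generate the image of [p] as a right module. *)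
Record presentation (I : finType) (p : minf A) (u : I -> V)
    (b c : I -> minf A) (l : I -> option (nat * V * seq Ed)) : Prop := {
  pres_lead : forall i, has_lead (u i) (l i) (b i);
  pres_fix : forall i, p ** b i = b i;
  pres_end : forall i, b i ** corner (P (u i)) = b i;
  pres_start : forall i, corner (P (u i)) ** c i = c i;
  pres_tame : forall i, mtame (b i) /\ mtame (c i);
  pres_sum : \sum_i b i ** c i = p
}.

(** Since [d] may be empty, this also makes the leading words distinct. *)
Definition reduced (I : finType) (l : I -> option (nat * V * seq Ed)) : Prop :=
  forall i j r v g d, i != j -> l i = Some (r, v, g) -> l j = Some (r, v, d ++ g) ->
  False.

(** One division step: [b i] times the path [d] cancels the leading word of [b j], and [c i] absorbs
    the corresponding multiple of [c j], so that the sum stays equal to [p]. Rescaling [b j] by [a]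
    is undone in [c j]. *)
Lemma reduction_step (I : finType) p u b c l (i j : I) r v g d :
  presentation p u b c l -> i != j -> l i = Some (r, v, g) ->
  l j = Some (r, v, d ++ g) ->
  exists b' c' l', presentation p u b' c' l' /\
    (\sum_k lead_code (l' k) < \sum_k lead_code (l k))%N.
Proof.
move=> [lead fx ed st tm sm] ij li lj.
have := lead i; have := lead j; rewrite li lj /=.
move=> [/= Pj vdg uj bj] [/= Pi vg ui bi].
have vd : is_path (u i) d by move: vdg; rewrite is_path_cat ui => /andP[].
pose m := path_elt (u i) d.
have mE : P (u i) ** m = m by apply: path_elt_start.
have Em : m ** P (u j) = m.
  by rewrite -uj path_end_cat ui path_elt_end.
have tm' : mtame (corner m).
  exact/mtame_corner/path_span_tame/path_span_elt.
pose X := b j - b i ** corner m.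
have Xb : below (word_code r v (d ++ g)) (u j) X.
  have -> : X = (b j - mcol r (path_elt v (d ++ g)))
      - (b i - mcol r (path_elt v g)) ** corner m.
    by rewrite /X /m -ui nmulBl mcol_corner path_elt_cat opprB addrA subrK.
  apply: lspanB => //.
  by rewrite -{1}uj -ui in bi *; rewrite /m -ui; apply: below_cat.
have [a [l' [a0 Xl [_ lk]]]] := below_normalize Xb.
pose b' k := if k == j then a *: X else b k.
pose c' k := if k == j then a^-1 *: c j
  else if k == i then c i + corner m ** c j else c k.
pose l'' k := if k == j then l' else l k.
exists b', c', l''; split; last first.
  rewrite (bigD1 j)//= [X in (_ < X)%N](bigD1 j)//=.
  rewrite /l'' eqxx lj [X in (X + _)%N]/=.
  rewrite (eq_bigr (fun k => lead_code (l k))) => [|k /negbTE->//].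
  by rewrite ltn_add2r; apply: lk; apply: word_code_gt0.
have Xe : X ** corner (P (u j)) = X.
  by rewrite nmulBl ed -nmulA -cornerM Em.
split.
- by move=> k; rewrite /b' /l''; case: eqP => [->|_].
- move=> k; rewrite /b'; case: eqP => [_|_]; last exact: fx.
  by rewrite nscalerAr nmulBr nmulA !fx.
- move=> k; rewrite /b'; case: eqP => [->|_]; last exact: ed.
  by rewrite nscalerAl Xe.
- move=> k; rewrite /c'; case: eqP => [->|_]; first by rewrite nscalerAr st.
  case: eqP => [->|_]; last exact: st.
  by rewrite nmulDr st nmulA -cornerM mE.
- move=> k; split; rewrite /b' /c'.
    case: eqP => [_|_]; last exact: (tm k).1.
    rewrite -[a *: X]addr0; apply: mtameP; last by move=> *; apply: tame0.
    rewrite /X -scaleN1r addrC; apply: mtameP; last exact: (tm j).1.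
    by apply: mtameM => //; apply: (tm i).1.
  case: eqP => [_|_].
    rewrite -[_ *: c j]addr0; apply: mtameP; last by move=> *; apply: tame0.
    exact: (tm j).2.
  case: eqP => [_|_]; last exact: (tm k).2.
  rewrite -[c i]scale1r; apply: mtameP; first exact: (tm i).2.
  by apply: mtameM => //; apply: (tm j).2.
- rewrite -sm (bigD1 j)//= [RHS](bigD1 j)//= (bigD1 i)//= [in RHS](bigD1 i)//=.
  rewrite /b' /c' eqxx (negbTE ij) eqxx.
  rewrite (eq_bigr (fun k => b k ** c k)) => [|k /andP[/negbTE-> /negbTE->]//].
  rewrite !addrA; congr (_ + _).
  rewrite nscalerAl nscalerAr scalerA mulfV// scale1r nmulDr nmulBl nmulA.
  by rewrite [_ + b i ** corner m ** c j]addrC addrA subrK.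
Qed.

Lemma reduced_presentation (I : finType) p u (b c : I -> minf A) l :
  presentation p u b c l ->
  exists b' c' l', presentation p u b' c' l' /\ reduced l'.
Proof.
have [n] := ubnP (\sum_k lead_code (l k)); elim: n b c l => // n IH b c l.
rewrite ltnS => ln pr.
have [red|/existsNP[i /existsNP[j /existsNP[r /existsNP[v /existsNP[g /existsNP[d]]]]]]] :=
  pselect (reduced l); first by exists b, c, l.
move=> /not_implyP[ij /not_implyP[li /not_implyP[lj _]]].
have [b' [c' [l' [pr' ll]]]] := reduction_step pr ij li lj.
exact: (IH b' c' l' (leq_trans ll ln) pr').
Qed.

Lemma below_sum u (I : finType) (F : I -> minf A) :
  (forall i, exists k, below k u (F i)) -> exists k, below k u (\sum_i F i).
Proof.
move=> Fk; elim/big_ind: _ => [|X Y [k Xk] [l Yl]|i _]; last exact: Fk.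
  by exists 0%N; apply: lspan0.
exists (maxn k l); apply: lspanD.
  exact: belowW (leq_maxl _ _) Xk.
exact: belowW (leq_maxr _ _) Yl.
Qed.

Lemma initial_presentation (p : minf A) : p ** p = p ->
  (forall i j, tame (p i j)) -> (forall i j, p i j ** family_one = p i j) ->
  exists (I : finType) u (b c : I -> minf A) l, presentation p u b c l.
Proof.
move=> ip pt p1; set n := msize p.
have pE := minf_sum_units (@msizeP _ p).
have pM (k : 'I_n) m x : p ** munit k m x = \sum_(i < n) munit i m (p i k ** x).
  rewrite {1}pE nmul_suml; apply: eq_bigr => i _.
  rewrite nmul_suml (bigD1 k)//= munitM eqxx big1 ?addr0// => j jk.
  by rewrite munitM (negbTE (jk : (j : nat) != k)).
pose item (X : minf A) := exists u b c, [/\ exists k, below k u b,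
  p ** b = b, corner (P u) ** c = c, mtame b /\ mtame c & X = b ** c].
have itemZ k X : item X -> item (k *: X).
  move=> [u [b [c [bk pb uc [bt ct] ->]]]]; exists u, b, (k *: c).
  split=> //; first by rewrite nscalerAr uc.
    split=> //; rewrite -[k *: c]addr0; apply: mtameP => //.
    by move=> *; apply: tame0.
  by rewrite nscalerAr.
have [N Nt] : exists N, forall i j : 'I_n, tame_at N (p i j).
  have [N NP] := choice (fun ij : 'I_n * 'I_n => pt ij.1 ij.2).
  exists (\max_ij N ij)%N => i j.
  by apply: (tame_atW _ (NP (i, j))); apply: leq_bigmax.
have pitem : lspan item p.
  (* Each diagonal unit is split into a column and a row: of a term of [one_decomposition], the path
     goes into the column, where [p] loses its ghosts, and [t] goes into the row. *)
  have -> : p = \sum_(k < n) p ** (mcol k family_one ** mrow k family_one).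
    rewrite {1}pE exchange_big; apply: eq_bigr => k _.
    rewrite munitM eqxx pM; apply: eq_bigr => i _; congr munit.
    by rewrite nmulA !p1.
  apply: lspan_sum => k _; rewrite nmulA.
  have lin : linear (fun x => p ** mcol k x ** mrow k family_one).
    by move=> a x y; rewrite mcol_linear nmulDr nmulDl nscalerAr nscalerAl.
  apply: (@lspan_map _ _ _ _ _ _ lin _ _ (one_decomposition N)).
  move=> _ [v [g [t [vg Pt tt ->]]]]; apply: lspan_gen.
  exists (path_end v g), (p ** mcol k (path_elt v g)), (mrow k (t ** family_one)).
  split.
  - rewrite pM; apply: below_sum => i; apply: path_span_to_below.
    by rewrite -path_elt_end nmulA; apply/path_spanP/Nt.
  - by rewrite nmulA ip.
  - by rewrite corner_mrow nmulA Pt.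
  - split; first apply: mtameM => //.
      apply/mtame_munit/path_span_tame/path_span_elt.
      by case/andP: vg.
    apply/mtame_munit/tameM => //; apply: tame_sum => w _; exact: tame_vertex.
  - by rewrite -corner_mrow -mcol_corner !nmulA.
have [r rI rE] := lspan_seq itemZ pitem.
have exi (i : 'I_(size r)) : exists x : V * minf A * minf A *
    option (nat * V * seq Ed), [/\ has_lead x.1.1.1 x.2 x.1.1.2,
     p ** x.1.1.2 = x.1.1.2, x.1.1.2 ** corner (P x.1.1.1) = x.1.1.2,
     corner (P x.1.1.1) ** x.1.2 = x.1.2 &
     (mtame x.1.1.2 /\ mtame x.1.2) /\ r`_i = x.1.1.2 ** x.1.2].
  have [u [b [c [[k bk] pb uc [bt ct] ->]]]] := rI _ (mem_nth 0 (ltn_ord i)).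
  have [a [l [a0 bl _]]] := below_normalize bk.
  exists (u, a *: b, a^-1 *: c, l); split=> //=.
  - by rewrite nscalerAr pb.
  - by rewrite nscalerAl (below_col bk).
  - by rewrite nscalerAr uc.
  - rewrite nscalerAl nscalerAr scalerA mulfV// scale1r; do 2?split=> //.
      rewrite -[a *: b]addr0; apply: mtameP => //.
      by move=> *; apply: tame0.
    rewrite -[_ *: c]addr0; apply: mtameP => //.
    by move=> *; apply: tame0.
have [x xP] := choice exi.
exists 'I_(size r), (fun i => (x i).1.1.1), (fun i => (x i).1.1.2),
  (fun i => (x i).1.2), (fun i => (x i).2).
split=> [i|i|i|i|i|]; try by case: (xP i) => // ? ? ? ? [].
rewrite rE (big_nth 0) big_mkord; apply: eq_bigr => i _.
by case: (xP i) => ? ? ? ? [_ ->].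
Qed.

(** * Linear independence of reduced columns *)

Variable coef : V -> seq Ed -> A -> K.
Hypothesis coef_linear : forall v g c x y,
  coef v g (c *: x + y) = c * coef v g x + coef v g y.
(** Only paths with a common nonzero end need to be separated; other ends are separated by the
    vertex projections. The functionals are defined on all of [A], ghosts included. *)
Hypothesis coef_path : forall v g w h, is_path v g -> is_path w h ->
  path_end v g = path_end w h -> P (path_end v g) != 0 ->
  coef v g (path_elt w h) = ((v, g) == (w, h))%:R.

Lemma coef0 v g : coef v g 0 = 0.
Proof. by apply: (addrI (coef v g 0)); rewrite -{1}[coef v g 0]mul1r -coef_linear scaler0 !addr0. Qed.

Definition word_coef (w : nat * V * seq Ed) (X : minf A) : K :=
  coef w.1.2 w.2 (X w.1.1 0).

Lemma word_coefP w c X Y : word_coef w (c *: X + Y) = c * word_coef w X + word_coef w Y.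
Proof. by rewrite /word_coef mentryD mentryZ coef_linear. Qed.

Lemma word_coefD w X Y : word_coef w (X + Y) = word_coef w X + word_coef w Y.
Proof. by rewrite -{1}[X]scale1r word_coefP mul1r. Qed.

Lemma word_coef0 w : word_coef w 0 = 0.
Proof. exact: coef0. Qed.

Lemma word_coefZ w c X : word_coef w (c *: X) = c * word_coef w X.
Proof. by rewrite -[_ *: _]addr0 word_coefP word_coef0 addr0. Qed.

Lemma word_coef_sum w (I : Type) (r : seq I) (F : I -> minf A) :
  word_coef w (\sum_(i <- r) F i) = \sum_(i <- r) word_coef w (F i).
Proof.
by elim/big_rec2: _ => [|i x y _ <-]; rewrite ?word_coef0 ?word_coefD.
Qed.

Lemma word_coef_mcol i v g j w h : is_path v g -> is_path w h ->
  path_end v g = path_end w h -> P (path_end v g) != 0 ->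
  word_coef (i, v, g) (mcol j (path_elt w h)) = ((i, v, g) == (j, w, h))%:R.
Proof.
move=> vg wh gh Pg; rewrite /word_coef mcolE /= andbT !xpair_eqE.
case: eqVneq => [_|_]; last by rewrite coef0.
by rewrite coef_path// xpair_eqE.
Qed.

Lemma word_coef_below k i v g X : is_path v g -> P (path_end v g) != 0 ->
  (k <= word_code i v g)%N -> below k (path_end v g) X ->
  word_coef (i, v, g) X = 0.
Proof.
move=> vg Pg kg; elim=> [|c _ Y [j [w [h [wh hg hk ->]]]] _ IH].
  exact: word_coef0.
rewrite word_coefP IH addr0 word_coef_mcol//.
case: eqP => [[ij vw gh]|_]; last by rewrite mulr0.
by move: (leq_trans hk kg); rewrite ij vw gh ltnn.
Qed.

Lemma word_coef_monic u w X : monic u w X -> word_coef w X = 1.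
Proof.
case: w => -[i v] g [/= Pu vg gu Xb]; rewrite -gu in Pu Xb.
rewrite -[X](subrK (mcol i (path_elt v g))) word_coefD (word_coef_below _ _ _ Xb)//.
by rewrite add0r word_coef_mcol// eqxx.
Qed.

Lemma word_coef_monic_lt u w i v g X : monic u w X -> is_path v g ->
  path_end v g = u -> (lead_code (Some w) < word_code i v g)%N ->
  word_coef (i, v, g) X = 0.
Proof.
case: w => -[j t] h [/= Pu th hu Xb] vg gu lt.
rewrite -[X](subrK (mcol j (path_elt t h))) word_coefD.
rewrite -gu in Pu Xb hu; rewrite (word_coef_below _ _ (ltnW lt) Xb)// add0r.
rewrite word_coef_mcol//; case: eqP => [[ij vt gh]|//].
by move: lt; rewrite ij vt gh ltnn.
Qed.

Lemma monic_cat u w r v g d X : monic u (r, v, g) X -> is_path u d ->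
  path_end u d = w -> P w != 0 ->
  monic w (r, v, d ++ g) (X ** corner (path_elt u d)).
Proof.
move=> [/= Pu vg gu Xb] ud dw Pw.
have vdg : is_path v (d ++ g) by rewrite is_path_cat vg gu.
have endE : path_end v (d ++ g) = w by rewrite path_end_cat gu.
split=> //=; rewrite -endE -path_elt_cat -mcol_corner gu -nmulBl -gu.
by apply: below_cat => //; rewrite gu.
Qed.

Lemma path_expansion u w y : P w != 0 -> path_span_from_to u w y ->
  exists D : seq (seq Ed), [/\ uniq D,
    forall d, d \in D -> is_path u d /\ path_end u d = w
    & y = \sum_(d <- D) coef u d y *: path_elt u d].
Proof.
move=> Pw; elim=> [|c _ z [g [ug gw ->]] _ [D [uD DP zE]]].
  by exists [::]; rewrite big_nil.
have coefg d : is_path u d -> path_end u d = w ->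
    coef u d (path_elt u g) = (d == g)%:R.
  move=> ud dw; rewrite coef_path// ?dw ?gw//.
  by rewrite xpair_eqE eqxx.
have sumg D' : uniq D' -> (forall d, d \in D' -> is_path u d /\ path_end u d = w) ->
    g \in D' -> \sum_(d <- D') coef u d (c *: path_elt u g + z) *: path_elt u d =
    c *: path_elt u g + \sum_(d <- D') coef u d z *: path_elt u d.
  move=> uD' D'P gD'; transitivity (\sum_(d <- D')
    (((d == g)%:R * c) *: path_elt u d + coef u d z *: path_elt u d)).
    rewrite big_seq [RHS]big_seq; apply: eq_bigr => d /D'P[ud dw].
    by rewrite coef_linear coefg// scalerDl mulrC.
  rewrite big_split (bigD1_seq g)//= eqxx mul1r big1 ?addr0// => d dg.
  by rewrite (negbTE dg) mul0r scale0r.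
have [gD|gD] := boolP (g \in D).
  by exists D; split=> //; rewrite sumg// -zE.
have cg : coef u g z = 0.
  rewrite zE; elim: (D) gD DP => [|d D' IH]; first by rewrite big_nil coef0.
  rewrite inE negb_or => /andP[gd gD'] D'P; rewrite big_cons coef_linear IH//.
    have [ud dw] := D'P d (mem_head _ _).
    rewrite coef_path ?gw ?dw//.
    by rewrite xpair_eqE eqxx (negbTE gd) mulr0 addr0.
  by move=> e eD'; apply: D'P; rewrite inE eD' orbT.
exists (g :: D); have gDP d : d \in g :: D -> is_path u d /\ path_end u d = w.
  by rewrite inE => /orP[/eqP->|/DP].
split=> //=; first by rewrite gD.
by rewrite sumg ?mem_head//= ?gD// big_cons cg scale0r add0r -zE.
Qed.

(** In the reversed listing, suffixes are initial segments of paths: two initial segments of one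
    path are comparable. *)
Lemma cat_suffix (d g d' g' : seq Ed) : d ++ g = d' ++ g' ->
  (exists e, g' = e ++ g) \/ (exists e, g = e ++ g').
Proof.
elim: d d' => [|x d IH] [|x' d'] /=.
- by move=> ->; left; exists [::].
- by move=> ->; right; exists (x' :: d').
- by move=> <-; left; exists (x :: d).
- by move=> [_ /IH].
Qed.

(* The products of the b_i by distinct paths have distinct leading words. *)
Lemma reduced_independent (I : finType) p u (b c : I -> minf A) l w (y : I -> A) :
  presentation p u b c l -> reduced l -> P w != 0 ->
  (forall i, path_span_from_to (u i) w (y i)) ->
  \sum_i b i ** corner (y i) = 0 -> forall i, l i != None -> y i = 0.
Proof.
move=> pr red Pw yP by0.
have [D DP] := choice (fun i => path_expansion Pw (yP i)).
pose code (i : I) (d : seq Ed) := if l i is Some x then word_code x.1.1 x.1.2 (d ++ x.2) else 0%N.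
pose hit m := `[< exists i d, [/\ l i != None, d \in D i, coef (u i) d (y i) != 0
  & code i d = m] >].
have [hex|nhit] := pselect (exists m, hit m); last first.
  move=> i li; have [uD Dpath ->] := DP i; rewrite big_seq big1// => d dD.
  have [->|c0] := eqVneq (coef (u i) d (y i)) 0; first by rewrite scale0r.
  by case: nhit; exists (code i d); apply/asboolP; exists i, d.
have hbound m : hit m -> (m <= \max_i \max_(d <- D i) code i d)%N.
  move=> /asboolP[i [d [_ dD _ <-]]].
  apply: leq_trans (leq_bigmax i).
  exact: (@leq_bigmax_seq _ (D i) xpredT (code i) d dD isT).
(* The largest leading word occurring with nonzero coefficient: reading off its coefficient in the
   vanishing sum will leave only the pair [(i, d)]. *)
have [m /asboolP[i [d [li dD cd dm]]] mmax] := ex_maxnP hex hbound.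
case lE : (l i) li dm => [[[r v] g]|]//= _; rewrite /code lE /= => dm.
have [ud dw] : is_path (u i) d /\ path_end (u i) d = w.
  by have [_ + _] := DP i; apply.
have := pres_lead pr i; rewrite lE /= => bi; have [/= _ vg gu _] := bi.
have vdg : is_path v (d ++ g) by rewrite is_path_cat vg gu.
have endE : path_end v (d ++ g) = w by rewrite path_end_cat gu.
have := congr1 (word_coef (r, v, d ++ g)) by0; rewrite word_coef0 word_coef_sum.
have term j : word_coef (r, v, d ++ g) (b j ** corner (y j)) =
    \sum_(h <- D j) coef (u j) h (y j) *
      word_coef (r, v, d ++ g) (b j ** corner (path_elt (u j) h)).
  have [_ _ {1}->] := DP j; rewrite linear_sum nmul_sumr word_coef_sum.
  by apply: eq_bigr => h _; rewrite linearZ nscalerAr word_coefZ.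
(* By maximality the leading word of any other contributing pair is either smaller, and contributes
   nothing, or equal; equality forces one of the two leading words [l i], [l j] to extend the other,
   against [red], or [h = d] when [i = j]. *)
have tzero j h : h \in D j -> (j, h) != (i, d) ->
    coef (u j) h (y j) * word_coef (r, v, d ++ g) (b j ** corner (path_elt (u j) h)) = 0.
  move=> hD jhid; have [->|c0] := eqVneq (coef (u j) h (y j)) 0; first by rewrite mul0r.
  have [uh hw] : is_path (u j) h /\ path_end (u j) h = w.
    by have [_ + _] := DP j; apply.
  have := pres_lead pr j; case lj : (l j) => [[[r' v'] g']|] /=; last first.
    by move=> ->; rewrite nmul0r word_coef0 mulr0.
  move=> bj; have bjh := monic_cat bj uh hw Pw.
  have := mmax (code j h); rewrite /code lj /= leq_eqVlt => /(_ _)/orP[].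
  - by apply/asboolP; exists j, h; rewrite lj /code lj.
  - rewrite -dm => /eqP /word_code_inj[rr vv /esym gg]; case/eqP: jhid.
    subst r' v'; have [ij|ij] := eqVneq i j.
      move: lj gg; rewrite -ij lE => -[<-].
      move=> gg; have dh : size d = size h.
        by apply: (@addIn (size g)); rewrite -!size_cat gg.
      by move/eqP: gg; rewrite eqseq_cat// => /andP[/eqP-> _].
    have [[e ge]|[e ge]] := cat_suffix gg.
      by exfalso; apply: (red i j r v g e) => //; rewrite lj ge.
    by exfalso; apply: (red j i r v g' e) => //; rewrite 1?eq_sym// lE ge.
  - by rewrite -dm => lt; rewrite (word_coef_monic_lt bjh)// mulr0.
rewrite (bigD1 i)//= [X in _ + X]big1 => [|j ji]; last first.
  rewrite term big_seq big1// => h hD; apply: tzero => //.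
  by rewrite xpair_eqE (negbTE ji).
have [uD _ _] := DP i.
rewrite addr0 term (bigD1_seq d)//= [X in _ + X]big_seq_cond big1 => [|h]; last first.
  move=> /andP[hD hd]; apply: tzero => //.
  by rewrite xpair_eqE (negbTE hd) andbF.
rewrite addr0 (word_coef_monic (monic_cat bi ud dw Pw)) mulr1 => c0.
by rewrite c0 eqxx in cd.
Qed.
(** As [p] fixes [b j], the differences [x k] between [c k ** b j] and the expected values satisfy a
    relation among the [b k]. They may contain ghosts, so independence is applied after multiplying
    by each deep path, and [one_decomposition] recovers [x i = 0]. *)
Lemma reduced_biorthogonal (I : finType) p u (b c : I -> minf A) l :
  presentation p u b c l -> reduced l ->
  forall i j, l i != None -> c i ** b j = if i == j then corner (P (u i)) else 0.
Proof.
move=> pr red i j li; have [_ fx ed st tm sm] := pr.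
pose z k := (c k ** b j) 0%N 0%N; pose d k := if k == j then P (u k) else 0.
have zE k : c k ** b j = corner (z k).
  by apply: (corner_sandwich (p := P (u k)) (q := P (u j)));
    rewrite ?nmulA ?st// -nmulA ed.
pose x k := z k - d k.
suff xi0 : x i = 0.
  by rewrite zE; move/eqP: xi0; rewrite subr_eq0 => /eqP ->; rewrite /d; case: eqP;
    rewrite ?linear0.
have sumx : \sum_k b k ** corner (x k) = 0.
  under eq_bigr do rewrite linearB /= nmulBr -zE nmulA.
  rewrite sumrB -nmul_suml sm fx (bigD1 j)//= /d eqxx ed big1 ?addr0 ?subrr// => k kj.
  by rewrite (negbTE kj) linear0 nmulr0.
have Px k : P (u k) ** x k = x k.
  rewrite nmulBr; congr (_ - _); last first.
    by rewrite /d; case: ifP => _; rewrite ?nmulr0 ?PP ?eqxx.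
  by apply: (@corner_inj K A); rewrite cornerM -zE nmulA st.
have xPj k : x k ** P (u j) = x k.
  rewrite nmulBl; congr (_ - _); last first.
    by rewrite /d; case: eqP => [->|_]; rewrite ?nmul0r ?PP ?eqxx.
  by apply: (@corner_inj K A); rewrite cornerM -zE -nmulA ed.
have xt k : tame (x k).
  apply: tameB; first exact: (mtameM (tm k).2 (tm j).1).
  by rewrite /d; case: eqP => _; [exact: tame_vertex|exact: tame0].
have [N NP] := choice xt.
have xpath v g : deep (\max_k N k) v g -> x i ** path_elt v g = 0.
  move=> vg; pose w := path_end v g.
  have [Pw|Pw] := eqVneq (P w) 0.
    by rewrite -path_elt_end -/w Pw !nmulr0.
  apply: (reduced_independent pr red (w := w) (y := fun k => x k ** path_elt v g)) li => //.
    move=> k; rewrite -Px -nmulA; apply: path_span_from.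
    rewrite -path_elt_end nmulA; apply: path_spanP.
    by apply: (tame_atW _ (NP k)) vg; apply: leq_bigmax.
  under eq_bigr do rewrite cornerM nmulA.
  by rewrite -nmul_suml sumx nmul0r.
rewrite -xPj -(P_one (u j)) nmulA xPj.
elim: (one_decomposition (\max_k N k)) => [|a _ y [v [g [t [vg _ _ ->]]]] _ IH].
  exact: nmulr0.
by rewrite nmulDr nscalerAr nmulA xpath// nmul0r scaler0 add0r.
Qed.

(** By biorthogonality the [b i ** c i] are orthogonal idempotents, and swapping the factors turns
    each into the vertex [P (u i)]. Indices with lead [None] have [b i = 0]. *)
Lemma finite_family_class (p : minf A) : p ** p = p ->
  (forall i j, tame (p i j)) -> (forall i j, p i j ** family_one = p i j) ->
  exists s : seq V, kc p = \sum_(v <- s) kc (corner (P v)).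
Proof.
move=> ip pt p1; have [I [u [b0 [c0 [l0 pr0]]]]] := initial_presentation ip pt p1.
have [b [c [l [pr red]]]] := reduced_presentation pr0.
have bio := reduced_biorthogonal pr red.
have [lead fx ed st tm sm] := pr.
exists [seq u i | i <- [seq i <- index_enum I | l i != None]].
have -> : p = \sum_(i <- [seq i <- index_enum I | l i != None]) b i ** c i.
  rewrite -[LHS]sm big_filter [RHS]big_mkcond; apply: eq_bigr => i _.
  by have := lead i; case: (l i) => //= ->; rewrite nmul0r.
rewrite kc_sum ?filter_uniq ?index_enum_uniq// => [|i j].
  rewrite big_map big_seq [RHS]big_seq; apply: eq_bigr => i.
  rewrite mem_filter => /andP[li _]; have cb := bio i i li; rewrite eqxx in cb.
  by rewrite kc_swap ?cb// ?st// -nmulA cb ed.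
rewrite !mem_filter => /andP[li _] /andP[lj _].
rewrite nmulA -(nmulA (b i)) bio//; case: eqP => [<-|_].
  by rewrite ed.
by rewrite nmulr0 nmul0r.
Qed.

End FiniteFamily.

(** * A representation of L(E) separating paths *)

Section BranchingSystem.
Context (E : graph).
Hypothesis countableE : countable [set: edge E].

Definition regular (v : vertex E) : Prop := emitted v !=set0 /\ finite_set (emitted v).

(** At a regular vertex, division with remainder by the number of edges splits N exactly, as the
    relation there demands; elsewhere disjointness is enough, and a pairing function provides it. *)
Lemma branching_function : exists phi : edge E -> nat -> nat,
  (forall e f m n, gsource e = gsource f -> phi e m = phi f n -> e = f /\ m = n) /\
  (forall v n, regular v -> exists e m, gsource e = v /\ phi e m = n).
Proof.
have [code code_inj] : exists code : edge E -> nat, injective code.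
  case/countable_injP: countableE => f fi; exists f => x y.
  by apply: fi; rewrite in_setT.
pose em v : seq (edge E) := fset_set (emitted v).
have mem_em v e : regular v -> (e \in em v) = (gsource e == v).
  by move=> [_ vf]; rewrite in_fset_set.
exists (fun e m => if pselect (regular (gsource e))
  then (m * size (em (gsource e)) + index e (em (gsource e)))%N
  else choice.pickle (code e, m)); split=> [e f m n|v n reg].
  move=> ef; rewrite -ef; case: pselect => reg.
    have ie : (index e (em (gsource e)) < size (em (gsource e)))%N.
      by rewrite index_mem mem_em.
    have jf : (index f (em (gsource e)) < size (em (gsource e)))%N.
      by rewrite index_mem mem_em// ef.
    have s0 := leq_ltn_trans (leq0n _) ie.
    move=> h; have := congr1 (fun k => k %/ size (em (gsource e)))%N h.
    rewrite /= !divnMDl// !divn_small// !addn0 => mn; split=> //.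
    move: h; rewrite mn => /addnI h.
    rewrite -[e](nth_index e (s := em (gsource e))) ?mem_em// h nth_index//.
    by rewrite mem_em// ef.
  by move/(pcan_inj choice.pickleK) => [/code_inj].
have [[e0 e0v] _] := reg; set s := size (em v).
have s0 : (0 < s)%N by rewrite -has_predT; apply/hasP; exists e0; rewrite ?mem_em//; apply/eqP.
have lt : (n %% s < s)%N by rewrite ltn_mod.
exists (nth e0 (em v) (n %% s)%N), (n %/ s)%N.
have ev : gsource (nth e0 (em v) (n %% s)) = v.
  by apply/eqP; rewrite -mem_em// mem_nth.
split=> //; rewrite ev; case: pselect => //= _.
by rewrite index_uniq ?fset_uniq// -divn_eq.
Qed.

End BranchingSystem.

(* L(E) acts on functions on E^0 x N x Z: each edge e embeds {r(e)} x N x Z into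
   {s(e)} x N x Z along phi, and the Z-coordinate counts edges, so that paths of
   different lengths act independently. *)
Section BranchingRepresentation.
Context (K : fieldType) (E : graph) (phi : edge E -> nat -> nat).
Hypothesis phi_inj : forall e f m n,
  gsource e = gsource f -> phi e m = phi f n -> e = f /\ m = n.
Hypothesis phi_surj : forall v n,
  regular v -> exists e m, gsource e = v /\ phi e m = n.

Definition branch_point : Type := (vertex E * nat * int)%type.
HB.instance Definition _ := Choice.on branch_point.

(** The partial inverse of all the [phi e] with source [u]; the value [None] can occur only at
    vertices that are not regular. *)
Definition branch (u : vertex E) (n : nat) : option (edge E * nat) :=
  if pselect (exists em, gsource em.1 = u /\ phi em.1 em.2 = n) is left h
  then Some (projT1 (cid h)) else None.

Lemma branch_phi e m : branch (gsource e) (phi e m) = Some (e, m).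
Proof.
rewrite /branch; case: pselect => [h|[]]; last by exists (e, m).
case: cid => -[f n] /= [fe fn]; congr Some.
by have [-> ->] := phi_inj fe fn.
Qed.

Lemma branchP u n e m : branch u n = Some (e, m) -> gsource e = u /\ phi e m = n.
Proof. by rewrite /branch; case: pselect => // h; case: cid => -[f i] /= fiP [<- <-]. Qed.

Lemma branch_regular u n : regular u -> branch u n <> None.
Proof.
move=> /(phi_surj n)[e [m [eu en]]]; rewrite /branch; case: pselect => // -[].
by exists (e, m).
Qed.

(** All functions are allowed, not only those of finite support, so edges and ghost edges act by
    substitution along [phi] and its partial inverse. *)
Definition gen_act (x : lpa_gen E) (g : branch_point -> K) : branch_point -> K :=
  match x with
  | gvertex v => fun y => if y.1.1 == v then g y else 0
  | gedge e => fun y => if branch y.1.1 y.1.2 is Some (f, m)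
      then if f == e then g (grange e, m, y.2 - 1) else 0 else 0
  | gghost e => fun y =>
      if y.1.1 == grange e then g (gsource e, phi e y.1.2, y.2 + 1) else 0
  end.

(** Terms act directly on functions, without a bundled algebra of operators. Linearity of each
    operator is therefore a separate induction; it is what validates right distributivity in
    [act_pres]. *)
Fixpoint act (t : alg_term K (lpa_gen E)) (g : branch_point -> K) : branch_point -> K :=
  match t with
  | tgen x => gen_act x g
  | tzero => fun=> 0
  | topp t => fun y => - act t g y
  | tadd t u => fun y => act t g y + act u g y
  | tscale a t => fun y => a * act t g y
  | tmul t u => act t (act u g)
  end.

Lemma act_linear t a g h :
  act t (fun y => a * g y + h y) = (fun y => a * act t g y + act t h y).
Proof.
elim: t g h => [[v|e|e]||t IH|t IHt u IHu|b t IH|t IHt u IHu] g h /=;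
  rewrite ?IH ?IHt ?IHu; apply/funext => y /=.
- by case: ifP; rewrite ?mulr0 ?addr0.
- case: branch => [[f m]|]; last by rewrite mulr0 addr0.
  by case: ifP; rewrite ?mulr0 ?addr0.
- by case: ifP; rewrite ?mulr0 ?addr0.
- by rewrite mulr0 addr0.
- by rewrite opprD mulrN.
- by rewrite mulrDr !addrA; congr (_ + _); rewrite addrAC.
- by rewrite mulrDr !mulrA (mulrC b).
- by rewrite IHt.
Qed.

Lemma act0 t : act t (fun=> 0) = fun=> 0.
Proof.
have := act_linear t (- 1) (fun=> 0) (fun=> 0).
under eq_fun do rewrite mulr0 addr0.
by move=> ->; apply/funext => y; rewrite mulN1r addNr.
Qed.

Lemma actD t g h : act t (fun y => g y + h y) = (fun y => act t g y + act t h y).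
Proof.
have := act_linear t 1 g h; under eq_fun do rewrite mul1r.
by move=> ->; apply/funext => y; rewrite mul1r.
Qed.

Lemma actZ t a g : act t (fun y => a * g y) = (fun y => a * act t g y).
Proof.
have := act_linear t a g (fun=> 0); under eq_fun do rewrite addr0.
by move=> ->; apply/funext => y; rewrite act0 addr0.
Qed.

Lemma act_rel t u : lpa_rel t u -> act t = act u.
Proof.
case=> [v|v w vw|e|e|e|e|e|e f ef|v v0 vf]; apply/funext => g; apply/funext => y /=.
- by case: ifP => // ->.
- by case: eqP => // ->; case: eqP.
- case E1: branch => [[f m]|]; last by rewrite if_same.
  case: (y.1.1 =P gsource e) => // ye; case: eqP => // fe; case: ye.
  by have [<- _] := branchP E1; rewrite fe.
- by case: branch => [[f m]|] //; rewrite eqxx.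
- by case: eqP.
- by rewrite eqxx.
- case: eqP => // yg; rewrite branch_phi eqxx addrK -yg.
  by case: (y) => -[].
- by rewrite branch_phi; case: (eqVneq e f) => [fe|_]; [case: ef|case: ifP].
- transitivity (\sum_(e <- fset_set (emitted v))
      act (tmul (tgen (gedge e)) (tgen (gghost e))) g y); last first.
    by elim/big_rec2: _ => // e a b _ ->.
  have reg : regular v by [].
  rewrite /=; case: eqP => [yv|yv]; last first.
    rewrite big_seq big1// => e; rewrite in_fset_set// => /set_mem ev.
    case E1: branch => [[f m]|] //; case: eqP => // fe.
    by case: yv; have [<- _] := branchP E1; rewrite fe.
  (* At a regular vertex the point lies in the image of exactly one edge, and only that summand
     survives. *)
  case E1: (branch y.1.1 y.1.2) => [[f m]|]; last first.
    by case: (@branch_regular y.1.1 y.1.2); rewrite ?yv// -yv.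
  have [fs fm] := branchP E1.
  have fin : f \in (fset_set (emitted v) : seq _).
    by rewrite in_fset_set//; apply/mem_set; rewrite /emitted /= fs.
  rewrite (bigD1_seq f fin (fset_uniq _))/= eqxx big1 ?addr0 => [|e ef].
    by rewrite !eqxx fs fm subrK; case: (y) => -[].
  by rewrite eq_sym (negbTE ef).
Qed.

Lemma act_pres t u : pres_eq (@lpa_rel K E) t u -> act t = act u.
Proof.
elim=> //=.
- exact: act_rel.
- by move=> ? ? ? _ -> _ ->.
- by move=> ? ? _ ->.
- by move=> ? ? ? ? _ -> _ ->.
- by move=> ? ? ? _ ->.
- by move=> ? ? ? ? _ -> _ ->.
- by move=> *; apply/funext => g; apply/funext => y; rewrite addrA.
- by move=> *; apply/funext => g; apply/funext => y; rewrite addrC.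
- by move=> *; apply/funext => g; apply/funext => y; rewrite add0r.
- by move=> *; apply/funext => g; apply/funext => y; rewrite addNr.
- by move=> *; apply/funext => g; apply/funext => y; rewrite mulrA.
- by move=> *; apply/funext => g; apply/funext => y; rewrite mul1r.
- by move=> *; apply/funext => g; apply/funext => y; rewrite mulrDr.
- by move=> *; apply/funext => g; apply/funext => y; rewrite mulrDl.
- by move=> *; apply/funext => g; rewrite actD.
- by move=> *; apply/funext => g; rewrite actZ.
Qed.

Definition lact (a : leavitt K E) : (branch_point -> K) -> branch_point -> K := act (prepr a).

Lemma lact_class t : lact (pres_class (@lpa_rel K E) t) = act t.
Proof. exact/act_pres/(prepr_class (pres_equivalence (@lpa_rel K E))). Qed.

Lemma lact_linear c (a b : leavitt K E) g y :
  lact (c *: a + b) g y = c * lact a g y + lact b g y.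
Proof.
elim/pres_classW: a => t; elim/pres_classW: b => u.
by rewrite -pres_classZ -pres_classD !lact_class.
Qed.

Lemma lactM (a b : leavitt K E) g : lact (a ** b) g = lact a (lact b g).
Proof.
elim/pres_classW: a => t; elim/pres_classW: b => u.
by rewrite -pres_classM !lact_class.
Qed.

Lemma lact_sum (I : Type) (r : seq I) (F : I -> leavitt K E) g y :
  lact (\sum_(i <- r) F i) g y = \sum_(i <- r) lact (F i) g y.
Proof.
elim/big_rec2: _ => [|i a b _ <-]; first by rewrite -pres_class0 lact_class.
by rewrite -[F i]scale1r lact_linear mul1r scale1r.
Qed.

Lemma lactB (a b : leavitt K E) g y : lact (a - b) g y = lact a g y - lact b g y.
Proof. by rewrite addrC -scaleN1r lact_linear mulN1r addrC. Qed.

Definition delta (x : branch_point) : branch_point -> K := fun y => (y == x)%:R.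

Definition edge_point (e : edge E) (x : branch_point) : branch_point :=
  (gsource e, phi e x.1.2, x.2 + 1).

Lemma lact_vertex v x : lact (lpa_vertex K v) (delta x) =
  if x.1.1 == v then delta x else fun=> 0.
Proof.
rewrite lact_class; apply/funext => y /=; rewrite /delta.
case: (eqVneq y x) => [->|yx]; first by case: ifP; rewrite /= ?eqxx.
by rewrite if_same; case: ifP => //=; rewrite (negbTE yx).
Qed.

Lemma lact_edge e x : x.1.1 = grange e ->
  lact (lpa_edge K e) (delta x) = delta (edge_point e x).
Proof.
rewrite lact_class; case: x => -[u n] k /= xe; apply/funext => -[[w m] l] /=.
rewrite /delta /edge_point /=; case E1: branch => [[f i]|]; last first.
  case: eqP => // -[wE mE lE].
  by move: E1; rewrite wE mE branch_phi.
have [fs fm] := branchP E1.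
case: eqVneq => [fe|fe]; last first.
  case: eqP => // -[wE mE lE]; move: E1.
  by rewrite wE mE branch_phi => -[/eqP]; rewrite eq_sym (negbTE fe).
rewrite -xe -fs -fm fe !xpair_eqE !eqxx /= subr_eq.
congr (_ && _)%:R; apply/eqP/eqP => [->//|h].
by have [] := phi_inj (erefl (gsource e)) h.
Qed.

Lemma lact_edge_ghost e x : lact (lpa_edge K e ** lpa_ghost K e) (delta x) =
  if branch x.1.1 x.1.2 is Some (f, _)
  then if f == e then delta x else fun=> 0 else fun=> 0.
Proof.
rewrite /lpa_edge /lpa_ghost -pres_classM lact_class.
apply/funext => y /=; rewrite eqxx subrK /delta.
case: (eqVneq y x) => [->|yx].
  case E1: branch => [[f m]|] //; have [fs fm] := branchP E1.
  by case: eqP => // fe; rewrite -fe fs fm; case: (x) => -[] *; rewrite !eqxx.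
have -> : (if branch x.1.1 x.1.2 is Some (f, _)
  then if f == e then delta x else fun=> 0 else fun=> 0) y = 0.
  case: branch => [[f m]|] //; case: ifP => // _.
  by rewrite /delta (negbTE yx).
case E1: branch => [[f m]|] //; have [fs fm] := branchP E1.
case: eqP => // fe; rewrite -fe fs fm; case: y yx {E1 fs fm} => -[u n] k /= yx.
by rewrite (negbTE yx).
Qed.

End BranchingRepresentation.

(** * Vertices generate K_0(L(E)) *)

(* A finite set of edges of E splits each vertex w into the sum rp w of the
   projections e e^* over the chosen edges e leaving w, and the complement w - rp w,
   which becomes a sink; splitting each edge accordingly gives a finite graph. *)
Section SplitGraph.
Context (K : fieldType) (E : graph).
Variables (vs : seq (vertex E)) (es : seq (edge E)).
Hypothesis src_vs : forall e, e \in es -> gsource e \in vs.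
Hypothesis rng_vs : forall e, e \in es -> grange e \in vs.

Local Notation L := (leavitt K E).
Local Notation W := (@lpa_vertex K E).
Local Notation S := (@lpa_edge K E).
Local Notation T := (@lpa_ghost K E).

Definition split_vertex : finType := (seq_sub vs * bool)%type.
Definition split_edge : finType := (seq_sub es * bool)%type.

Definition split_src (e : split_edge) : split_vertex :=
  (SeqSub (src_vs (ssvalP e.1)), false).
Definition split_rng (e : split_edge) : split_vertex :=
  (SeqSub (rng_vs (ssvalP e.1)), e.2).

Definition rp (w : vertex E) : L :=
  \sum_(e : seq_sub es | gsource (ssval e) == w) S (ssval e) ** T (ssval e).

(** The value [true] marks the complement, so [v.2] is the sink predicate of the split graph. A copy
    marked [false] from which no chosen edge leaves is zero, in agreement with [ST] for an empty
    sum. *)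
Definition sq (w : vertex E) (t : bool) : L := if t then W w - rp w else rp w.

Lemma W_rp w : W w ** rp w = rp w.
Proof.
rewrite /rp -big_filter nmul_sumr !big_filter.
by apply: eq_bigr => e /eqP <-; rewrite nmulA lpa_VS.
Qed.

Lemma rp_W w : rp w ** W w = rp w.
Proof.
rewrite /rp -big_filter nmul_suml !big_filter.
by apply: eq_bigr => e /eqP <-; rewrite -nmulA lpa_TV.
Qed.

Lemma rp_S e : e \in es -> rp (gsource e) ** S e = S e.
Proof.
move=> ein; rewrite /rp -big_filter nmul_suml !big_filter.
rewrite (bigD1 (SeqSub ein)) ?eqxx//= -nmulA lpa_TS eqxx lpa_SV big1 ?addr0//.
move=> f /andP[_ fe]; rewrite -nmulA lpa_TS.
case: eqP => [fE|_]; last by rewrite nmulr0.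
by case/eqP: fe; apply: val_inj.
Qed.

Lemma T_rp e : e \in es -> T e ** rp (gsource e) = T e.
Proof.
move=> ein; rewrite /rp -big_filter nmul_sumr !big_filter.
rewrite (bigD1 (SeqSub ein)) ?eqxx//= nmulA lpa_TS eqxx lpa_VT big1 ?addr0//.
move=> f /andP[_ fe]; rewrite nmulA lpa_TS.
case: eqP => [fE|_]; last by rewrite nmul0r.
by case/eqP: fe; apply: val_inj.
Qed.

Lemma rp_rp w : rp w ** rp w = rp w.
Proof.
rewrite {2}/rp -big_filter nmul_sumr big_filter [RHS]/rp.
by apply: eq_bigr => e /eqP <-; rewrite nmulA rp_S// ssvalP.
Qed.

Lemma sq_W w t : sq w t ** W w = sq w t /\ W w ** sq w t = sq w t.
Proof.
by case: t; rewrite /sq ?nmulBl ?nmulBr ?W_rp ?rp_W ?lpa_vertexM ?eqxx.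
Qed.

Lemma sqM w t w' t' :
  sq w t ** sq w' t' = if (w == w') && (t == t') then sq w t else 0.
Proof.
case: eqVneq => [<-|ww] /=; last first.
  rewrite -(sq_W w t).1 -(sq_W w' t').2 nmulA -(nmulA _ (W w)) lpa_vertexM.
  by rewrite (negbTE ww) nmulr0 nmul0r.
by case: t t' => -[]; rewrite /sq ?nmulBl ?nmulBr ?W_rp ?rp_W ?rp_rp ?lpa_vertexM
  ?eqxx ?subrr ?subr0.
Qed.

Lemma sq_sum w : sq w false + sq w true = W w.
Proof. by rewrite /sq addrC subrK. Qed.

Definition split_P (v : split_vertex) : L := sq (ssval v.1) v.2.
Definition split_S (e : split_edge) : L := S (ssval e.1) ** split_P (split_rng e).
Definition split_T (e : split_edge) : L := split_P (split_rng e) ** T (ssval e.1).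

Lemma split_PP v w : split_P v ** split_P w = if v == w then split_P v else 0.
Proof. by rewrite /split_P sqM; case: v w => [v t] [w t']; rewrite xpair_eqE. Qed.

Lemma split_PS e : split_P (split_src e) ** split_S e = split_S e.
Proof. by rewrite nmulA rp_S// ssvalP. Qed.

Lemma split_SP e : split_S e ** split_P (split_rng e) = split_S e.
Proof. by rewrite -nmulA split_PP eqxx. Qed.

Lemma split_PT e : split_P (split_rng e) ** split_T e = split_T e.
Proof. by rewrite nmulA split_PP eqxx. Qed.

Lemma split_TP e : split_T e ** split_P (split_src e) = split_T e.
Proof. by rewrite -nmulA T_rp// ssvalP. Qed.

Lemma split_TS e f : split_T e ** split_S f = if e == f then split_P (split_rng e) else 0.
Proof.
rewrite nmulA -(nmulA _ (T _)) lpa_TS.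
case: e f => [e t] [f t'] /=; rewrite xpair_eqE -(inj_eq val_inj e f) /=.
case: eqP => [ef|_] /=; last by rewrite nmulr0 nmul0r.
by rewrite /split_P /= (sq_W _ t).1 ef sqM eqxx.
Qed.

Lemma split_ST (v : split_vertex) : ~~ v.2 ->
  split_P v = \sum_(e | split_src e == v) split_S e ** split_T e.
Proof.
case: v => w [] //= _; rewrite /split_P /= /rp.
rewrite [RHS](eq_bigl (fun e : split_edge => (gsource (ssval e.1) == ssval w) && true));
  last by move=> e; rewrite andbT xpair_eqE -(inj_eq val_inj) /= andbT.
rewrite -(pair_big_dep (fun e : seq_sub es => gsource (ssval e) == ssval w) (fun _ _ => true)
  (fun e t => split_S (e, t) ** split_T (e, t))) /=.
apply: eq_bigr => e _; rewrite big_bool /= /split_S /split_T /=.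
rewrite -!nmulA !(nmulA (split_P _) (split_P _)) !split_PP !eqxx.
rewrite -nmulDr -nmulDl [X in _ ** (X ** _)]addrC sq_sum lpa_VT.
by [].
Qed.

Local Notation one := (family_one split_P).

Lemma split_one : one = \sum_(w : seq_sub vs) W (ssval w).
Proof.
rewrite /family_one; transitivity (\sum_(w : seq_sub vs) \sum_t split_P (w, t)).
  by rewrite pair_bigA; apply: eq_bigr => -[].
by apply: eq_bigr => w _; rewrite big_bool /= addrC sq_sum.
Qed.

Lemma W_one w : w \in vs -> W w ** one = W w.
Proof.
move=> ww; rewrite split_one nmul_sumr (bigD1 (SeqSub ww))//= lpa_vertexM eqxx.
rewrite big1 ?addr0// => u uw; rewrite lpa_vertexM; case: eqP => // wu.
by case/eqP: uw; apply: val_inj.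
Qed.

Local Notation tm := (tame (split_src) split_rng (fun v : split_vertex => v.2) split_P split_S).

Lemma split_tameM x y : tm x -> tm y -> tm (x ** y).
Proof. exact: (tameM split_PP split_SP). Qed.

Lemma split_sink e : ~~ (fun v : split_vertex => v.2) (split_src e).
Proof. by []. Qed.

Lemma tame_W w : w \in vs -> tm (W w).
Proof.
move=> ww; rewrite -sq_sum; apply: tameD.
  exact: (tame_vertex _ _ split_PP split_SP (SeqSub ww, false)).
exact: (tame_vertex _ _ split_PP split_SP (SeqSub ww, true)).
Qed.

Lemma tame_S e : e \in es -> tm (S e).
Proof.
move=> ein; rewrite -lpa_SV -sq_sum nmulDr; apply: tameD.
  exact: (tame_edge _ split_PP split_PS split_SP (SeqSub ein, false)).
exact: (tame_edge _ split_PP split_PS split_SP (SeqSub ein, true)).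
Qed.

Lemma tame_T e : e \in es -> tm (T e).
Proof.
move=> ein; rewrite -lpa_VT -sq_sum nmulDl; apply: tameD.
  exact: (tame_ghost split_PP split_PS split_SP split_TP split_TS split_sink (SeqSub ein, false)).
exact: (tame_ghost split_PP split_PS split_SP split_TP split_TS split_sink (SeqSub ein, true)).
Qed.

Fixpoint covered (t : alg_term K (lpa_gen E)) : bool :=
  match t with
  | tgen (gvertex v) => v \in vs
  | tgen (gedge e) | tgen (gghost e) => e \in es
  | tzero => true
  | topp t | tscale _ t => covered t
  | tadd t u | tmul t u => covered t && covered u
  end.

Lemma covered_tame t : covered t ->
  tm (pres_class (@lpa_rel K E) t) /\
  pres_class (@lpa_rel K E) t ** one = pres_class (@lpa_rel K E) t.
Proof.
elim: t => [[v|e|e]||t IH|t IHt u IHu|a t IH|t IHt u IHu] /=.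
- by move=> vv; split; [exact: tame_W|exact: W_one].
- move=> ein; split; first exact: tame_S.
  by rewrite -[LHS]/(S e ** one) -lpa_SV -nmulA W_one ?rng_vs// lpa_SV.
- move=> ein; split; first exact: tame_T.
  by rewrite -[LHS]/(T e ** one) -lpa_TV -nmulA W_one ?src_vs// lpa_TV.
- by rewrite pres_class0 nmul0r; split=> //; apply: tame0.
- move=> /IH[tt t1]; rewrite pres_classN -scaleN1r nscalerAl t1; split=> //.
  exact: tameZ.
- move=> /andP[/IHt[tt t1] /IHu[ut u1]]; rewrite pres_classD nmulDl t1 u1.
  by split=> //; apply: tameD.
- move=> /IH[tt t1]; rewrite pres_classZ nscalerAl t1; split=> //.
  exact: tameZ.
- move=> /andP[/IHt[tt t1] /IHu[ut u1]]; rewrite pres_classM -nmulA u1.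
  by split=> //; apply: split_tameM.
Qed.

(** * Coefficient functionals for the split graph *)

Variable phi : edge E -> nat -> nat.
Hypothesis phi_inj : forall e f m n,
  gsource e = gsource f -> phi e m = phi f n -> e = f /\ m = n.
Hypothesis phi_surj : forall v n,
  regular v -> exists e m, gsource e = v /\ phi e m = n.

Local Notation ac := (lact phi).

Definition chosen (x : branch_point E) : bool :=
  if branch phi x.1.1 x.1.2 is Some (e, _) then e \in es else false.

(** Membership of [x] in the support of [split_P v]: points in the image of a chosen edge belong to
    [rp], the remaining ones to the complement. *)
Definition point_type (x : branch_point E) (v : split_vertex) : bool :=
  (x.1.1 == ssval v.1) && (chosen x == ~~ v.2).

Lemma point_type_inj x v w : point_type x v -> point_type x w -> v = w.
Proof.
case: v w => [v t] [w t'] /andP[/= /eqP xv /eqP xt] /andP[/= /eqP xw /eqP xt'].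
by congr (_, _); [apply: val_inj; rewrite /= -xv|apply: negb_inj; rewrite -xt].
Qed.

Lemma lact_rp x : ac (rp x.1.1) (delta K x) = if chosen x then delta K x else fun=> 0.
Proof.
apply/funext => y; rewrite /rp -big_filter (lact_sum phi_inj phi_surj) big_filter.
under eq_bigr do rewrite (lact_edge_ghost K phi_inj phi_surj).
rewrite /chosen; case E1: branch => [[f m]|]; last by rewrite big1.
have [fs fm] := branchP E1; case: ifP => fin.
  rewrite (bigD1 (SeqSub fin)) /= ?fs// eqxx big1 ?addr0// => e /andP[_ ef].
  by case: eqP => // fe; case/eqP: ef; apply: val_inj.
by rewrite big1// => e _; case: eqP => // fe; rewrite fe ssvalP in fin.
Qed.

Lemma lact_split_P x v : point_type x v -> ac (split_P v) (delta K x) = delta K x.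
Proof.
case: v => w t /andP[/= /eqP xw /eqP xt]; rewrite /split_P /= -xw /sq.
case: t xt => /= xt; last by rewrite lact_rp xt.
apply/funext => y; rewrite (lactB phi_inj phi_surj) lact_rp xt subr0.
by rewrite (lact_vertex K phi_inj phi_surj) eqxx.
Qed.

Definition split_point (e : split_edge) (x : branch_point E) : branch_point E :=
  edge_point phi (ssval e.1) x.

Lemma split_point_type e x : point_type (split_point e x) (split_src e).
Proof.
by rewrite /point_type /chosen /= eqxx (branch_phi phi_inj) ssvalP.
Qed.

Lemma lact_split_S e x : point_type x (split_rng e) ->
  ac (split_S e) (delta K x) = delta K (split_point e x).
Proof.
move=> xe; rewrite (lactM phi_inj phi_surj) lact_split_P//.
by rewrite (lact_edge K phi_inj phi_surj)//; case/andP: xe => /eqP.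
Qed.

Definition path_point (g : seq split_edge) (x : branch_point E) : branch_point E :=
  foldl (fun x e => split_point e x) x g.

Lemma lact_path v g x : is_path split_src split_rng v g ->
  point_type x (path_end split_rng v g) ->
  ac (path_elt split_P split_S v g) (delta K x) = delta K (path_point g x).
Proof.
elim: g x => [|e g IH] x /=; first by move=> _; apply: lact_split_P.
move=> /andP[vg /eqP eg] xe; rewrite (lactM phi_inj phi_surj) lact_split_S// IH//.
by rewrite -eg; apply: split_point_type.
Qed.

Lemma path_point_height g x : (path_point g x).2 = x.2 + (size g)%:Z.
Proof.
elim: g x => [|e g IH] x /=; first by rewrite addr0.
by rewrite IH /= -addrA.
Qed.

(** Peeling off edges from the start of the path, [phi_inj] recovers the edge of E, and the type of
    the point recovers which half of its range is meant. *)
Lemma path_point_inj v g w h x y :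
  is_path split_src split_rng v g -> is_path split_src split_rng w h ->
  point_type x (path_end split_rng v g) -> point_type y (path_end split_rng w h) ->
  size g = size h -> path_point g x = path_point h y ->
  [/\ v = w, g = h & x = y].
Proof.
elim: g h x y => [|e g IH] [|f h] x y //=.
  by move=> _ _ xv yw _ xy; rewrite -xy in yw *; rewrite (point_type_inj xv yw).
move=> /andP[vg /eqP eg] /andP[wh /eqP fh] xe yf [gh] /IH[]//.
- by rewrite -eg; apply: split_point_type.
- by rewrite -fh; apply: split_point_type.
move=> -> -> [/= es' ep /addIr xy2].
have [ef xy1] := phi_inj es' ep.
have xy : x = y.
  case/andP: xe => /eqP xe _; case/andP: yf => /eqP yf _.
  move: xe yf xy1 xy2 {ep}; case: x y => [[a b] c] [[a' b'] c'] /= -> -> -> ->.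
  by rewrite ef.
subst y; split=> //; congr (_ :: _).
have := point_type_inj xe yf; case: e f ef {xe yf eg fh es' ep} => [e t] [f t'] /= ef [_ ->].
by congr (_, _); apply: val_inj.
Qed.

(** Without points, a [rp] is an empty sum. A complement without points means that all edges leaving
    the vertex are chosen and at least one exists; the vertex is then regular and its relation makes
    the complement zero. *)
Lemma split_P_point v : split_P v != 0 -> exists x, point_type x v.
Proof.
case: v => w t; apply: contra_neqP => nx.
have nx' n k : chosen (ssval w, n, k) != ~~ t.
  by apply/negP => h; apply: nx; exists (ssval w, n, k); rewrite /point_type /= eqxx.
rewrite /split_P /=; case: t nx nx' => /= nx nx'; last first.
  rewrite /rp big_pred0// => e; apply/negP => /eqP ew.
  have /= := nx' (phi (ssval e) 0) 0.
  by rewrite /chosen /= -ew (branch_phi phi_inj) ssvalP.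
have ch n : chosen (ssval w, n, 0) by have := nx' n 0; rewrite eqbF_neg negbK.
have em_es e : emitted (ssval w) e -> e \in es.
  by move=> ew; have := ch (phi e 0); rewrite /chosen /= -ew (branch_phi phi_inj).
have wf : finite_set (emitted (ssval w)).
  by apply: (sub_finite_set (B := [set` es])) => //; apply: finite_seq.
have w0 : emitted (ssval w) !=set0.
  have := ch 0%N; rewrite /chosen /=; case E1: branch => [[e m]|] // _.
  by exists e; have [] := branchP E1.
rewrite (lpa_CK K w0 wf) /rp; apply/eqP; rewrite subr_eq0; apply/eqP.
rewrite -[RHS](big_map _ (fun e => gsource e == ssval w) (fun e => S e ** T e)).
rewrite -[RHS]big_filter; apply: perm_big; apply: uniq_perm.
- exact: fset_uniq.
- by rewrite filter_uniq// map_inj_uniq ?index_enum_uniq//; apply: val_inj.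
move=> e; rewrite in_fset_set// mem_filter; apply/idP/andP.
  move=> /set_mem ew; split; first exact/eqP.
  by apply/mapP; exists (SeqSub (em_es e ew)); rewrite ?mem_index_enum.
by move=> [/eqP ew _]; apply/mem_set.
Qed.

(** The coefficient of a path is read off by acting on a base point of its end and evaluating at the
    image of that point under the path. The height coordinate forces equal lengths, and then
    [path_point_inj] applies. *)
Lemma split_coef : exists coef : split_vertex -> seq split_edge -> L -> K,
  (forall v g c x y, coef v g (c *: x + y) = c * coef v g x + coef v g y) /\
  (forall v g w h, is_path split_src split_rng v g -> is_path split_src split_rng w h ->
    path_end split_rng v g = path_end split_rng w h ->
    split_P (path_end split_rng v g) != 0 ->
    coef v g (path_elt split_P split_S w h) = ((v, g) == (w, h))%:R).
Proof.
have base v : exists x, split_P v != 0 -> point_type x v.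
  have [Pv|Pv] := eqVneq (split_P v) 0; first by exists (ssval v.1, 0%N, 0).
  by have [x xv] := split_P_point Pv; exists x.
have [b bP] := choice base.
exists (fun v g a => let x := b (path_end split_rng v g) in
  ac a (delta K x) (path_point g x)); split=> [v g c x y|v g w h vg wh gh Pg].
  exact: (lact_linear phi_inj phi_surj).
have xg := bP _ Pg; set x := b _ in xg *; rewrite /= lact_path//; last by rewrite -gh.
rewrite /delta; congr (_ %:R); congr nat_of_bool; apply/eqP/eqP; last by case=> _ ->.
move=> gh'; have sz : size g = size h.
  have := congr1 snd gh'; rewrite !path_point_height => /addrI.
  by case.
by have [] := path_point_inj vg wh xg _ sz gh'; rewrite -?gh// => -> ->.
Qed.

Lemma split_class (p : minf L) : p ** p = p ->
  (forall i j, exists2 t, covered t & p i j = pres_class (@lpa_rel K E) t) ->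
  exists s : seq split_vertex, kc p = \sum_(v <- s) kc (corner (split_P v)).
Proof.
move=> ip pc; have [coef [coef_lin coef_path]] := split_coef.
apply: (finite_family_class split_PP split_PS split_SP split_PT split_TP split_TS
  split_ST split_sink coef_lin coef_path ip) => i j.
  by have [t ct ->] := pc i j; apply: (covered_tame ct).1.
by have [t ct ->] := pc i j; apply: (covered_tame ct).2.
Qed.

Lemma kc_rp w : kc (corner (rp w)) =
  \sum_(e : seq_sub es | gsource (ssval e) == w) kc (corner (W (grange (ssval e)))).
Proof.
rewrite /rp -big_filter linear_sum kc_sum ?filter_uniq ?index_enum_uniq// => [|e f].
  by rewrite big_filter; apply: eq_bigr => e _; rewrite /= kc_edge_ghost.
move=> _ _; rewrite -cornerM edge_ghostM -(inj_eq val_inj e f).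
by case: eqP => //; rewrite linear0.
Qed.

(** Splitting creates no classes outside the span of the vertices: [rp w] is a sum of ranges of
    edges, and the complement is a difference. *)
Lemma kc_split_P v : exists s1 s2 : seq (vertex E),
  kc (corner (split_P v)) =
    \sum_(w <- s1) kc (corner (W w)) - \sum_(w <- s2) kc (corner (W w)).
Proof.
case: v => w t; rewrite /split_P /=.
pose s : seq (vertex E) := [seq grange (ssval e) |
  e : seq_sub es <- [seq e : seq_sub es <- index_enum _ | gsource (ssval e) == ssval w]].
have rpE : kc (corner (rp (ssval w))) = \sum_(u <- s) kc (corner (W u)).
  by rewrite kc_rp big_map big_filter.
case: t => /=; last by exists s, [::]; rewrite rpE big_nil subr0.
exists [:: ssval w], s; rewrite -rpE big_cons big_nil addr0.
have -> : kc (corner (W (ssval w))) =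
    kc (corner (sq (ssval w) false)) + kc (corner (sq (ssval w) true)).
  by rewrite -(sq_sum (ssval w)) linearD kcD// -cornerM sqM ?eqxx ?andbF ?linear0//.
by rewrite [RHS]addrC addKr.
Qed.

End SplitGraph.

(** * From idempotents over L(E) to vertices *)

Section Generation.
Context (K : fieldType) (E : graph).
Hypothesis countableE : countable [set: edge E].
Local Notation L := (leavitt K E).
Local Notation vk v := (kc (corner (lpa_vertex K v))).

Fixpoint term_vertices (t : alg_term K (lpa_gen E)) : seq (vertex E) :=
  match t with
  | tgen (gvertex v) => [:: v]
  | tgen _ | tzero => [::]
  | topp t | tscale _ t => term_vertices t
  | tadd t u | tmul t u => term_vertices t ++ term_vertices u
  end.

Fixpoint term_edges (t : alg_term K (lpa_gen E)) : seq (edge E) :=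
  match t with
  | tgen (gedge e) | tgen (gghost e) => [:: e]
  | tgen _ | tzero => [::]
  | topp t | tscale _ t => term_edges t
  | tadd t u | tmul t u => term_edges t ++ term_edges u
  end.

Lemma coveredP (vs : seq (vertex E)) (es : seq (edge E)) t :
  {subset term_vertices t <= vs} -> {subset term_edges t <= es} ->
  covered vs es t.
Proof.
have catl (T : eqType) (a b c : seq T) : {subset a ++ b <= c} -> {subset a <= c}.
  by move=> h x xa; apply: h; rewrite mem_cat xa.
have catr (T : eqType) (a b c : seq T) : {subset a ++ b <= c} -> {subset b <= c}.
  by move=> h x xa; apply: h; rewrite mem_cat xa orbT.
elim: t => [[v|e|e]||t IH|t IHt u IHu|a t IH|t IHt u IHu] //= tv te.
- by apply: tv; rewrite mem_head.
- by apply: te; rewrite mem_head.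
- by apply: te; rewrite mem_head.
- by rewrite IHt ?IHu//; [apply: catr tv|apply: catr te|apply: catl tv|apply: catl te].
- by rewrite IHt ?IHu//; [apply: catr tv|apply: catr te|apply: catl tv|apply: catl te].
Qed.

Lemma leavitt_class (p : minf L) : p ** p = p ->
  exists s1 s2 : seq (vertex E), kc p = \sum_(v <- s1) vk v - \sum_(v <- s2) vk v.
Proof.
move=> ip; have [phi [phi_inj phi_surj]] := branching_function countableE.
set n := msize p; pose t i j := prepr (p i j).
(* Representing terms of the finitely many entries of [p] supply the chosen edges; the vertices are
   then closed under source and range. *)
pose es := flatten [seq term_edges (t i j) | i <- iota 0 n, j <- iota 0 n].
pose vs := flatten [seq term_vertices (t i j) | i <- iota 0 n, j <- iota 0 n]
  ++ [seq gsource e | e <- es] ++ [seq grange e | e <- es].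
have hs e : e \in es -> gsource e \in vs.
  by move=> ein; rewrite !mem_cat map_f ?orbT.
have hr e : e \in es -> grange e \in vs.
  by move=> ein; rewrite !mem_cat (map_f _ ein) !orbT.
have [|s ->] := @split_class K E vs es hs hr phi phi_inj phi_surj p ip.
  move=> i j; have [ij|ij] := boolP ((i < n)%N && (j < n)%N); last first.
    exists tzero => //; rewrite pres_class0 msizeP//.
    by move: ij; rewrite negb_and -!leqNgt.
  have [ir jr] : i \in iota 0 n /\ j \in iota 0 n by rewrite !mem_iota; apply/andP.
  exists (t i j); last by rewrite /pres_class preprK.
  apply: coveredP => x xt.
    rewrite mem_cat; apply/orP; left; apply/flattenP.
    by exists (term_vertices (t i j)) => //; apply/allpairsP; exists (i, j).
  apply/flattenP.
  by exists (term_edges (t i j)) => //; apply/allpairsP; exists (i, j).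
elim: s => [|v s [s1 [s2 IH]]]; first by exists [::], [::]; rewrite !big_nil subr0.
have [r1 [r2 vE]] := kc_split_P K es v.
exists (r1 ++ s1), (r2 ++ s2).
by rewrite big_cons !big_cat /= IH vE opprD addrACA.
Qed.

Lemma k0_leavitt_ext (G : zmodType) (f g : {additive K0 L -> G}) :
  (forall v, f (vk v) = g (vk v)) -> forall c, f c = g c.
Proof.
move=> fg; suff cl p : f (k0_class p) = g (k0_class p).
  elim/gcclassW => -[a b]; elim/vclassW: a => p; elim/vclassW: b => q.
  by rewrite k0_classB !raddfB !cl.
have [s1 [s2 pE]] := leavitt_class (idemP p); rewrite -kcE pE !raddfB !raddf_sum.
by congr (_ + _); apply: eq_bigr => v _; rewrite fg.
Qed.

End Generation.

Theorem theorem3p1 (K : fieldType) (E : graph) (R : algType K)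
    (E_nonempty : [set: vertex E] !=set0)
    (R_pis : purely_infinite_simple R)
    (xi : {additive K0 (leavitt K E) -> K0 R}) :
  [/\ countable_graph E ->
        exists psi : {nuhom leavitt K E -> minf R},
          (exists x, psi x != 0) /\
          (forall c, k0_map psi c = k0_map (@corner K R) (xi c)),
      finite_graph E ->
        exists psi : {nuhom leavitt K E -> R},
          (exists x, psi x != 0) /\ (forall c, k0_map psi c = xi c)
    & forall finV : finite_set [set: vertex E],
        countable [set: edge E] ->
        xi (k0_one (lpa_one_identity K finV)) = k0_one (one_identity R) ->
        exists phi : {nuhom leavitt K E -> R},
          phi (lpa_one K E) = 1 /\ (forall c, k0_map phi c = xi c)].
Proof.
have iV v : lpa_vertex K v ** lpa_vertex K v = lpa_vertex K v :> leavitt K E.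
  by rewrite lpa_vertexM eqxx.
have code (T : Type) : countable [set: T] -> exists code : T -> nat, injective code.
  case/countable_injP => f fi; exists f => x y; apply: fi; exact: in_setT.
have lift (p : vertex E -> R) : countable [set: edge E] ->
    (forall v w, p v * p w = if v == w then p v else 0) ->
    (forall v, realizes 1 (xi (kc (corner (lpa_vertex K v)))) (p v)) ->
    exists psi : {nuhom leavitt K E -> R},
      (forall v, psi (lpa_vertex K v) = p v) /\ forall c, k0_map psi c = xi c.
  move=> cE pp pk; have [||psi psiV] := realize_on_vertices R_pis cE pp (xi := xi).
  - by move=> v; case: (pk v).
  - by move=> v; case: (pk v).
  exists psi; split=> //; apply: k0_leavitt_ext => // v.
  by rewrite /= k0_map_corner// psiV; case: (pk v).
have orth : countable [set: vertex E] -> exists p : vertex E -> R,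
    (forall v w, p v * p w = if v == w then p v else 0) /\
    (forall v, realizes 1 (xi (kc (corner (lpa_vertex K v)))) (p v)).
  move=> /code[c ci]; apply: (orthogonal_realization R_pis _ ci).
    exact: mul1r.
  exact: oner_neq0.
(* For countable [E] there is already a homomorphism into [R] itself; (i) composes it with the
   corner inclusion, and (ii) is a special case. *)
have part1 : countable_graph E -> exists psi : {nuhom leavitt K E -> R},
    (exists x, psi x != 0) /\ (forall c, k0_map psi c = xi c).
  move=> [cV cE]; have [p [pp pk]] := orth cV.
  have [psi [psiV psiK]] := lift p cE pp pk.
  exists psi; split=> //; case: E_nonempty => v _.
  by exists (lpa_vertex K v); rewrite psiV; case: (pk v).
split.
- move=> cE; have [psi [[x x0] psiK]] := part1 cE.
  pose cpsi : {nuhom leavitt K E -> minf R} := @corner K R \o psi.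
  exists cpsi; split.
    exists x; apply: contraNneq x0 => h; apply/eqP/(@corner_inj K R).
    by rewrite linear0.
  apply: (k0_leavitt_ext cE.2 (f := k0_map cpsi) (g := k0_map (@corner K R) \o xi)).
  by move=> v; rewrite /= -psiK !k0_map_corner// -nmorphM iV.
- move=> [fV fE]; apply: part1.
  by split; apply: finite_set_countable.
- move=> fV cE unit.
  have [Q [QQ Qk]] := orth (finite_set_countable fV).
  set r : seq (vertex E) := fset_set [set: vertex E].
  have inr v : v \in r by rewrite in_fset_set// mem_setT.
  have oneE : lpa_one K E = \sum_(v <- r) lpa_vertex K v by exact: fsbig_finite.
  (* Unitality of [xi] supplies the equation between the class of 1 and the sum of the classes of
     the vertices. *)
  have [||||p [pp pk sump]] := partition_realization (r := r) _ _ _ QQ Qk.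
  - exact: fset_uniq.
  - by case: E_nonempty => v _; have := inr v; case: (r).
  - exact: mul1r.
  - have -> : kr (1 : R) = k0_one (one_identity R) by rewrite /k0_one -kcE.
    rewrite -unit /k0_one -kcE /= oneE linear_sum kc_sum ?fset_uniq ?raddf_sum// => v w _ _.
    by rewrite -cornerM lpa_vertexM; case: eqP => //; rewrite linear0.
  have [psi [psiV psiK]] := lift p cE (fun v w => pp v w (inr v) (inr w)) (fun v => pk v (inr v)).
  exists psi; split=> //; rewrite oneE linear_sum -[RHS]sump.
  by apply: eq_bigr => v _; apply: psiV.
Qed.
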